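(* Let $E=\{x_n\}\subseteq\mathbb{R}^d$ be a separated sequence, and let $\Lambda\subseteq\widehat{\mathbb{R}}^d$ be a compact S-set of strict multiplicity which is convex and symmetric about $0$. If balayage is possible for $(E,\Lambda)$, then there exist $A,B>0$ such that for all $f\in PW_\Lambda\setminus\{0\}$, $F=\widehat f$, $$A^{1/2}\frac{\int_\Lambda|F(\gamma)+F(2\gamma)+F(3\gamma)|^2\,d\gamma}{\left(\int_\Lambda|F(\gamma)|^2\,d\gamma\right)^{1/2}}\le\Big(\sum_{x\in E}|f(x)|^2\Big)^{1/2}+\frac12\Big(\sum_{x\in E}|f(\tfrac12x)|^2\Big)^{1/2}+\frac13\Big(\sum_{x\in E}|f(\tfrac13x)|^2\Big)^{1/2}\le B^{1/2}\Big(\int_\Lambda|F(\gamma)|^2\,d\gamma\Big)^{1/2}.$$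
   Context: Fourier transform $\widehat f(\gamma)=\int f(x)e^{-2\pi i x\cdot\gamma}dx$; $\widehat{\mathbb{R}}^d$ is $\mathbb{R}^d$ as frequency domain; $F$ is regarded as a function on $\widehat{\mathbb{R}}^d$ vanishing off $\Lambda$. $PW_\Lambda=\{f\in L^2(\mathbb{R}^d):\operatorname{supp}\widehat f\subseteq\Lambda\}$. $M_b(X)$: bounded complex Radon measures supported in closed $X$. $\mathcal{C}(\Lambda)=\{f\in C_b(\mathbb{R}^d):\operatorname{supp}\widehat f\subseteq\Lambda\}$. Balayage possible for $(E,\Lambda)$: every $\mu\in M_b(\mathbb{R}^d)$ has $\nu\in M_b(E)$ with $\widehat\mu=\widehat\nu$ on $\Lambda$. S-set: for all $f\in\mathcal{C}(\Lambda)$, $\mu\in M_b(\mathbb{R}^d)$ with $\widehat\mu=0$ on $\Lambda$, $\int f\,d\mu=0$. Strict multiplicity: some $\mu\in M_b(\Lambda)\setminus\{0\}$ with $|\mu^\vee(x)|\to0$ as $\|x\|\to\infty$. Separated: $\inf\{\|x-y\|:x\ne y\in E\}>0$. *)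

(* Defs.v *)
From HB Require Import structures.
From mathcomp Require Import all_boot all_order all_algebra.
From mathcomp Require Import all_classical all_reals all_analysis.
From mathcomp Require Import complex.

Set Implicit Arguments.
Unset Strict Implicit.
Unset Printing Implicit Defensive.

Import Order.TTheory GRing.Theory Num.Theory.
Import numFieldNormedType.Exports.

Local Open Scope classical_set_scope.
Local Open Scope ring_scope.

Section Defs.
Context {R : realType} {d : nat}.

(* R^d (and its dual \hat R^d) as row vectors *)
Notation Vec := 'rV[R]_d.

Definition Rd : Type := g_sigma_algebraType (@open Vec).
HB.instance Definition _ := Measurable.on Rd.

Definition vec_of (x : Rd) : Vec := x.

Definition dotv (x y : Vec) : R := \sum_(i < d) x ord0 i * y ord0 i.

Definition cabs2 (z : R[i]) : R := (complex.Re z) ^+ 2 + (complex.Im z) ^+ 2.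
Definition cabs (z : R[i]) : R := Num.sqrt (cabs2 z).

Definition expi (t : R) : R[i] := (cos t +i* sin t)%C.

Definition boxv (a b : Vec) : set Vec :=
  [set x | forall i : 'I_d, a ord0 i <= x ord0 i < b ord0 i].
Definition volv (a b : Vec) : R := \prod_(i < d) (b ord0 i - a ord0 i).
Definition lebesgue_d (A : set Rd) : \bar R :=
  ereal_inf [set (\sum_(0 <= k <oo) (volv (ab k).1 (ab k).2)%:E)%E |
    ab in [set ab : nat -> Vec * Vec |
      (forall k (i : 'I_d), (ab k).1 ord0 i <= (ab k).2 ord0 i) /\
      A `<=` \bigcup_k boxv (ab k).1 (ab k).2]].

Definition cintegral (mu : set Rd -> \bar R) (D : set Rd) (h : Rd -> R[i])
  : R[i] :=
  (fine (\int[mu]_(x in D) (complex.Re (h x))%:E)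
   +i* fine (\int[mu]_(x in D) (complex.Im (h x))%:E))%C.

Definition cmeasurable (h : Rd -> R[i]) : Prop :=
  measurable_fun setT (fun x => complex.Re (h x)) /\
  measurable_fun setT (fun x => complex.Im (h x)).

(* bounded complex (Radon) measures on R^d, written (via the Jordan
   decomposition) as mu = (m1 - m2) + i (m3 - m4) with finite positive
   Borel measures m_j *)
Record cmeasure := CMeasure {
  cm1 : {finite_measure set Rd -> \bar R};
  cm2 : {finite_measure set Rd -> \bar R};
  cm3 : {finite_measure set Rd -> \bar R};
  cm4 : {finite_measure set Rd -> \bar R} }.

Definition cmval (mu : cmeasure) (A : set Rd) : R[i] :=
  ((fine (cm1 mu A) - fine (cm2 mu A)) +i* (fine (cm3 mu A) - fine (cm4 mu A)))%C.

Definition cmint (mu : cmeasure) (g : Rd -> R[i]) : R[i] :=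
  cintegral (cm1 mu) setT g - cintegral (cm2 mu) setT g
  + 'i%C * (cintegral (cm3 mu) setT g - cintegral (cm4 mu) setT g).

Definition supported_in (mu : cmeasure) (X : set Vec) : Prop :=
  forall A : set Rd, measurable A -> A `<=` ~` X -> cmval mu A = 0.

Definition Mb (X : set Vec) (mu : cmeasure) : Prop := supported_in mu X.

Definition cm_hat (mu : cmeasure) (gamma : Vec) : R[i] :=
  cmint mu (fun x => expi (- (2 * pi) * dotv (vec_of x) gamma)).
Definition cm_check (mu : cmeasure) (x : Vec) : R[i] :=
  cmint mu (fun g => expi (2 * pi * dotv x (vec_of g))).

Fixpoint smooth_k (k : nat) (g : Vec -> R) : Prop :=
  continuous g /\
  match k with
  | 0 => True
  | k'.+1 => forall v : Vec, (forall x, derivable g x v) /\ smooth_k k' ('D_v g)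
  end.
Definition is_smooth (g : Vec -> R) : Prop := forall k, smooth_k k g.

Definition test_fun_on (U : set Vec) (phi : Vec -> R[i]) : Prop :=
  is_smooth (fun x => complex.Re (phi x)) /\ is_smooth (fun x => complex.Im (phi x)) /\
  exists K : set Vec, [/\ compact K, K `<=` U & forall x, ~ K x -> phi x = 0].

Definition fourier (h : Vec -> R[i]) (x : Vec) : R[i] :=
  cintegral lebesgue_d setT
    (fun g => h (vec_of g) * expi (- (2 * pi) * dotv x (vec_of g))).

(* C(Lambda): bounded continuous f whose distributional Fourier transform is
   supported in the closed set Lambda, i.e. <\hat f, phi> = \int f \hat phi = 0
   for every test function phi supported in the complement of Lambda *)
Definition CLambda (Lambda : set Vec) (f : Vec -> R[i]) : Prop :=
  [/\ continuous (fun x => complex.Re (f x)),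
      continuous (fun x => complex.Im (f x)),
      (exists M : R, forall x, cabs (f x) <= M) &
      forall phi, test_fun_on (~` Lambda) phi ->
        cintegral lebesgue_d setT
          (fun x => f (vec_of x) * fourier phi (vec_of x)) = 0].

Definition S_set (Lambda : set Vec) : Prop :=
  forall f mu, CLambda Lambda f -> (forall g, Lambda g -> cm_hat mu g = 0) ->
    cmint mu (fun x => f (vec_of x)) = 0.

Definition strict_multiplicity (Lambda : set Vec) : Prop :=
  exists mu, [/\ Mb Lambda mu, (exists A, measurable A /\ cmval mu A != 0) &
    forall e : R, 0 < e -> exists M : R, forall x : Vec, M < `|x| ->
      cabs (cm_check mu x) < e].

Definition balayage (E Lambda : set Vec) : Prop :=
  forall mu, exists nu, Mb E nu /\ forall g, Lambda g -> cm_hat mu g = cm_hat nu g.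

Definition is_separated (E : set Vec) : Prop :=
  exists delta : R, 0 < delta /\
    forall x y, E x -> E y -> x != y -> delta <= `|x - y|.

Definition is_convex (L : set Vec) : Prop :=
  forall x y (t : R), L x -> L y -> 0 <= t <= 1 -> L (t *: x + (1 - t) *: y).
Definition is_symmetric (L : set Vec) : Prop := forall x, L x -> L (- x).

(* Paley-Wiener functions: f(x) = \int_Lambda F(g) e^{2 pi i x.g} dg with
   F in L^2(Lambda), F = 0 off Lambda (so F = \hat f) *)
Definition PW_F (Lambda : set Vec) (F : Vec -> R[i]) : Prop :=
  [/\ cmeasurable (fun g => F (vec_of g)),
      (forall g, ~ Lambda g -> F g = 0) &
      (\int[lebesgue_d]_(g in (Lambda : set Rd)) (cabs2 (F (vec_of g)))%:E < +oo)%E].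
Definition PW_fun (Lambda : set Vec) (F : Vec -> R[i]) (x : Vec) : R[i] :=
  cintegral lebesgue_d Lambda
    (fun g => F (vec_of g) * expi (2 * pi * dotv x (vec_of g))).

Definition esqrt (x : \bar R) : \bar R :=
  match x with
  | EFin r => (Num.sqrt r)%:E
  | +oo%E => +oo%E
  | -oo%E => 0%E
  end.

End Defs.

(* Main.v *)
(** Balayage of point masses is a sampling inequality: if [g] is bounded with
    spectrum in [Lambda], [|g| <= 1], and [|g|] is small enough on [E], then
    [|g| <= 1/2] everywhere (gliding hump, tested on a measure
    [\sum_k 8^-k delta_(t_k)]).  Averaging over many scales extends this to
    spectra in [(1 + eps) Lambda], which leaves room to multiply by a decaying
    kernel; localised by this kernel, the sup-norm inequality compares l2 sums:
    the sum of [|g|^2] over any separated set is at most a constant times its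
    sum over [E].  With lattice points as the separated set, Parseval on a cube
    gives the lower estimate for [g x = f x + 2^-d f (x/2) + 3^-d f (x/3)],
    whose transform is [F + F (2 .) + F (3 .)].  For the upper estimate the
    roles are exchanged: [E / k] is separated, a fine lattice samples by
    Bernstein's inequality, and the lattice sum is bounded by Bessel.  A set
    [Lambda] without interior is null, and then [f = 0]. *)
Require Import Defs.
From HB Require Import structures.
From mathcomp Require Import all_boot all_order all_algebra.
From mathcomp Require Import finmap.
From mathcomp Require Import all_classical all_reals all_analysis.
From mathcomp Require Import measurable_realfun.
From mathcomp Require Import complex.
From mathcomp Require Import ring lra zify.

Set Implicit Arguments.
Unset Strict Implicit.
Unset Printing Implicit Defensive.

Import Order.TTheory GRing.Theory Num.Theory.
Import numFieldNormedType.Exports.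
Local Open Scope classical_set_scope.
Local Open Scope ring_scope.

(** * Lebesgue measure on R^d *)

Section outer_lebesgue.
Context {R : realType} {n : nat}.
Local Notation V := 'rV[R]_n.+1.
Local Notation T := (@Rd R n.+1).
Local Notation leb := (@lebesgue_d R n.+1).

(** Balayage gives, for each measure, some measure on E without any control of its norm; the gliding
    hump is what produces one constant for all functions. Spectra are encoded by bounded pointwise
    limits of trigonometric polynomials ([spec]), since equality of transforms on Lambda passes to
    such limits by dominated convergence alone, and products, dilations and translations act visibly
    on the frequencies.

    One scale is not enough to enlarge the spectrum: at distances where f has already moved but the
    kernel has not yet decayed, nothing is gained. Along lacunary scales a given point meets this
    intermediate zone at most once, so its share in the average can be made small.

    The quotient in the lower estimate is the product of two bounds. Let G be the squared norm of
    the combination of dilates, N that of F, and m the middle sum. Sampling gives G <= 3 C m^2,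
    expanding the square gives G <= 9 N, hence G^2 <= 27 C m^2 N. *)

Definition box_cover (A : set T) := [set ab : nat -> V * V |
  (forall k (i : 'I_n.+1), (ab k).1 ord0 i <= (ab k).2 ord0 i) /\
  A `<=` \bigcup_k boxv (ab k).1 (ab k).2].

Lemma volv_ge0 (a b : V) : (forall i, a ord0 i <= b ord0 i) -> 0 <= volv a b.
Proof. by move=> ab; apply: prodr_ge0 => i _; rewrite subr_ge0. Qed.

Lemma volv_diag (a : V) : volv a a = 0.
Proof. by rewrite /volv (bigD1 ord0) //= subrr mul0r. Qed.

Lemma cover_sum_ge0 (ab : nat -> V * V) :
  (forall k i, (ab k).1 ord0 i <= (ab k).2 ord0 i) ->
  (0 <= \sum_(0 <= k <oo) (volv (ab k).1 (ab k).2)%:E)%E.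
Proof.
by move=> h; apply: nneseries_ge0 => k _ _; rewrite lee_fin volv_ge0.
Qed.

Lemma leb_ge0 A : (0 <= leb A)%E.
Proof. by apply: le_ereal_inf_tmp => _ [ab [h _] <-]; exact: cover_sum_ge0. Qed.

Lemma leb_mono : {homo leb : A B / A `<=` B >-> (A <= B)%E}.
Proof.
move=> A B AB; apply: ereal_inf_le_tmp => _ [ab [h c] <-].
by exists ab => //; split => //; exact: subset_trans c.
Qed.

Lemma leb0 : leb set0 = 0%E.
Proof.
apply/eqP; rewrite eq_le leb_ge0 andbT; apply: ereal_inf_lbound.
exists (fun=> (0, 0)); first by split.
by rewrite eseries0 // => k _ _ /=; rewrite volv_diag.
Qed.

Lemma leb_box (a b : V) : (forall i, a ord0 i <= b ord0 i) ->
  (leb (boxv a b) <= (volv a b)%:E)%E.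
Proof.
move=> ab; apply: ereal_inf_lbound.
exists (fun k => if k == 0%N then (a, b) else (0, 0)).
  by split=> [[|k] i //=|x abx]; exists 0%N.
rewrite nneseries_recl//=; last first.
  by move=> k _; case: ifP => _; rewrite lee_fin ?volv_diag ?volv_ge0.
by rewrite eseries_cond /= eseries0 ?adde0// => -[|k] //= _ _; rewrite volv_diag.
Qed.

(** Covers of the [A k] that are optimal up to e / 2^(k+1) are merged into one sequence through a
    bijection between [nat] and pairs. *)
Lemma leb_sigma_subadditive : sigma_subadditive leb.
Proof.
move=> A; have [[i ioo]|] := pselect (exists i, leb (A i) = +oo%E).
  rewrite (eseries_pinfty _ _ ioo) ?leey// => k _.
  by rewrite -ltNye (lt_le_trans _ (leb_ge0 _)).
rewrite -forallNE => Aoo; apply/lee_addgt0Pr => e e0.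
apply: le_trans (epsilon_trick _ _ (ltW e0)); last by move=> ?; exact: leb_ge0.
pose P k (ab : nat -> V * V) := box_cover (A k) ab /\
  (\sum_(0 <= j <oo) (volv (ab j).1 (ab j).2)%:E <=
    leb (A k) + (e / (2 ^ k.+1)%:R)%:E)%E.
have [G PG] : {G & forall k, P k (G k)}.
  apply: (@choice _ _ P) => k.
  have e1 : 0 < e / (2 ^ k.+1)%:R by rewrite divr_gt0 // ltr0n expn_gt0.
  have Afin : leb (A k) \is a fin_num.
    by rewrite ge0_fin_numE ?leb_ge0// ltey; apply/eqP; exact: Aoo.
  have [_ [ab cab <-] /ltW] := lb_ereal_inf_adherent e1 Afin.
  by exists ab; split.
pose vol (ij : nat * nat) := (volv (G ij.1 ij.2).1 (G ij.1 ij.2).2)%:E.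
have vol0 ij : (0 <= vol ij)%E.
  by rewrite lee_fin volv_ge0// => l; apply: (PG ij.1).1.1.
apply: (@le_trans _ _ (\esum_(ij in [set: nat * nat]) vol ij)).
  have /card_esym/ppcard_eqP[f] := card_nat2.
  apply: ereal_inf_lbound; exists (fun k => G (f k).1 (f k).2).
    split=> [k i|x [k _ Akx]]; first exact: (PG (f k).1).1.1.
    have [j _ xj] := (PG k).1.2 _ Akx.
    by exists (f^-1%FUN (k, j)) => //=; rewrite invK ?inE.
  rewrite -(esum_pred_image vol _ xpredT) ?[fun=> _]set_true//.
  by rewrite image_eq.
have -> : (\esum_(ij in [set: nat * nat]) vol ij =
   \sum_(i <oo) \sum_(j <oo) vol (i, j))%E.
  rewrite [X in esum X _](_ : _ = setT `*`` (fun=> setT)); last first.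
    by apply/seteqP; split.
  rewrite -(@esum_esum _ _ _ setT (fun=> setT) (fun i j => vol (i, j)))//.
  rewrite nneseries_esumT//; last by move=> k; exact: nneseries_ge0.
  by apply: eq_esum => i _; rewrite nneseries_esumT.
apply: lee_nneseries => [k _ _|k _]; first exact: nneseries_ge0.
exact: (PG k).2.
Qed.

HB.instance Definition _ := isOuterMeasure.Build R T leb
  leb0 leb_ge0 leb_mono leb_sigma_subadditive.

Definition setc (a : V) (i : 'I_n.+1) (m : R) : V :=
  \row_j if j == i then m else a ord0 j.

Lemma volv_split (a b : V) i m :
  volv a b = volv a (setc b i m) + volv (setc a i m) b.
Proof.
rewrite /volv !(bigD1 (P := xpredT) i)//= !mxE !eqxx.
rewrite [X in _ = _ * X + _](eq_bigr (fun j => b ord0 j - a ord0 j)); last first.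
  by move=> j /negPf ji; rewrite mxE ji.
rewrite [X in _ = _ + _ * X](eq_bigr (fun j => b ord0 j - a ord0 j)); last first.
  by move=> j /negPf ji; rewrite mxE ji.
by rewrite -mulrDl; congr (_ * _); ring.
Qed.

Lemma halfspace_caratheodory (i : 'I_n.+1) (c : R) :
  leb.-caratheodory [set x : T | vec_of x ord0 i < c].
Proof.
apply: le_caratheodory_measurable => X.
apply: le_ereal_inf_tmp => _ [ab [h cX] <-].
(* The cutting level c is clamped to the side of the box, so that both pieces keep ordered corners;
   one of them may be degenerate. *)
pose m k := Order.max ((ab k).1 ord0 i) (Order.min ((ab k).2 ord0 i) c).
have am k : (ab k).1 ord0 i <= m k by rewrite le_max lexx.
have mb k : m k <= (ab k).2 ord0 i by rewrite ge_max h ge_min lexx.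
have -> : (\sum_(0 <= k <oo) (volv (ab k).1 (ab k).2)%:E =
   \sum_(0 <= k <oo) (volv (ab k).1 (setc (ab k).2 i (m k)))%:E +
   \sum_(0 <= k <oo) (volv (setc (ab k).1 i (m k)) (ab k).2)%:E)%E.
  rewrite -nneseriesD //.
  - by apply: eq_eseriesr => k _; rewrite -EFinD -volv_split.
  - by move=> k _ _; rewrite lee_fin volv_ge0// => j; rewrite mxE; case: eqP => [->|].
  - by move=> k _ _; rewrite lee_fin volv_ge0// => j; rewrite mxE; case: eqP => [->|].
apply: leeD; apply: ereal_inf_lbound.
- exists (fun k => ((ab k).1, setc (ab k).2 i (m k))) => //; split=> /=.
    by move=> k j; rewrite mxE; case: eqP => [->|].
  move=> x [/cX [k _ xk] /= xc]; exists k => // j; rewrite mxE.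
  have /andP[xa xb] := xk j; case: eqP => [ji|_]; last by rewrite xa xb.
  by subst j; rewrite xa lt_max lt_min xb xc orbT.
- exists (fun k => (setc (ab k).1 i (m k), (ab k).2)) => //; split=> /=.
    by move=> k j; rewrite mxE; case: eqP => [->|].
  move=> x [/cX [k _ xk] /= /negP xc]; exists k => // j; rewrite mxE.
  have /andP[xa xb] := xk j; case: eqP => [ji|_]; last by rewrite xa xb.
  by subst j; rewrite ge_max xa xb ge_min -leNgt in xc *; rewrite xc orbT.
Qed.
End outer_lebesgue.

Section borel.
Context {R : realType} {n : nat}.
Local Notation V := 'rV[R]_n.+1.
Local Notation T := (@Rd R n.+1).
Local Notation leb := (@lebesgue_d R n.+1).

Lemma le_coord_norm (x : V) i : `|x ord0 i| <= `|x|.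
Proof.
rewrite [leRHS]/Num.Def.normr/= mx_normrE.
exact: (@le_bigmax _ _ _ _ (fun ij : 'I_1 * 'I_n.+1 => `|x ij.1 ij.2|) (ord0, i)).
Qed.

Lemma norm_le_coord (x : V) e : (forall i, `|x ord0 i| <= e) -> `|x| <= e.
Proof.
move=> h; have e0 : 0 <= e by apply: le_trans (h ord0).
rewrite [leLHS]/Num.Def.normr/= mx_normrE; apply: bigmax_le => // -[i j] _ /=.
by rewrite ord1.
Qed.

Lemma halfspace_open (i : 'I_n.+1) (c : R) : open [set x : V | x ord0 i < c].
Proof.
apply: (@open_comp _ _ (fun x : V => x ord0 i) [set y | y < c]); last exact: open_lt.
by move=> x _; exact: coord_continuous.
Qed.

(* Every open set is a countable union of half-open boxes with rational corners. *)
Lemma borel_ind (P : set (set T)) : sigma_algebra setT P ->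
  (forall i c, P [set x : T | vec_of x ord0 i < c]) ->
  forall A, measurable A -> P A.
Proof.
move=> sP hP; apply: smallest_sub => // U Uo.
(* [TP] has P as its own sigma-algebra, so closure properties of P become measurability lemmas. *)
pose TP := g_sigma_algebraType P.
have mP (B : set T) : measurable (B : set TP) = P B.
  by rewrite /measurable /= smallest_id.
pose rb (ab : 'rV[rat]_n.+1 * 'rV[rat]_n.+1) : set V :=
  boxv (map_mx ratr ab.1) (map_mx ratr ab.2).
have -> : (U : set T) = \bigcup_ab (if `[< rb ab `<=` U >] then rb ab else set0).
  apply/seteqP; split => [x Ux|x [ab _]]; last by case: asboolP => [h /h|].
  have /nbhs_ballP[e /= e0 eU] : nbhs (x : V) U by apply: open_nbhs_nbhs.
  have ea i : exists a : rat, vec_of x ord0 i - e < ratr a < vec_of x ord0 i.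
    have /rat_in_itvoo[q] : vec_of x ord0 i - e < vec_of x ord0 i by lra.
    by rewrite in_itv /=; exists q.
  have eb i : exists b : rat, vec_of x ord0 i < ratr b < vec_of x ord0 i + e.
    have /rat_in_itvoo[q] : vec_of x ord0 i < vec_of x ord0 i + e by lra.
    by rewrite in_itv /=; exists q.
  have [a ha] := choice ea; have [b hb] := choice eb.
  exists (\row_i a i, \row_i b i) => //; case: asboolP => [_ i|].
    rewrite !mxE; have /andP[_ a1] := ha i; have /andP[b1 _] := hb i.
    by rewrite (ltW a1) b1.
  case=> y hy; apply: eU; split=> // k i; rewrite (ord1 k).
  have := hy i; rewrite !mxE => /andP[y1 y2].
  have /andP[a0 a1] := ha i; have /andP[b1 b2] := hb i.
  by rewrite /ball /= ltr_distlC; rewrite /vec_of in a0 b2; apply/andP; split; lra.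
rewrite -mP; apply: countable_bigcupT_measurable => // ab.
case: ifP => _; last exact: measurable0.
have -> : rb ab = \big[setI/setT]_(i < n.+1)
   ([set x : T | vec_of x ord0 i < ratr (ab.2 ord0 i)] `\`
    [set x : T | vec_of x ord0 i < ratr (ab.1 ord0 i)]).
  rewrite -bigcap_seq; apply/seteqP; split => [x xab i _|x h i].
    have /andP[] := xab i; rewrite !mxE => x1 x2; split => //=.
    by apply/negP; rewrite -leNgt.
  by have [/= + /negP] := h i (mem_index_enum i); rewrite -leNgt !mxE => -> ->.
apply: (@bigsetI_measurable _ TP) => i _.
by apply: measurableD; rewrite mP.
Qed.

Lemma measurable_caratheodory (A : set T) : measurable A -> leb.-caratheodory A.
Proof.
apply: borel_ind; last by move=> i c; exact: halfspace_caratheodory.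
exact: (@sigma_algebra_measurable _ (caratheodory_type leb)).
Qed.

Lemma leb_sigma_additive : semi_sigma_additive leb.
Proof.
move=> F mF tF mU.
apply: (@caratheodory_measure_sigma_additive _ _ leb) => //.
- by move=> i; exact: measurable_caratheodory.
- exact: measurable_caratheodory.
Qed.

HB.instance Definition _ := isMeasure.Build _ T R leb
  leb0 leb_ge0 leb_sigma_additive.

End borel.

(** * Complex modulus and unimodular exponentials *)

Section complex_modulus.
Context {R : realType}.
Implicit Types (z w : R[i]) (t : R).
Local Notation Re := complex.Re.
Local Notation Im := complex.Im.

Lemma ReD z w : Re (z + w) = Re z + Re w. Proof. by case: z; case: w. Qed.
Lemma ImD z w : Im (z + w) = Im z + Im w. Proof. by case: z; case: w. Qed.
Lemma ReN z : Re (- z) = - Re z. Proof. by case: z. Qed.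
Lemma ImN z : Im (- z) = - Im z. Proof. by case: z. Qed.
Lemma ReB z w : Re (z - w) = Re z - Re w. Proof. by rewrite ReD ReN. Qed.
Lemma ImB z w : Im (z - w) = Im z - Im w. Proof. by rewrite ImD ImN. Qed.
Lemma ReM z w : Re (z * w) = Re z * Re w - Im z * Im w.
Proof. by case: z; case: w. Qed.
Lemma ImM z w : Im (z * w) = Re z * Im w + Im z * Re w.
Proof. by case: z; case: w. Qed.
Lemma ReJ z : Re (z^*)%C = Re z. Proof. by case: z. Qed.
Lemma ImJ z : Im (z^*)%C = - Im z. Proof. by case: z. Qed.

Lemma complex_ext z w : Re z = Re w -> Im z = Im w -> z = w.
Proof. by case: z => a b; case: w => c e /= -> ->. Qed.

Lemma Re_sum (I : Type) (r : seq I) (F : I -> R[i]) :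
  Re (\sum_(i <- r) F i) = \sum_(i <- r) Re (F i).
Proof. by elim/big_rec2: _ => // i x y _ <-; rewrite ReD. Qed.

Lemma cabs2_ge0 z : 0 <= cabs2 z. Proof. by rewrite addr_ge0 ?sqr_ge0. Qed.

Lemma cabs2M z w : cabs2 (z * w) = cabs2 z * cabs2 w.
Proof. by rewrite /cabs2 ReM ImM; ring. Qed.

Lemma cabs2E z : cabs2 z = cabs z ^+ 2.
Proof. by rewrite sqr_sqrtr ?cabs2_ge0. Qed.

Lemma cabs_ge0 z : 0 <= cabs z. Proof. exact: sqrtr_ge0. Qed.

Lemma cabs_normc z : cabs z = Normc.normc z. Proof. by case: z. Qed.

Lemma cabsM z w : cabs (z * w) = cabs z * cabs w.
Proof. by rewrite /cabs cabs2M sqrtrM ?cabs2_ge0. Qed.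

Lemma cabsD z w : cabs (z + w) <= cabs z + cabs w.
Proof. by rewrite !cabs_normc le_normcD. Qed.

Lemma cabsN z : cabs (- z) = cabs z.
Proof. by rewrite /cabs /cabs2 ReN ImN !sqrrN. Qed.

Lemma cabsBC z w : cabs (z - w) = cabs (w - z).
Proof. by rewrite -cabsN opprB. Qed.

Lemma cabs_triang w z u : cabs (z - u) <= cabs (z - w) + cabs (w - u).
Proof. by have := cabsD (z - w) (w - u); rewrite subrKA. Qed.

Lemma cabsB z w : cabs (z - w) <= cabs z + cabs w.
Proof. by apply: le_trans (cabsD _ _) _; rewrite cabsN. Qed.

Lemma cabs_sub z w : cabs z <= cabs (z - w) + cabs w.
Proof. by rewrite -{1}(subrK w z) cabsD. Qed.

Lemma cabs2J z : cabs2 (z^*)%C = cabs2 z.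
Proof. by rewrite /cabs2 ReJ ImJ sqrrN. Qed.

Lemma cabs_real t : cabs (t%:C)%C = `|t|.
Proof. by rewrite /cabs /cabs2 /= expr0n addr0 sqrtr_sqr. Qed.

Lemma cabs0 : cabs (0 : R[i]) = 0. Proof. by rewrite (cabs_real 0) normr0. Qed.
Lemma cabs20 : cabs2 (0 : R[i]) = 0. Proof. by rewrite cabs2E cabs0 expr0n. Qed.

Lemma cabs_eq0 z : cabs z = 0 -> z = 0.
Proof. by rewrite cabs_normc; exact: Normc.eq0_normc. Qed.

Lemma Re_le_cabs z : `|Re z| <= cabs z.
Proof. by rewrite -sqrtr_sqr ler_wsqrtr// lerDl sqr_ge0. Qed.

Lemma Im_le_cabs z : `|Im z| <= cabs z.
Proof. by rewrite -sqrtr_sqr ler_wsqrtr// lerDr sqr_ge0. Qed.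

Lemma cabs_le_ReIm z : cabs z <= `|Re z| + `|Im z|.
Proof.
rewrite -(@ler_pXn2r _ 2)// ?nnegrE ?addr_ge0 ?cabs_ge0// -cabs2E /cabs2.
by rewrite sqrrD !real_normK ?num_real// addrAC lerDl mulrn_wge0// mulr_ge0.
Qed.

Lemma cabs_sum (I : Type) (r : seq I) (F : I -> R[i]) :
  cabs (\sum_(i <- r) F i) <= \sum_(i <- r) cabs (F i).
Proof.
elim/big_rec2: _ => [|i x y _ h]; first by rewrite cabs0.
by apply: le_trans (cabsD _ _) _; rewrite lerD2l.
Qed.

Lemma cabs2D z w : cabs2 (z + w) <= 2 * (cabs2 z + cabs2 w).
Proof.
rewrite -subr_ge0 (_ : _ - _ = (Re z - Re w) ^+ 2 + (Im z - Im w) ^+ 2).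
  by rewrite addr_ge0 ?sqr_ge0.
by rewrite /cabs2 ReD ImD; ring.
Qed.

Lemma cabs2D3 z w u : cabs2 (z + w + u) <= 3 * (cabs2 z + cabs2 w + cabs2 u).
Proof.
rewrite -subr_ge0 (_ : _ - _ = (Re z - Re w) ^+ 2 + (Re z - Re u) ^+ 2 +
  (Re w - Re u) ^+ 2 + ((Im z - Im w) ^+ 2 + (Im z - Im u) ^+ 2 +
  (Im w - Im u) ^+ 2)); first by rewrite !addr_ge0 ?sqr_ge0.
by rewrite /cabs2 !ReD !ImD; ring.
Qed.

Lemma cabs2_le z M : 0 <= M -> (cabs2 z <= M ^+ 2) = (cabs z <= M).
Proof. by move=> M0; rewrite cabs2E ler_pXn2r// nnegrE cabs_ge0. Qed.

Lemma mulJ_cabs2 z : (z * z^*)%C = ((cabs2 z)%:C)%C.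
Proof. by apply: complex_ext; rewrite ?ReM ?ImM ReJ ImJ /= /cabs2; ring. Qed.

Lemma sin_le_norm t : `|sin t| <= `|t|.
Proof.
wlog t0 : t / 0 <= t.
  move=> h; have [/h//|t0] := leP 0 t.
  by rewrite -normrN -sinN -(normrN t); apply: h; rewrite oppr_ge0 ltW.
have [c _ /eqP] := @MVT_segment R sin cos 0 t t0 (fun x _ => is_derive_sin x)
  (continuous_subspaceT (@continuous_sin R)).
by rewrite sin0 !subr0 => /eqP ->; rewrite normrM ler_piMl// cos_max.
Qed.

Lemma expiD (s t : R) : expi (s + t) = expi s * expi t.
Proof.
by apply: complex_ext; rewrite ?ReM ?ImM /= ?cosD ?sinD //; ring.
Qed.

Lemma expi0 : expi (0 : R) = 1.
Proof. by rewrite /expi cos0 sin0. Qed.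

Lemma expiN t : expi (- t) = (expi t)^*%C.
Proof. by rewrite /expi cosN sinN. Qed.

Lemma cabs2_expi t : cabs2 (expi t) = 1. Proof. exact: cos2Dsin2. Qed.

Lemma cabs_expi t : cabs (expi t) = 1.
Proof. by rewrite /cabs cabs2_expi sqrtr1. Qed.

(** The chord between two points of the unit circle has length 2 |sin ((s - t) / 2)|. *)
Lemma expi_lip (s t : R) : cabs (expi s - expi t) <= `|s - t|.
Proof.
rewrite -cabs2_le//.
have h : (s - t) / 2 + (s - t) / 2 = s - t by lra.
have -> : cabs2 (expi s - expi t) = (2 * sin ((s - t) / 2)) ^+ 2.
  transitivity (2 - 2 * cos (s - t)).
    rewrite /cabs2 ReB ImB /= cosB.
    have := cos2Dsin2 s; have := cos2Dsin2 t; set a := cos s; set b := sin s.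
    set c := cos t; set e := sin t => h1 h2.
    have -> : (a - c) ^+ 2 + (b - e) ^+ 2 =
       (a ^+ 2 + b ^+ 2) + (c ^+ 2 + e ^+ 2) - 2 * (a * c + b * e) by ring.
    by rewrite h1 h2; ring.
  rewrite -{1}h cosD -!expr2 cos2sin2 exprMn; ring.
have := sin_le_norm ((s - t) / 2); set u := (s - t) / 2.
rewrite (_ : s - t = 2 * u); last by rewrite /u; field.
move=> hu; rewrite normrM exprMn [leRHS]exprMn.
rewrite [X in _ <= X * _](_ : _ = 2 ^+ 2); last by rewrite ger0_norm.
by rewrite ler_pM2l// -(real_normK (num_real (sin u))) ler_pXn2r// nnegrE.
Qed.

End complex_modulus.

(** * Translations and dilations of Lebesgue measure *)

Section invariance.
Context {R : realType} {n : nat}.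
Local Notation V := 'rV[R]_n.+1.
Local Notation T := (@Rd R n.+1).
Local Notation leb := (@lebesgue_d R n.+1).

Lemma measurable_open (A : set V) : open A -> measurable (A : set T).
Proof. exact: sub_sigma_algebra. Qed.

Lemma measurable_closed (A : set V) : closed A -> measurable (A : set T).
Proof.
by move=> cA; rewrite -(setCK A); apply: measurableC; apply: measurable_open; rewrite openC.
Qed.

Lemma continuous_measurable_Rd (f : V -> R) : continuous f ->
  measurable_fun (setT : set T) (f : T -> R).
Proof.
move=> cf; apply: (measurability _ (@RGenOpens.measurableE R)).
move=> _ [_ [a [b ->] <-]]; rewrite setTI; apply: measurable_open.
by move/continuousP : cf; apply; exact: interval_open.
Qed.

Lemma continuous_measurable_RdRd (f : V -> V) : continuous f ->
  measurable_fun (setT : set T) (f : T -> T).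
Proof.
move=> cf; apply: (@measurability _ _ T T setT f (@open V)) => //.
move=> _ [A oA <-]; rewrite setTI; apply: measurable_open.
by move/continuousP : cf; apply.
Qed.

Lemma measurable_box (a b : V) : measurable (boxv a b : set T).
Proof.
rewrite (_ : boxv a b = \big[setI/setT]_(i < n.+1)
   (~` [set x : V | x ord0 i < a ord0 i] `&` [set x : V | x ord0 i < b ord0 i])).
  apply: bigsetI_measurable => i _; apply: measurableI.
    by apply: measurableC; apply: measurable_open; exact: halfspace_open.
  by apply: measurable_open; exact: halfspace_open.
rewrite -bigcap_seq; apply/seteqP; split => [x xab i _|x h i].
  by have /andP[x1 x2] := xab i; split => //=; apply/negP; rewrite -leNgt.
by have [/= /negP + ->] := h i (mem_index_enum i); rewrite -leNgt => ->.
Qed.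

Definition shiftv (v : V) : T -> T := fun x => vec_of x + v.
Definition dilatev (c : R) : T -> T := fun x => c *: vec_of x.

Lemma measurable_shift (v : V) : measurable_fun [set: T] (shiftv v).
Proof.
apply: continuous_measurable_RdRd => x.
have F : Filter (nbhs x) := nbhs_filter x.
by apply: (@cvgD _ _ _ (nbhs x) _ (fun x => x) (cst v) x v); last exact: cvg_cst.
Qed.

Lemma measurable_dilate (c : R) : measurable_fun [set: T] (dilatev c).
Proof.
apply: continuous_measurable_RdRd => x.
have F : Filter (nbhs x) := nbhs_filter x.
exact: (@cvgZl_tmp _ _ _ (nbhs x) _ c (fun x => x)).
Qed.

Lemma leb_shift_le (v : V) (A : set T) :
  (leb (shiftv v @^-1` A) <= leb A)%E.
Proof.
apply: le_ereal_inf_tmp => _ [ab [h cA] <-].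
apply: ereal_inf_lbound; exists (fun k => ((ab k).1 - v, (ab k).2 - v)).
  split => [k i|x /= /cA [k _ xk]]; first by rewrite /= !mxE lerD2r.
  by exists k => // i; have := xk i; rewrite !mxE lerBlDr ltrBrDr.
apply: eq_eseriesr => k _; congr (_%:E); apply: eq_bigr => i _.
by rewrite !mxE; ring.
Qed.

Lemma leb_shift (v : V) (A : set T) : leb (shiftv v @^-1` A) = leb A.
Proof.
apply/eqP; rewrite eq_le leb_shift_le /=.
rewrite {1}(_ : A = shiftv (- v) @^-1` (shiftv v @^-1` A)).
  exact: leb_shift_le.
by apply/seteqP; split => x; rewrite /shiftv /vec_of /= subrK.
Qed.

(** A cover of A scaled by c^-1 covers the preimage. The converse inequality comes from applying
    this one to c^-1. *)
Lemma leb_dilate_le (c : R) (A : set T) : 0 < c ->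
  ((c ^+ n.+1)%:E * leb (dilatev c @^-1` A) <= leb A)%E.
Proof.
move=> c0; apply: le_ereal_inf_tmp => _ [ab [h cA] <-].
pose ab' k := (c^-1 *: (ab k).1, c^-1 *: (ab k).2).
have h' k i : (ab' k).1 ord0 i <= (ab' k).2 ord0 i.
  by rewrite !mxE ler_pM2l ?invr_gt0.
apply: (@le_trans _ _ ((c ^+ n.+1)%:E *
   \sum_(0 <= k <oo) (volv (ab' k).1 (ab' k).2)%:E)%E).
  rewrite lee_pmul2l ?lte_fin ?exprn_gt0//.
  apply: ereal_inf_lbound; exists ab' => //; split => // x /= /cA [k _ xk].
  exists k => // i; have := xk i; rewrite !mxE.
  by rewrite ler_pdivrMl// ltr_pdivlMl.
rewrite -nneseriesZl; last by move=> k _; rewrite lee_fin volv_ge0.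
rewrite le_eqVlt; apply/orP; left; apply/eqP; apply: eq_eseriesr => k _.
rewrite -EFinM; congr (_%:E).
rewrite /volv (eq_bigr (fun i => c^-1 * ((ab k).2 ord0 i - (ab k).1 ord0 i))).
  by rewrite big_split /= prodr_const card_ord mulrA -exprMn divff ?gt_eqF// expr1n mul1r.
by move=> i _; rewrite !mxE mulrBr.
Qed.

Lemma leb_dilate (c : R) (A : set T) : 0 < c ->
  ((c ^+ n.+1)%:E * leb (dilatev c @^-1` A) = leb A)%E.
Proof.
move=> c0; apply/eqP; rewrite eq_le leb_dilate_le //=.
set B := _ @^-1` A.
have -> : A = dilatev c^-1 @^-1` B.
  by apply/seteqP; split => x; rewrite /B /dilatev /vec_of /= scalerA divff ?gt_eqF// scale1r.
have ci : 0 < c^-1 by rewrite invr_gt0.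
have cn : 0 < c ^+ n.+1 by rewrite exprn_gt0.
have := leb_dilate_le B ci; rewrite -(@lee_pmul2l _ (c ^+ n.+1)%:E)// ?lte_fin// muleA -EFinM.
by rewrite exprVn divff ?gt_eqF// mul1e.
Qed.

Lemma ge0_integral_shift (v : V) (f : T -> \bar R) :
  measurable_fun [set: T] f -> (forall x, 0 <= f x)%E ->
  (\int[leb]_x f (shiftv v x) = \int[leb]_x f x)%E.
Proof.
move=> mf f0.
have := @ge0_integral_pushforward _ _ T T R _ (measurable_shift v) leb setT f
  measurableT mf (fun y _ => f0 y).
rewrite preimage_setT => <-; apply: eq_measure_integral => [|hv A mA _].
  exact: (measurable_shift v).
exact: (leb_shift v A).
Qed.

Lemma integral_shift (v : V) (f : T -> \bar R) : measurable_fun [set: T] f ->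
  (\int[leb]_x f (shiftv v x) = \int[leb]_x f x)%E.
Proof.
move=> mf; rewrite integralE [RHS]integralE.
congr (_ - _)%E.
  rewrite -[RHS](@ge0_integral_shift v f^\+%E) //; last exact: measurable_funepos.
  by apply: eq_integral => x _; rewrite !funeposE.
rewrite -[RHS](@ge0_integral_shift v f^\-%E) //; last exact: measurable_funeneg.
by apply: eq_integral => x _; rewrite !funenegE.
Qed.

Lemma ge0_integral_dilate (c : R) (f : T -> \bar R) : 0 < c ->
  measurable_fun [set: T] f -> (forall x, 0 <= f x)%E ->
  ((c ^+ n.+1)%:E * \int[leb]_x f (dilatev c x) = \int[leb]_x f x)%E.
Proof.
move=> c0 mf f0.
have := @ge0_integral_pushforward _ _ T T R _ (measurable_dilate c) leb setT f
  measurableT mf (fun y _ => f0 y).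
rewrite preimage_setT => <-.
have cn : 0 <= c ^+ n.+1 by rewrite exprn_ge0 ?ltW.
have := @ge0_integral_mscale _ T R (pushforward leb (dilatev c))
  setT measurableT (NngNum cn) f mf (fun y _ => f0 y).
move=> /= <-; first exact: measurable_dilate.
move=> hd; apply: eq_measure_integral => A mA _.
exact: leb_dilate.
Qed.

Lemma integrable_dilate (c : R) (f : T -> \bar R) : 0 < c ->
  leb.-integrable setT f -> leb.-integrable setT (fun x => f (dilatev c x)).
Proof.
move=> c0 /integrableP[mf iff]; apply/integrableP; split.
  exact: (measurableT_comp mf (measurable_dilate c)).
move: iff; rewrite -(@ge0_integral_dilate c (fun x => `|f x|%E))//; last exact: measurableT_comp.
have cn : 0 < c ^+ n.+1 by rewrite exprn_gt0.
set I := integral _ _ _; case: (ltP I +oo%E) => //; rewrite leye_eq => /eqP ->.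
by rewrite mulry gtr0_sg// mul1e.
Qed.

Lemma integrable_shift (v : V) (f : T -> \bar R) :
  leb.-integrable setT f -> leb.-integrable setT (fun x => f (shiftv v x)).
Proof.
move=> /integrableP[mf iff]; apply/integrableP; split.
  exact: (measurableT_comp mf (measurable_shift v)).
rewrite (@ge0_integral_shift v (fun x => `|f x|%E))//; exact: measurableT_comp.
Qed.

Lemma integral_dilate (c : R) (f : T -> \bar R) : 0 < c ->
  leb.-integrable setT f ->
  ((c ^+ n.+1)%:E * \int[leb]_x f (dilatev c x) = \int[leb]_x f x)%E.
Proof.
move=> c0 iff; have mf := measurable_int _ iff.
rewrite integralE [RHS]integralE muleBr//; last first.
  apply: integrable_add_def => //; exact: integrable_dilate.
congr (_ - _)%E.
  rewrite -[RHS](@ge0_integral_dilate c f^\+%E c0) //; last exact: measurable_funepos.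
  by congr (_ * _)%E; apply: eq_integral => x _; rewrite !funeposE.
rewrite -[RHS](@ge0_integral_dilate c f^\-%E c0) //; last exact: measurable_funeneg.
by congr (_ * _)%E; apply: eq_integral => x _; rewrite !funenegE.
Qed.

End invariance.

(** * Complex-valued integrals *)

Lemma cvg_lower {R : realType} (c l : R) (w : nat -> R) :
  (forall k, c <= w k) -> w k @[k --> \oo] --> l -> c <= l.
Proof. by move=> cw wl; apply: (cvgr_to_ge wl); exact: nearW. Qed.

Section ccvg.
Context {R : realType}.
Implicit Types (u v : nat -> R[i]) (l m : R[i]).

(** Stated through a real null sequence, so that squeezing and the limit rules of R apply
    directly. *)
Definition ccvg (u : nat -> R[i]) (l : R[i]) := cabs (u k - l) @[k --> \oo] --> (0 : R).


Lemma ccvg_cst l : ccvg (fun=> l) l.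
Proof. by rewrite /ccvg subrr cabs0; exact: cvg_cst. Qed.

Lemma ccvg_squeeze u l (e : nat -> R) :
  (forall k, cabs (u k - l) <= e k) -> e k @[k --> \oo] --> (0 : R) -> ccvg u l.
Proof.
move=> ue e0; apply: (squeeze_cvgr _ (cvg_cst 0) e0).
by apply: nearW => k; rewrite cabs_ge0 ue.
Qed.

Lemma ccvgD u v l m : ccvg u l -> ccvg v m -> ccvg (fun k => u k + v k) (l + m).
Proof.
move=> ul vm; apply: ccvg_squeeze (fun k => cabs (u k - l) + cabs (v k - m)) _ _.
  by move=> k; rewrite opprD addrACA cabsD.
by rewrite -(addr0 (0 : R)); exact: cvgD.
Qed.

Lemma ccvgM u v l m : ccvg u l -> ccvg v m -> ccvg (fun k => u k * v k) (l * m).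
Proof.
move=> ul vm; apply: ccvg_squeeze (fun k => cabs (u k - l) * (cabs (v k - m) + cabs m) + cabs l * cabs (v k - m)) _ _.
  move=> k; rewrite (_ : u k * v k - l * m = (u k - l) * v k + l * (v k - m)); last by ring.
  by apply: le_trans (cabsD _ _) _; rewrite !cabsM lerD2r ler_wpM2l ?cabs_ge0// cabs_sub.
rewrite (_ : 0 = 0 * (0 + cabs m) + cabs l * 0 :> R); last by ring.
apply: cvgD; apply: cvgM => //; last exact: cvg_cst.
by apply: cvgD => //; exact: cvg_cst.
Qed.

Lemma ccvgB u v l m : ccvg u l -> ccvg v m ->
  ccvg (fun k => u k - v k) (l - m).
Proof.
move=> ul vm; rewrite -(mulN1r m); apply: ccvgD => //.
under eq_fun do rewrite -mulN1r.
by apply: ccvgM => //; exact: ccvg_cst.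
Qed.

Lemma ccvg_unique u l m : ccvg u l -> ccvg u m -> l = m.
Proof.
move=> ul um; apply/eqP; rewrite -subr_eq0; apply/eqP/cabs_eq0.
have h : (cabs (u k - l) + cabs (u k - m) @[k --> \oo] --> (0 : R)).
  by rewrite -(addr0 (0 : R)); exact: cvgD.
apply/eqP; rewrite eq_le cabs_ge0 andbT.
apply: cvg_lower h => k; rewrite -(cabsN (u k - l)) opprB.
exact: cabs_triang.
Qed.

Lemma ccvg_bound u l M : (forall k, cabs (u k) <= M) -> ccvg u l -> cabs l <= M.
Proof.
move=> uM ul; apply: (@cvg_lower _ _ _ (fun k => cabs (u k - l) + M)).
  by move=> k; apply: le_trans (cabs_sub l (u k)) _; rewrite cabsBC lerD2l.
by rewrite -[X in _ --> X]add0r; apply: cvgD => //; exact: cvg_cst.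
Qed.

Lemma ccvg_bound_near u l M N : (forall k, (N <= k)%N -> cabs (u k) <= M) ->
  ccvg u l -> cabs l <= M.
Proof.
move=> uM ul; apply: (@ccvg_bound (fun k => u (k + N)%N)).
  by move=> k; apply: uM; rewrite leq_addl.
by rewrite /ccvg; have := ul; rewrite /ccvg -(cvg_shiftn N).
Qed.

End ccvg.

Section complex_integral.
Context {R : realType} {n : nat}.
Local Notation T := (@Rd R n.+1).
Variable mu : {measure set T -> \bar R}.
Local Notation Re := complex.Re.
Local Notation Im := complex.Im.
Implicit Types (f g : T -> R) (h k : T -> R[i]) (a : R[i]).

Definition rintble f := mu.-integrable setT (EFin \o f).
Definition cintble h := rintble (fun x => Re (h x)) /\ rintble (fun x => Im (h x)).

Lemma rintble_measurable f : rintble f -> measurable_fun setT f.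
Proof. by move=> /measurable_int /measurable_EFinP. Qed.

Lemma cintble_measurable h : cintble h -> cmeasurable h.
Proof. by move=> [/rintble_measurable ? /rintble_measurable ?]. Qed.

Lemma rintble_le f g : measurable_fun setT f -> (forall x, `|f x| <= g x) ->
  rintble g -> rintble f.
Proof.
move=> mf fg; apply: le_integrable => //; first exact/measurable_EFinP.
by move=> x _ /=; rewrite lee_fin (le_trans (fg x))// ler_norm.
Qed.

Lemma rintbleD f g : rintble f -> rintble g -> rintble (fun x => f x + g x).
Proof. by move=> hf hg; apply: eq_integrable (integrableD _ hf hg). Qed.

Lemma rintbleB f g : rintble f -> rintble g -> rintble (fun x => f x - g x).
Proof. by move=> hf hg; apply: eq_integrable (integrableB _ hf hg). Qed.

Lemma rintbleZl c f : rintble f -> rintble (fun x => c * f x).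
Proof. by move=> hf; apply: eq_integrable (integrableZl _ c hf). Qed.

Lemma rintble0 : rintble (fun=> 0).
Proof. exact: integrable0. Qed.

Lemma measurable_cabs2 h : cmeasurable h -> measurable_fun setT (fun x => cabs2 (h x)).
Proof.
by move=> [m1 m2]; apply: measurable_funD; apply: measurable_funX.
Qed.

Lemma measurable_cabs h : cmeasurable h -> measurable_fun setT (fun x => cabs (h x)).
Proof.
move=> mh; apply: (@measurableT_comp _ _ _ _ _ _ (@Num.sqrt R)); last exact: measurable_cabs2.
exact: continuous_measurable_fun (@sqrt_continuous R).
Qed.

Lemma cmeasurableD h k : cmeasurable h -> cmeasurable k -> cmeasurable (fun x => h x + k x).
Proof.
move=> [h1 h2] [k1 k2]; split.
  rewrite (_ : (fun _ => _) = fun x => Re (h x) + Re (k x)); first exact: measurable_funD.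
  by apply/funext => x; rewrite ReD.
rewrite (_ : (fun _ => _) = fun x => Im (h x) + Im (k x)); first exact: measurable_funD.
by apply/funext => x; rewrite ImD.
Qed.

Lemma cmeasurableM h k : cmeasurable h -> cmeasurable k -> cmeasurable (fun x => h x * k x).
Proof.
move=> [h1 h2] [k1 k2]; split.
  rewrite (_ : (fun _ => _) = fun x => Re (h x) * Re (k x) - Im (h x) * Im (k x)).
    by apply: measurable_funB; apply: measurable_funM.
  by apply/funext => x; rewrite ReM.
rewrite (_ : (fun _ => _) = fun x => Re (h x) * Im (k x) + Im (h x) * Re (k x)).
  by apply: measurable_funD; apply: measurable_funM.
by apply/funext => x; rewrite ImM.
Qed.

Lemma cmeasurable_cst a : cmeasurable (fun _ : T => a).
Proof. by split; exact: measurable_cst. Qed.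

Lemma cmeasurableJ h : cmeasurable h -> cmeasurable (fun x => (h x)^*%C).
Proof.
move=> [h1 h2]; split.
  by rewrite (_ : (fun _ => _) = fun x => Re (h x))//; apply/funext => x; rewrite ReJ.
rewrite (_ : (fun _ => _) = fun x => - Im (h x)); first exact: measurable_funN.
by apply/funext => x; rewrite ImJ.
Qed.

Lemma cmeasurableB h k : cmeasurable h -> cmeasurable k -> cmeasurable (fun x => h x - k x).
Proof.
move=> mh mk; rewrite (_ : (fun _ => _) = fun x => h x + (-1) * k x).
  by apply: cmeasurableD => //; apply: cmeasurableM => //; exact: cmeasurable_cst.
by apply/funext => x; rewrite mulN1r.
Qed.

Lemma cmeasurable_sum (I : Type) (r : seq I) (h : I -> T -> R[i]) :
  (forall i, cmeasurable (h i)) -> cmeasurable (fun x => \sum_(i <- r) h i x).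
Proof.
move=> mh; elim: r => [|i r ih].
  by under eq_fun do rewrite big_nil; exact: cmeasurable_cst.
by under eq_fun do rewrite big_cons; exact: cmeasurableD.
Qed.

Lemma cintble_le h g : cmeasurable h -> (forall x, cabs (h x) <= g x) ->
  rintble g -> cintble h.
Proof.
move=> [m1 m2] hg ig; split; apply: rintble_le ig => // x; apply: le_trans (hg x).
  exact: Re_le_cabs.
exact: Im_le_cabs.
Qed.

Lemma cintble_cabs h : cintble h -> rintble (fun x => cabs (h x)).
Proof.
move=> ih; have mh := cintble_measurable ih; case: ih => i1 i2.
have i12 := rintbleD (integrable_norm i1) (integrable_norm i2).
apply: rintble_le i12; first exact: measurable_cabs.
by move=> x /=; rewrite ger0_norm ?cabs_ge0// cabs_le_ReIm.
Qed.

Lemma cintbleD h k : cintble h -> cintble k -> cintble (fun x => h x + k x).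
Proof.
move=> ih ik.
apply: cintble_le (rintbleD (cintble_cabs ih) (cintble_cabs ik)).
  by apply: cmeasurableD; exact: cintble_measurable.
by move=> x; exact: cabsD.
Qed.

Lemma cintbleZ a h : cintble h -> cintble (fun x => a * h x).
Proof.
move=> ih; apply: cintble_le (rintbleZl (cabs a) (cintble_cabs ih)).
  by apply: cmeasurableM; [exact: cmeasurable_cst|exact: cintble_measurable].
by move=> x; rewrite cabsM.
Qed.

Lemma cintbleM h k M : cmeasurable k -> (forall x, cabs (k x) <= M) ->
  cintble h -> cintble (fun x => h x * k x).
Proof.
move=> mk kM ih; apply: cintble_le (rintbleZl M (cintble_cabs ih)).
  by apply: cmeasurableM => //; exact: cintble_measurable.
by move=> x; rewrite cabsM mulrC ler_wpM2r ?cabs_ge0.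
Qed.

Lemma cintble0 : cintble (fun=> 0). Proof. by split; exact: rintble0. Qed.

Lemma cintble_sum (I : Type) (r : seq I) (h : I -> T -> R[i]) :
  (forall i, cintble (h i)) -> cintble (fun x => \sum_(i <- r) h i x).
Proof.
move=> mh; elim: r => [|i r ih].
  by under eq_fun do rewrite big_nil; exact: cintble0.
by under eq_fun do rewrite big_cons; exact: cintbleD.
Qed.

Local Notation CI := (cintegral mu setT).

Lemma eq_cintegral h k : (forall x, h x = k x) -> CI h = CI k.
Proof. by move=> /funext ->. Qed.

Lemma cintegralD h k : cintble h -> cintble k -> CI (fun x => h x + k x) = CI h + CI k.
Proof.
move=> [h1 h2] [k1 k2]; apply: complex_ext; rewrite ?ReD ?ImD /=.
  by rewrite -[RHS](RintegralD measurableT h1 k1); congr fine; apply: eq_integral => x _; rewrite ReD.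
by rewrite -[RHS](RintegralD measurableT h2 k2); congr fine; apply: eq_integral => x _; rewrite ImD.
Qed.

Lemma cintegralZ a h : cintble h -> CI (fun x => a * h x) = a * CI h.
Proof.
move=> [h1 h2]; apply: complex_ext; rewrite ?ReM ?ImM /=.
  have := RintegralB (measurableT) (rintbleZl (Re a) h1) (rintbleZl (Im a) h2).
  rewrite (RintegralZl _ measurableT h1) (RintegralZl _ measurableT h2) => <-.
  by congr fine; apply: eq_integral => x _; rewrite ReM.
have := RintegralD (measurableT) (rintbleZl (Re a) h2) (rintbleZl (Im a) h1).
rewrite (RintegralZl _ measurableT h2) (RintegralZl _ measurableT h1) => <-.
by congr fine; apply: eq_integral => x _; rewrite ImM.
Qed.

Lemma cintegral0 : CI (fun=> 0) = 0.
Proof. by apply: complex_ext => /=; rewrite integral0. Qed.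

Lemma cintegralB h k : cintble h -> cintble k -> CI (fun x => h x - k x) = CI h - CI k.
Proof.
move=> ih ik; rewrite -[X in _ = _ + X]mulN1r -cintegralZ// -cintegralD//; last exact: cintbleZ.
by apply: eq_cintegral => x; rewrite mulN1r.
Qed.

Lemma cintegral_sum (I : Type) (r : seq I) (h : I -> T -> R[i]) :
  (forall i, cintble (h i)) -> CI (fun x => \sum_(i <- r) h i x) = \sum_(i <- r) CI (h i).
Proof.
move=> mh; elim: r => [|i r ih].
  by under eq_fun do rewrite big_nil; rewrite big_nil cintegral0.
under eq_fun do rewrite big_cons.
by rewrite cintegralD ?ih ?big_cons//; exact: cintble_sum.
Qed.

(* Rotating the integral onto the positive real axis. *)
Lemma cabs_cintegral h : cintble h ->
  cabs (CI h) <= fine (\int[mu]_x (cabs (h x))%:E).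
Proof.
move=> ih; set z := CI h; have ia := cintble_cabs ih.
have [z0|z0] := eqVneq (cabs z) 0; first by rewrite z0 fine_ge0// integral_ge0// => x _; rewrite lee_fin cabs_ge0.
have zp : 0 < cabs z by rewrite lt_neqAle eq_sym z0 cabs_ge0.
have iz : cintble (fun x => (z^*)%C * h x) by exact: cintbleZ.
rewrite -(ler_pM2l zp) -expr2 -cabs2E.
have -> : cabs2 z = Re (CI (fun x => (z^*)%C * h x)).
  by rewrite cintegralZ// mulrC mulJ_cabs2.
have -> : cabs z * fine (\int[mu]_x (cabs (h x))%:E) =
   \int[mu]_(x in setT) (cabs z * cabs (h x)) by rewrite RintegralZl.
apply: le_Rintegral => //; first exact: iz.1.
  exact: rintbleZl.
move=> x _; apply: le_trans (ler_norm _) _; apply: le_trans (Re_le_cabs _) _.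
by rewrite cabsM /cabs cabs2J.
Qed.

Lemma rdominated (u : nat -> T -> R) g : (forall j, measurable_fun setT (u j)) ->
  (forall x, u j x @[j --> \oo] --> (0 : R)) -> (forall j x, `|u j x| <= g x) -> rintble g ->
  fine (\int[mu]_x (u j x)%:E) @[j --> \oo] --> (0 : R).
Proof.
move=> mu_ u0 ug ig.
have := @dominated_cvg _ T R mu setT measurableT (fun j => EFin \o u j) (cst 0%E) (EFin \o g).
rewrite integral0.
have h1 j : measurable_fun setT (EFin \o u j) by exact/measurable_EFinP.
have h2 x : [set: T] x -> (EFin \o u j) x @[j --> \oo] --> cst (0%E : \bar R) x.
  by move=> _; apply: cvg_EFin; [exact: nearW|exact: u0].
have h3 x : [set: T] x -> (EFin \o g) x \is a fin_num by [].
have h4 j x : [set: T] x -> (`|(EFin \o u j) x| <= (EFin \o g) x)%E.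
  by move=> _; rewrite lee_fin.
by move=> /(_ h1 h2 h3 ig h4) /fine_cvg.
Qed.

Lemma ccvg_dominated (u : nat -> T -> R[i]) h g : (forall j, cmeasurable (u j)) ->
  cmeasurable h ->
  (forall x, ccvg (u^~ x) (h x)) -> (forall j x, cabs (u j x) <= g x) ->
  (forall x, cabs (h x) <= g x) -> rintble g ->
  ccvg (fun j => CI (u j)) (CI h).
Proof.
move=> mu_ mh uh ug hg ig.
have iu j : cintble (u j) by exact: cintble_le ig.
have ih : cintble h by exact: cintble_le ig.
have mB j : cmeasurable (fun x => u j x - h x) by exact: cmeasurableB.
have := @rdominated (fun j x => cabs (u j x - h x)) (fun x => g x + g x).
move=> /(_ (fun j => measurable_cabs (mB j)) uh).
have hb j x : `|cabs (u j x - h x)| <= g x + g x.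
  rewrite ger0_norm ?cabs_ge0//; apply: le_trans (cabsD _ _) _.
  by rewrite cabsN lerD.
move=> /(_ hb (rintbleD ig ig)) h0.
apply: ccvg_squeeze h0 => j; rewrite -cintegralB//.
apply: cabs_cintegral; apply: cintble_le (rintbleD ig ig) => // x.
by have := hb j x; rewrite ger0_norm ?cabs_ge0.
Qed.

End complex_integral.

(** * Bessel and Parseval on a cube *)

Section trig_poly.
Context {R : realType} {n : nat}.
Local Notation V := 'rV[R]_n.+1.
Local Notation T := (@Rd R n.+1).
Implicit Types (x y g : V) (s : seq (V * R[i])).

Lemma dotvC x g : dotv x g = dotv g x.
Proof. by apply: eq_bigr => i _; rewrite mulrC. Qed.

Lemma dotvDr x g g' : dotv x (g + g') = dotv x g + dotv x g'.
Proof. by rewrite /dotv -big_split; apply: eq_bigr => i _; rewrite mxE mulrDr. Qed.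

Lemma dotvZr x (c : R) g : dotv x (c *: g) = c * dotv x g.
Proof. by rewrite /dotv mulr_sumr; apply: eq_bigr => i _; rewrite mxE mulrCA. Qed.

Lemma dotv0r x : dotv x 0 = 0.
Proof. by rewrite -(scale0r (0 : V)) dotvZr mul0r. Qed.

Lemma dotvNr x g : dotv x (- g) = - dotv x g.
Proof. by rewrite -scaleN1r dotvZr mulN1r. Qed.

(** The norm of a row vector is the maximum norm, hence one factor |x| |g| for each of the n.+1
    coordinates. *)
Lemma dotv_bound x g : `|dotv x g| <= n.+1%:R * (`|x| * `|g|).
Proof.
apply: le_trans (ler_norm_sum _ _ _) _.
set c := `|x| * `|g|.
rewrite mulr_natl -[n.+1 in leRHS]card_ord -sumr_const; apply: ler_sum => i _.
by rewrite normrM ler_pM// le_coord_norm.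
Qed.

Lemma measurable_coord (i : 'I_n.+1) : measurable_fun [set: T] (fun g : T => vec_of g ord0 i).
Proof. by apply: continuous_measurable_Rd => g; exact: coord_continuous. Qed.

Lemma measurable_dotv x : measurable_fun [set: T] (fun g : T => dotv x (vec_of g)).
Proof.
apply: measurable_sum => i; apply: measurable_funM; first exact: measurable_cst.
exact: measurable_coord.
Qed.

Definition ez x g : R[i] := expi (2 * pi * dotv x g).

Lemma ezC x g : ez x g = ez g x. Proof. by rewrite /ez dotvC. Qed.
Lemma ezDr x g g' : ez x (g + g') = ez x g * ez x g'.
Proof. by rewrite /ez dotvDr mulrDr expiD. Qed.
Lemma ezDl x y g : ez (x + y) g = ez x g * ez y g.
Proof. by rewrite ezC ezDr !(ezC g). Qed.
Lemma ez0r x : ez x 0 = 1. Proof. by rewrite /ez dotv0r mulr0 expi0. Qed.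
Lemma ez0l g : ez 0 g = 1. Proof. by rewrite ezC ez0r. Qed.
Lemma ezNr x g : ez x (- g) = (ez x g)^*%C.
Proof. by rewrite /ez dotvNr mulrN expiN. Qed.
Lemma ezZ (c : R) x g : ez (c *: x) g = ez x (c *: g).
Proof. by rewrite /ez dotvZr dotvC dotvZr dotvC. Qed.
Lemma cabs_ez x g : cabs (ez x g) = 1. Proof. exact: cabs_expi. Qed.
Lemma cabs2_ez x g : cabs2 (ez x g) = 1. Proof. exact: cabs2_expi. Qed.

Lemma ez_lip x y g :
  cabs (ez x g - ez y g) <= 2 * pi * n.+1%:R * (`|x - y| * `|g|).
Proof.
apply: le_trans (expi_lip _ _) _.
rewrite -mulrBr normrM ger0_norm ?mulr_ge0 ?pi_ge0// -mulrA ler_wpM2l ?mulr_ge0 ?pi_ge0//.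
by rewrite -(dotvC g x) -(dotvC g y) -dotvNr -dotvDr dotvC dotv_bound.
Qed.

Lemma cmeasurable_ez x : cmeasurable (fun g : T => ez x (vec_of g)).
Proof.
have m : measurable_fun [set: T] (fun g : T => 2 * pi * dotv x (vec_of g)).
  by apply: measurable_funM; [exact: measurable_cst|exact: measurable_dotv].
split; [apply: (measurableT_comp _ m)|apply: (measurableT_comp _ m)].
  exact: continuous_measurable_fun (@continuous_cos R).
exact: continuous_measurable_fun (@continuous_sin R).
Qed.

Definition tp s x : R[i] := \sum_(p <- s) p.2 * ez x p.1.

Lemma tp_cat s t x : tp (s ++ t) x = tp s x + tp t x.
Proof. by rewrite /tp big_cat. Qed.

Definition tp_mul s t := [seq (p.1 + q.1, p.2 * q.2) | p <- s, q <- t].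

Lemma tp_mulE s t x : tp (tp_mul s t) x = tp s x * tp t x.
Proof.
rewrite /tp big_allpairs_dep /= mulr_suml; apply: eq_bigr => p _.
by rewrite mulr_sumr; apply: eq_bigr => q _; rewrite ezDr; ring.
Qed.

Lemma cmeasurable_tp s : cmeasurable (fun x : T => tp s (vec_of x)).
Proof.
apply: cmeasurable_sum => p; apply: cmeasurableM; first exact: cmeasurable_cst.
under eq_fun do rewrite ezC; exact: cmeasurable_ez.
Qed.

Lemma tp_bound s x : cabs (tp s x) <= \sum_(p <- s) cabs p.2.
Proof.
apply: le_trans (cabs_sum _ _) _; apply: ler_sum => p _.
by rewrite cabsM cabs_ez mulr1.
Qed.

(** A list may repeat a frequency, whereas orthogonality computations such as [nrm2_tp] need
    distinct ones; coefficients of equal frequencies are added. *)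
Lemma tp_uniq s : exists2 s', uniq [seq p.1 | p <- s'] &
  (forall p, p \in s' -> p.1 \in [seq q.1 | q <- s]) /\ forall x, tp s' x = tp s x.
Proof.
pose ks := undup [seq p.1 | p <- s].
exists [seq (k, \sum_(p <- s | p.1 == k) p.2) | k <- ks].
  by rewrite -map_comp map_id undup_uniq.
split=> [p /mapP[k kks -> /=]|x]; first by rewrite -mem_undup.
transitivity (\sum_(k <- ks) \sum_(p <- s) if p.1 == k then p.2 * ez x p.1 else 0).
  rewrite /tp big_map; apply: eq_bigr => k _ /=.
  by rewrite mulr_suml big_mkcond; apply: eq_bigr => p _; case: eqP => [->|].
rewrite exchange_big /= /tp [LHS]big_seq [RHS]big_seq; apply: eq_bigr => p ps.
rewrite (bigD1_seq p.1) ?undup_uniq ?mem_undup ?map_f//= eqxx big1 ?addr0// => k.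
by rewrite eq_sym => /negPf ->.
Qed.

End trig_poly.

Section fourier_integral.
Context {R : realType} {n : nat}.
Local Notation V := 'rV[R]_n.+1.
Local Notation T := (@Rd R n.+1).
Local Notation leb := (@lebesgue_d R n.+1).
Local Notation CI := (cintegral leb setT).
Implicit Types (x y g v : V) (F h : T -> R[i]).

(** The exponent has the sign used in [PW_fun]: this is the inverse Fourier transform, which
    recovers f from its transform F. *)
Definition ft F x : R[i] := CI (fun g => F g * ez x (vec_of g)).

Definition cind (A : set T) (g : T) : R[i] := ((\1_A g)%:C)%C.

Lemma cintegral_shift v h : cintble leb h -> CI (fun g => h (shiftv v g)) = CI h.
Proof.
move=> ih; have [/measurable_int m1 /measurable_int m2] := ih.
apply: complex_ext => /=; congr fine.
  exact: (integral_shift v m1).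
exact: (integral_shift v m2).
Qed.

Lemma cintegral_dilate (c : R) h : 0 < c -> cintble leb h ->
  ((c ^+ n.+1)%:C)%C * CI (fun g => h (dilatev c g)) = CI h.
Proof.
move=> c0 [i1 i2]; apply: complex_ext; rewrite ?ReM ?ImM /= mul0r ?subr0 ?addr0.
  have := integral_dilate c0 i1 => /(congr1 fine) <-.
  rewrite fineM//; apply: integrable_fin_num => //.
  exact: (integrable_dilate c0 i1).
have := integral_dilate c0 i2 => /(congr1 fine) <-.
rewrite fineM//; apply: integrable_fin_num => //.
exact: (integrable_dilate c0 i2).
Qed.

Lemma cmeasurable_cind A : measurable A -> cmeasurable (cind A).
Proof. by move=> mA; split; [exact: measurable_indic|exact: measurable_cst]. Qed.

Lemma cabs_cind A g : cabs (cind A g) = \1_A g.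
Proof. by rewrite /cind cabs_real ger0_norm. Qed.

Lemma rintble_indic A : measurable A -> (leb A < +oo)%E -> rintble leb (\1_A : T -> R).
Proof.
move=> mA fA; apply/integrableP; split; first exact/measurable_EFinP/measurable_indic.
under eq_integral do rewrite /= ger0_norm//.
by rewrite integral_indic// setIT.
Qed.

Lemma cintble_cind A : measurable A -> (leb A < +oo)%E -> cintble leb (cind A).
Proof. by move=> mA fA; split; [exact: rintble_indic|exact: rintble0]. Qed.

Lemma cintegral_cind A : measurable A -> CI (cind A) = ((fine (leb A))%:C)%C.
Proof.
by move=> mA; apply: complex_ext; rewrite /= ?integral0// integral_indic// setIT.
Qed.

Definition Q (L : R) : set T := boxv (const_mx (- L)) (const_mx L).

Lemma measurable_Q L : measurable (Q L). Proof. exact: measurable_box. Qed.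

Lemma QE L g : Q L g <-> forall i, - L <= vec_of g ord0 i < L.
Proof. by split => h i; have := h i; rewrite !mxE. Qed.

Lemma leb_Q_fin L : (leb (Q L) < +oo)%E.
Proof.
have [L0|L0] := leP 0 L.
  by apply: le_lt_trans (leb_box _) (ltry _) => i; rewrite !mxE; lra.
rewrite (_ : Q L = set0) ?measure0 ?ltry//.
by rewrite -subset0 => g /QE /(_ ord0); lra.
Qed.

(** The frequencies whose character has period 2 L in every coordinate, that is, the lattice dual to
    the tiling by translates of [Q L]. *)
Definition lat (L : R) : set V := [set y | forall i, exists m : int, y ord0 i = m%:~R / (2 * L)].

Lemma latD L y y' : lat L y -> lat L y' -> lat L (y + y').
Proof.
move=> hy hy' i; have [m hm] := hy i; have [k hk] := hy' i.
by exists (m + k); rewrite mxE hm hk intrD -mulrDl.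
Qed.

Lemma latN L y : lat L y -> lat L (- y).
Proof. by move=> hy i; have [m hm] := hy i; exists (- m); rewrite mxE hm mulrNz mulNr. Qed.

Lemma latB L y y' : lat L y -> lat L y' -> lat L (y - y').
Proof. by move=> hy /latN; exact: latD. Qed.

Lemma lat0 L : lat L 0.
Proof. by move=> i; exists 0; rewrite mxE mul0r. Qed.

(* Translating [Q L] along a coordinate by half a period of [ez y] and wrapping
   the overhang around flips the sign of the integral. *)
Lemma ez_orthogonal L y : 0 < L -> lat L y -> y != 0 -> ft (cind (Q L)) y = 0.
Proof.
move=> L0 ly y0.
have [i yi0] : exists i, y ord0 i != 0.
  apply/not_existsP => h; move/eqP: y0; apply; apply/rowP => i.
  by rewrite mxE; apply/eqP; have /negP := h i; rewrite negbK.
have [m ym] := ly i.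
have m0 : m != 0.
  by apply: contra_neq yi0 => m0; rewrite ym m0 mul0r.
pose am : R := `|m|%:~R.
have am1 : 1 <= am by rewrite /am -[1]/(1%:~R) ler_int; lia.
(* Half a period of [ez y] in direction i: with y_i = m / (2 L) the phase 2 pi s y_i equals pi or -
   pi. *)
pose s := L / am.
have s0 : 0 < s by rewrite divr_gt0// (lt_le_trans _ am1).
have sL : s <= L by rewrite ler_pdivrMr ?(lt_le_trans _ am1)// ler_peMr// ltW.
pose e (t : R) : V := t *: delta_mx ord0 i.
have eE t j : e t ord0 j = if j == i then t else 0.
  by rewrite !mxE eqxx /=; case: eqP => _; rewrite ?mulr1 ?mulr0.
have dote t : dotv y (e t) = t * y ord0 i.
  rewrite dotvZr /dotv (bigD1 i) //= big1 => [|j ji]; rewrite !mxE ?eqxx ?mulr1 ?addr0//.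
  by rewrite (negPf ji) mulr0.
have ezs : ez y (e s) = -1.
  rewrite /ez dote ym (_ : 2 * pi * _ = pi * (m%:~R / am)); last first.
    have amn0 : am != 0 by rewrite gt_eqF// (lt_le_trans _ am1).
    by rewrite /s; field; rewrite amn0 gt_eqF.
  have [mp|mn] := leP 0 m.
    rewrite /am ger0_norm// divff ?intr_eq0// mulr1.
    by rewrite /expi cospi sinpi; apply: complex_ext => /=; ring.
  rewrite /am ltr0_norm// rmorphN /= invrN mulrN divff ?intr_eq0// mulrN1 expiN.
  by rewrite /expi cospi sinpi; apply: complex_ext => /=; ring.
have ez2L : ez y (e (- (2 * L))) = 1.
  have hk (k : nat) : expi (2 * pi * k%:R) = 1 :> R[i].
    elim: k => [|k ih]; first by rewrite mulr0 expi0.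
    rewrite -(natr1 k) mulrDr expiD ih mul1r mulr1 mulr_natl.
    by rewrite /expi cos2pi sin2pi.
  rewrite /ez dote ym (_ : 2 * pi * _ = - (2 * pi * m%:~R)); last first.
    by field; rewrite gt_eqF.
  rewrite expiN; case: m {ym m0 am am1 s s0 sL ezs} => k.
    by rewrite -pmulrn hk; apply: complex_ext => /=; ring.
  by rewrite NegzE mulrNz mulrN expiN -pmulrn hk; apply: complex_ext => /=; ring.
(* Two partitions of the cube: [A1] moved by s is [B1], and the overhang [A2] moved by s - 2 L is
   [B2]. *)
pose A1 : set T := Q L `&` [set g : T | vec_of g ord0 i < L - s].
pose A2 : set T := Q L `\` [set g : T | vec_of g ord0 i < L - s].
pose B2 : set T := Q L `&` [set g : T | vec_of g ord0 i < - L + s].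
pose B1 : set T := Q L `\` [set g : T | vec_of g ord0 i < - L + s].
have mh c : measurable [set g : T | vec_of g ord0 i < c].
  by apply: measurable_open; exact: halfspace_open.
have mQ := measurable_Q L.
have mA1 : measurable A1 by exact: measurableI.
have mA2 : measurable A2 by exact: measurableD.
have mB1 : measurable B1 by exact: measurableD.
have mB2 : measurable B2 by exact: measurableI.
have fin A : A `<=` Q L -> (leb A < +oo)%E.
  by move=> AQ; apply: le_lt_trans (leb_Q_fin L); exact: leb_mono.
have ii A : measurable A -> A `<=` Q L -> cintble leb (fun g => cind A g * ez y (vec_of g)).
  move=> mA AQ; apply: (@cintbleM _ _ _ _ _ 1); first exact: cmeasurable_ez.
    by move=> x; rewrite cabs_ez.
  by apply: cintble_cind => //; exact: fin.
have split_ c : ft (cind (Q L)) y = ft (cind (Q L `&` [set g : T | vec_of g ord0 i < c])) y +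
   ft (cind (Q L `\` [set g : T | vec_of g ord0 i < c])) y.
  rewrite /ft -cintegralD; last 2 first.
  - by apply: ii; [exact: measurableI|exact: subIsetl].
  - by apply: ii; [exact: measurableD|exact: subDsetl].
  apply: eq_cintegral => g; rewrite -mulrDl; congr (_ * _).
  apply: complex_ext => /=; rewrite ?addr0//.
  rewrite !indicE in_setI in_setD.
  by case: (g \in Q L); case: (g \in _); rewrite /= ?addr0 ?add0r.
have shift_ (A B : set T) t z : measurable B -> B `<=` Q L -> ez y (e t) = z ->
    (forall g : T, B (shiftv (e t) g) <-> A g) -> ft (cind B) y = z * ft (cind A) y.
  move=> mB BQ ez_ BA; rewrite /ft -(cintegral_shift (e t) (ii _ mB BQ)).
  have eqi : forall g, cind B (shiftv (e t) g) = cind A g.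
    by move=> g; rewrite /cind !indicE; congr ((_%:R)%:C)%C; congr nat_of_bool;
       apply/idP/idP; rewrite !inE => /BA.
  rewrite -cintegralZ; last first.
    rewrite (_ : (fun _ => _) = (fun g => (z^*)%C * (fun g => cind B (shiftv (e t) g) * ez y (vec_of (shiftv (e t) g))) g)).
      apply: cintbleZ; have [j1 j2] := ii _ mB BQ.
      by split; [exact: (integrable_shift (e t) j1)|exact: (integrable_shift (e t) j2)].
    apply/funext => g; rewrite eqi /shiftv /vec_of ezDr ez_.
    have : (z^*)%C * z = 1 by rewrite -ez_ mulrC mulJ_cabs2 cabs2_ez.
    move=> hz; transitivity ((z^*)%C * z * (cind A g * ez y (vec_of g))); last by ring.
    by rewrite hz mul1r.
  apply: eq_cintegral => g; rewrite eqi /shiftv /vec_of ezDr ez_; ring.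
have sE t (g : T) j : vec_of (shiftv (e t) g) ord0 j =
    vec_of g ord0 j + (if j == i then t else 0) by rewrite /shiftv /vec_of mxE eE.
have e1 : ft (cind B1) y = -1 * ft (cind A1) y.
  apply: (shift_ _ _ s) => // [|g]; first exact: subDsetl.
  rewrite /B1 /A1; split=> [[/QE hQ /negP]|[/QE hQ /= hi]].
    rewrite -leNgt sE eqxx => hi; have := hQ i; rewrite sE eqxx => hQi.
    split; last by rewrite /=; lra.
    by apply/QE => j; have := hQ j; rewrite sE; case: eqP => [->|_] hj; lra.
  split; last by apply/negP; rewrite -leNgt sE eqxx; have := hQ i; lra.
  by apply/QE => j; rewrite sE; have := hQ j; case: eqP => [->|_] hj; lra.
have e2 : ft (cind B2) y = -1 * ft (cind A2) y.
  apply: (shift_ _ _ (s - 2 * L)) => // [||g]; first exact: subIsetl.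
    rewrite (_ : e _ = e s + e (- (2 * L))); last by rewrite /e scalerDl.
    by rewrite ezDr ezs ez2L mulr1.
  rewrite /B2 /A2; split=> [[/QE hQ /=]|[/QE hQ /negP]].
    rewrite sE eqxx => hi; have := hQ i; rewrite sE eqxx => hQi.
    split; last by apply/negP; rewrite -leNgt; lra.
    by apply/QE => j; have := hQ j; rewrite sE; case: eqP => [->|_] hj; lra.
  rewrite -leNgt => hi; split; last by rewrite /= sE eqxx; have := hQ i; lra.
  by apply/QE => j; rewrite sE; have := hQ j; case: eqP => [->|_] hj; lra.
have h1 := split_ (L - s); have h2 := split_ (- L + s).
rewrite -/A1 -/A2 in h1; rewrite -/B1 -/B2 e1 e2 in h2.
have : ft (cind (Q L)) y = - ft (cind (Q L)) y by rewrite {1}h2 h1; ring.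
set z := ft _ _ => hz.
have rz : complex.Re z = 0 by have := congr1 (@complex.Re R) hz; rewrite ReN => ?; lra.
have iz : complex.Im z = 0 by have := congr1 (@complex.Im R) hz; rewrite ImN => ?; lra.
exact: complex_ext.
Qed.

End fourier_integral.

Lemma uniq_map_inj (A B : eqType) (f : A -> B) (s : seq A) :
  uniq [seq f p | p <- s] -> {in s &, injective f}.
Proof.
elim: s => [|a s ih] //= /andP[fas us] x y; rewrite !inE.
move=> /predU1P[->|xs] /predU1P[->|ys] // fxy; last exact: ih.
  by move: fas; rewrite fxy map_f.
by move: fas; rewrite -fxy map_f.
Qed.

Section real_integral.
Context {R : realType} {n : nat}.
Local Notation T := (@Rd R n.+1).
Variable mu : {measure set T -> \bar R}.
Implicit Types f g : T -> R.

Definition rI f := fine (\int[mu]_x (f x)%:E).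

Lemma rI_le f g : rintble mu f -> rintble mu g -> (forall x, f x <= g x) -> rI f <= rI g.
Proof. by move=> hf hg fg; apply: le_Rintegral. Qed.

Lemma rI_ge0 f : (forall x, 0 <= f x) -> 0 <= rI f.
Proof. by move=> f0; apply: Rintegral_ge0. Qed.

Lemma rID f g : rintble mu f -> rintble mu g -> rI (fun x => f x + g x) = rI f + rI g.
Proof. by move=> hf hg; apply: RintegralD. Qed.

Lemma rIB f g : rintble mu f -> rintble mu g -> rI (fun x => f x - g x) = rI f - rI g.
Proof. by move=> hf hg; apply: RintegralB. Qed.

Lemma rIZ c f : rintble mu f -> rI (fun x => c * f x) = c * rI f.
Proof. by move=> hf; apply: RintegralZl. Qed.

Lemma eq_rI f g : (forall x, f x = g x) -> rI f = rI g.
Proof. by move=> /funext ->. Qed.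

Lemma Re_cintegral h : complex.Re (cintegral mu setT h) = rI (fun x => complex.Re (h x)).
Proof. by []. Qed.

End real_integral.

Lemma cvg0_small {R : realType} (w : nat -> R) e : w k @[k --> \oo] --> (0 : R) -> 0 < e ->
  exists N, forall k, (N <= k)%N -> `|w k| < e.
Proof.
move=> /cvgrPdist_lt w0 /w0 [N _ hN]; exists N => k Nk.
by have := hN k Nk; rewrite /= sub0r normrN.
Qed.

Section lattice_L2.
Context {R : realType} {n : nat}.
Local Notation V := 'rV[R]_n.+1.
Local Notation T := (@Rd R n.+1).
Local Notation leb := (@lebesgue_d R n.+1).
Local Notation CI := (cintegral leb setT).
Local Notation Re := complex.Re.
Implicit Types (x y g v : V) (F G h : T -> R[i]) (s : seq (V * R[i])).

Definition L2 F := cmeasurable F /\ rintble leb (fun g => cabs2 (F g)).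
Definition nrm2 F : R := rI leb (fun g => cabs2 (F g)).

Lemma nrm2_ge0 F : 0 <= nrm2 F.
Proof. by apply: rI_ge0 => x; exact: cabs2_ge0. Qed.

Lemma L2_le F G c : cmeasurable F -> L2 G -> (forall x, cabs2 (F x) <= c * cabs2 (G x)) -> L2 F.
Proof.
move=> mF [_ iG] FG; split => //; apply: rintble_le (rintbleZl c iG).
  exact: measurable_cabs2.
by move=> x; rewrite ger0_norm ?cabs2_ge0.
Qed.

Lemma L2D F G : L2 F -> L2 G -> L2 (fun x => F x + G x).
Proof.
move=> [mF iF] [mG iG]; have m := cmeasurableD mF mG; split => //.
apply: rintble_le (rintbleZl 2 (rintbleD iF iG)); first exact: measurable_cabs2.
by move=> x; rewrite ger0_norm ?cabs2_ge0// cabs2D.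
Qed.

Lemma nrm2_le F G c : L2 F -> L2 G -> (forall x, cabs2 (F x) <= c * cabs2 (G x)) ->
  nrm2 F <= c * nrm2 G.
Proof. by move=> [_ iF] [_ iG] FG; rewrite -rIZ//; apply: rI_le => //; exact: rintbleZl. Qed.

Lemma nrm2D F G : L2 F -> L2 G -> nrm2 (fun x => F x + G x) <= 2 * (nrm2 F + nrm2 G).
Proof.
move=> hF hG; rewrite -rID; [|exact: hF.2|exact: hG.2].
rewrite -rIZ; last exact: rintbleD hF.2 hG.2.
apply: rI_le; [exact: (L2D hF hG).2|exact: rintbleZl (rintbleD hF.2 hG.2)|].
by move=> x; exact: cabs2D.
Qed.

Variable L : R.
Local Notation QL := (@Q R n L).
Local Notation vol := (fine (leb QL)).

Definition offQ F := forall g, ~ QL g -> F g = 0.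

Lemma offQ_cases F g : offQ F -> cind QL g = 1 \/ cind QL g = 0 /\ F g = 0.
Proof.
move=> hF; rewrite /cind indicE; have [gQ|gQ] := boolP (g \in QL); [by left|right; split=> //].
by apply: hF => h; move/negP : gQ; apply; rewrite inE.
Qed.

Lemma rintble_Q : rintble leb (\1_QL : T -> R).
Proof. by apply: rintble_indic; [exact: measurable_Q|exact: leb_Q_fin]. Qed.

Lemma rI_Q : rI leb (\1_QL : T -> R) = vol.
Proof. by rewrite /rI integral_indic ?setIT//; exact: measurable_Q. Qed.

(** On the cube |F| <= 1 + |F|^2, and off the cube F vanishes. *)
Lemma L2_cintble F : L2 F -> offQ F -> cintble leb F.
Proof.
move=> [mF iF] oF; apply: cintble_le (rintbleD rintble_Q iF) => // x.
rewrite indicE; have [xQ|xQ] := boolP (x \in QL); last first.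
  rewrite oF ?cabs0 ?cabs20 ?addr0//.
  by move=> h; move/negP : xQ; apply; rewrite inE.
rewrite /= cabs2E; have := sqr_ge0 (cabs (F x) - 1); have := sqr_ge0 (cabs (F x)).
by rewrite sqrrB1; set c := _ ^+ 2 => ? ?; lra.
Qed.

Lemma L2_bounded h M : cmeasurable h -> (forall x, cabs (h x) <= M) ->
  L2 (fun x => cind QL x * h x).
Proof.
move=> mh hM; have m : cmeasurable (fun x => cind QL x * h x).
  by apply: cmeasurableM => //; apply: cmeasurable_cind; exact: measurable_Q.
split=> //; apply: rintble_le (rintbleZl (M ^+ 2) rintble_Q); first exact: measurable_cabs2.
move=> x; rewrite ger0_norm ?cabs2_ge0// cabs2M {1}/cabs2 /= expr0n addr0.
rewrite mulrC indicE; have M0 : 0 <= M := le_trans (cabs_ge0 _) (hM x).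
case: (_ \in _); rewrite ?mulr0 ?expr0n ?mulr0// expr1n !mulr1.
by rewrite cabs2_le.
Qed.

Lemma cintegral_tp F s : cintble leb F ->
  CI (fun g => F g * tp s (vec_of g)) = \sum_(p <- s) p.2 * ft F p.1.
Proof.
move=> iF.
have ie k : cintble leb (fun g => F g * ez k (vec_of g)).
  apply: (@cintbleM _ _ _ _ _ 1) => //; first exact: cmeasurable_ez.
  by move=> x; rewrite cabs_ez.
rewrite (_ : (fun _ => _) = (fun g => \sum_(p <- s) p.2 * (F g * ez p.1 (vec_of g)))).
  by rewrite cintegral_sum => [|p]; [apply: eq_bigr => p _; rewrite cintegralZ|exact: cintbleZ].
apply/funext => g; rewrite /tp mulr_sumr; apply: eq_bigr => p _.
by rewrite (ezC p.1); ring.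
Qed.

Definition lats s := forall p, p \in s -> lat L p.1.

Definition tp_conj s := [seq (- p.1, (p.2^*)%C) | p <- s].

Lemma tp_conjE s x : tp (tp_conj s) x = ((tp s x)^*)%C.
Proof.
rewrite /tp big_map rmorph_sum /=; apply: eq_bigr => p _.
by rewrite rmorphM /= ezNr.
Qed.

Lemma cintble_tp F s : cintble leb F -> cintble leb (fun g => F g * tp s (vec_of g)).
Proof.
by move=> iF; apply: cintbleM iF; [exact: cmeasurable_tp|move=> x; exact: tp_bound].
Qed.

Hypothesis L0 : 0 < L.

Lemma nrm2_tp s : uniq [seq p.1 | p <- s] -> lats s ->
  nrm2 (fun g => cind QL g * tp s (vec_of g)) = vol * \sum_(p <- s) cabs2 p.2.
Proof.
move=> us ls.
have iQ : cintble leb (cind QL) by apply: cintble_cind; [exact: measurable_Q|exact: leb_Q_fin].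
transitivity (Re (CI (fun g => cind QL g * tp (tp_mul s (tp_conj s)) (vec_of g)))).
  rewrite Re_cintegral; apply: eq_rI => g.
  rewrite tp_mulE tp_conjE mulJ_cabs2 cabs2M ReM /= mulr0 subr0 /cabs2 /= expr0n addr0.
  by rewrite indicE; case: (_ \in _) => /=; ring.
rewrite cintegral_tp// /tp_mul big_allpairs_dep /= mulr_sumr Re_sum.
rewrite [LHS]big_seq [RHS]big_seq; apply: eq_bigr => p ps.
rewrite /tp_conj big_map /= (bigD1_seq p) ?(map_uniq us)//=.
rewrite subrr big_seq_cond big1 => [|q /andP[qs qp]]; last first.
  rewrite ez_orthogonal ?mulr0//; first by apply: latB; exact: ls.
  by rewrite subr_eq0; apply: contra_neq qp => /(uniq_map_inj us ps qs).
rewrite addr0 mulJ_cabs2.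
have -> : ft (cind QL) 0 = (vol%:C)%C.
  rewrite -cintegral_cind; last exact: measurable_Q.
  by apply: eq_cintegral => g; rewrite ez0l mulr1.
by rewrite ReM /= mulr0 subr0 mulrC.
Qed.

(** The conjugate of F is approximated rather than F: the cross term is then the integral of F times
    the polynomial, a combination of values of [ft F] at the frequencies themselves, with neither
    conjugate nor change of sign. *)
Lemma nrm2_dist F s : L2 F -> offQ F -> uniq [seq p.1 | p <- s] -> lats s ->
  nrm2 (fun g => (F g)^*%C - cind QL g * tp s (vec_of g)) =
  nrm2 F - 2 * Re (\sum_(p <- s) p.2 * ft F p.1) + vol * \sum_(p <- s) cabs2 p.2.
Proof.
move=> hF oF us ls; have iF := L2_cintble hF oF.
have [iFt _] := cintble_tp s iF.
have hQ : L2 (fun g => cind QL g * tp s (vec_of g)).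
  by apply: L2_bounded; [exact: cmeasurable_tp|move=> x; exact: tp_bound].
rewrite -nrm2_tp// -cintegral_tp// Re_cintegral -rIZ// /nrm2.
rewrite -rIB; [|exact: hF.2|exact: rintbleZl].
rewrite -rID; [|exact: (rintbleB hF.2 (rintbleZl _ iFt))|exact: hQ.2].
apply: eq_rI => g; have [c1|[-> ->]] := offQ_cases g oF.
  rewrite c1 mul1r /cabs2 ReB ImB ReJ ImJ ReM; ring.
by rewrite !mul0r conjc0 subrr cabs20 /=; ring.
Qed.

Lemma bessel F (ks : seq V) : 0 < vol -> L2 F -> offQ F -> uniq ks ->
  (forall k, k \in ks -> lat L k) -> \sum_(k <- ks) cabs2 (ft F k) <= vol * nrm2 F.
Proof.
move=> v0 hF oF uks lks.
(* The coefficients of the orthogonal projection of the conjugate of F, which minimise the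
   distance. *)
pose s := [seq (k, (vol^-1%:C)%C * ((ft F k)^*)%C) | k <- ks].
have us : uniq [seq p.1 | p <- s] by rewrite -map_comp map_id.
have ls : lats s by move=> p /mapP[k kks ->]; exact: lks.
have := nrm2_ge0 (fun g => (F g)^*%C - cind QL g * tp s (vec_of g)).
rewrite nrm2_dist// /s !big_map /=.
rewrite Re_sum (eq_bigr (fun k => vol^-1 * cabs2 (ft F k))); last first.
  move=> k _; rewrite -mulrA (mulrC ((ft F k)^*)%C) mulJ_cabs2 ReM /=; ring.
rewrite [X in vol * X](eq_bigr (fun k => vol^-1 ^+ 2 * cabs2 (ft F k))); last first.
  move=> k _; rewrite -(cabs2J (ft F k)) [LHS]cabs2M; congr (_ * _).
  by rewrite /cabs2 /= expr0n addr0.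
rewrite -!mulr_sumr; set S := \sum_(_ <- _) _.
rewrite (_ : _ + _ = nrm2 F - vol^-1 * S); last by field; rewrite gt_eqF.
by rewrite subr_ge0 ler_pdivrMl.
Qed.

Definition L2app F := forall e, 0 < e -> exists2 s, lats s &
  nrm2 (fun g => (F g)^*%C - cind QL g * tp s (vec_of g)) < e.

Lemma parseval_app F S : 0 < vol -> L2 F -> offQ F -> L2app F ->
  (forall ks, uniq ks -> (forall k, k \in ks -> lat L k) ->
     \sum_(k <- ks) cabs2 (ft F k) <= S) -> vol * nrm2 F <= S.
Proof.
move=> v0 hF oF aF hS; apply/ler_addgt0Pr => e e0.
have [|s ls hs] := aF (e / vol); first by rewrite divr_gt0.
have [s' us' [ss' es']] := tp_uniq s.
have ls' : lats s' by move=> p /ss' /mapP[q qs ->]; exact: ls.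
have hs' : nrm2 (fun g => (F g)^*%C - cind QL g * tp s' (vec_of g)) < e / vol.
  by apply: le_lt_trans hs; rewrite le_eqVlt; apply/orP; left; apply/eqP/eq_rI => g; rewrite es'.
move: hs'; rewrite nrm2_dist//.
have hS' : \sum_(p <- s') cabs2 (ft F p.1) <= S.
  rewrite -(big_map (fun p => p.1) xpredT (fun k => cabs2 (ft F k))).
  by apply: hS => // k /mapP[p ps ->]; exact: ls'.
(* The square is completed frequency by frequency: the left side is the sum of |conj (ft F k) - vol
   c_k|^2. Hence vol times the distance is at least vol [nrm2 F] - S, and it is also below e. *)
have : \sum_(p <- s') cabs2 (ft F p.1) - 2 * vol * Re (\sum_(p <- s') p.2 * ft F p.1) +
  vol ^+ 2 * \sum_(p <- s') cabs2 p.2 >= 0.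
  rewrite Re_sum !mulr_sumr -sumrB -big_split /=; apply: sumr_ge0 => p _.
  have := cabs2_ge0 (((ft F p.1)^*)%C - (vol%:C)%C * p.2).
  rewrite /cabs2 ReB ImB ReJ ImJ !ReM !ImM /= => /le_trans; apply.
  by rewrite le_eqVlt; apply/orP; left; apply/eqP; ring.
rewrite ltr_pdivlMr//; move: hS'; set a := Re _; set b := \sum_(_ <- _) cabs2 _.2; set c := \sum_(_ <- _) _.
by move=> h1 h2 h3; nra.
Qed.

End lattice_L2.

(** * Density of trigonometric polynomials in L2 of a cube *)

Section density.
Context {R : realType} {n : nat}.
Local Notation V := 'rV[R]_n.+1.
Local Notation T := (@Rd R n.+1).
Local Notation leb := (@lebesgue_d R n.+1).
Local Notation Re := complex.Re.
Local Notation Im := complex.Im.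
Variable L : R.
Hypothesis L0 : 0 < L.
Local Notation QL := (@Q R n L).
Implicit Types (g h : T -> R[i]) (f : T -> R) (s : seq (V * R[i])).

(* This class is an algebra stable under bounded pointwise limits, so that it contains the
   indicator of every Borel set once it contains those of half-spaces. *)
Definition L2cl g := [/\ cmeasurable g, (exists M, forall x, cabs (g x) <= M) &
  forall e, 0 < e -> exists2 s, lats L s &
    nrm2 (fun x => cind QL x * (g x - tp s (vec_of x))) < e].

Lemma L2_cindB g s M : cmeasurable g -> (forall x, cabs (g x) <= M) ->
  L2 (fun x => cind QL x * (g x - tp s (vec_of x))).
Proof.
move=> mg gM; apply: (@L2_bounded _ _ _ _ (M + \sum_(p <- s) cabs p.2)).
  by apply: cmeasurableB => //; exact: cmeasurable_tp.
by move=> x; apply: le_trans (cabsD _ _) _; rewrite cabsN lerD// tp_bound.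
Qed.

Lemma nrm2_eq0 g : (forall x, g x = 0) -> nrm2 g = 0.
Proof.
by move=> g0; rewrite /nrm2 /rI; under eq_integral do rewrite g0 cabs20; rewrite integral0.
Qed.

Lemma eq_nrm2 g h : (forall x, g x = h x) -> nrm2 g = nrm2 h.
Proof. by move=> /funext ->. Qed.

Lemma L2cl_tp s : lats L s -> L2cl (fun x => tp s (vec_of x)).
Proof.
move=> ls; split; first exact: cmeasurable_tp.
  by exists (\sum_(p <- s) cabs p.2) => x; exact: tp_bound.
by move=> e e0; exists s => //; rewrite nrm2_eq0// => x; rewrite subrr mulr0.
Qed.

Lemma L2cl_cst (a : R[i]) : L2cl (fun=> a).
Proof.
have := @L2cl_tp [:: (0, a)]; rewrite (_ : (fun _ => _) = (fun=> a)).
  by apply; move=> p; rewrite inE => /eqP ->; exact: lat0.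
by apply/funext => x; rewrite /tp big_seq1 /= ez0r mulr1.
Qed.

Lemma L2clD g h : L2cl g -> L2cl h -> L2cl (fun x => g x + h x).
Proof.
move=> [mg [M gM] ag] [mh [N hN] ah]; split; first exact: cmeasurableD.
  by exists (M + N) => x; apply: le_trans (cabsD _ _) (lerD _ _).
move=> e e0; have [|s ls hs] := ag (e / 4); first by rewrite divr_gt0.
have [|t lt ht] := ah (e / 4); first by rewrite divr_gt0.
exists (s ++ t) => [p|]; first by rewrite mem_cat => /orP[/ls|/lt].
have := nrm2D (L2_cindB s mg gM) (L2_cindB t mh hN).
rewrite (@eq_nrm2 _ (fun x => cind QL x * (g x + h x - tp (s ++ t) (vec_of x)))) => [?|x].
  by lra.
by rewrite tp_cat; ring.
Qed.

Lemma L2clM g h : L2cl g -> L2cl h -> L2cl (fun x => g x * h x).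
Proof.
move=> [mg [M gM] ag] [mh [N hN] ah]; split; first exact: cmeasurableM.
  by exists (M * N) => x; rewrite cabsM ler_pM ?cabs_ge0.
have M0 : 0 <= M := le_trans (cabs_ge0 _) (gM (0 : V)).
(* The error is g (h - t) + t (g - s). So h is approximated first, because the tolerance for g
   depends on the bound [B] of the polynomial t just found. The + 1 keeps the divisors positive. *)
move=> e e0; have [|t lt ht] := ah (e / (8 * (M ^+ 2 + 1))).
  by rewrite divr_gt0// mulr_gt0// ltr_wpDl// sqr_ge0.
set B := \sum_(p <- t) cabs p.2.
have B0 : 0 <= B by apply: sumr_ge0 => p _; exact: cabs_ge0.
have [|s ls hs] := ag (e / (8 * (B ^+ 2 + 1))).
  by rewrite divr_gt0// mulr_gt0// ltr_wpDl// sqr_ge0.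
exists (tp_mul s t).
  by move=> _ /allpairsP[[p q] [/= /ls ps /lt qt ->]]; exact: latD.
have hL := L2_cindB t mh hN; have gL := L2_cindB s mg gM.
have mt := @cmeasurable_tp R n t.
set h1 := (fun x => cind QL x * (h x - tp t (vec_of x))) in hL ht.
set g1 := (fun x => cind QL x * (g x - tp s (vec_of x))) in gL hs.
have L2a : L2 (fun x => g x * h1 x).
  apply: (@L2_le _ _ _ h1 (M ^+ 2)) => // [|x]; first exact: cmeasurableM mg hL.1.
  by rewrite cabs2M ler_wpM2r ?cabs2_ge0// cabs2_le.
have L2b : L2 (fun x => tp t (vec_of x) * g1 x).
  apply: (@L2_le _ _ _ g1 (B ^+ 2)) => // [|x]; first exact: cmeasurableM mt gL.1.
  by rewrite cabs2M ler_wpM2r ?cabs2_ge0// cabs2_le ?tp_bound.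
have ha : nrm2 (fun x => g x * h1 x) <= M ^+ 2 * nrm2 h1.
  by apply: nrm2_le => // x; rewrite cabs2M ler_wpM2r ?cabs2_ge0// cabs2_le.
have hb : nrm2 (fun x => tp t (vec_of x) * g1 x) <= B ^+ 2 * nrm2 g1.
  by apply: nrm2_le => // x; rewrite cabs2M ler_wpM2r ?cabs2_ge0// cabs2_le ?tp_bound.
have := nrm2D L2a L2b.
rewrite (@eq_nrm2 _ (fun x => cind QL x * (g x * h x - tp (tp_mul s t) (vec_of x)))); last first.
  by move=> x; rewrite tp_mulE /h1 /g1; ring.
have sq a : 0 <= a ^+ 2 :> R by exact: sqr_ge0.
have key (a b : R) : 0 <= a -> b < e / (8 * (a + 1)) -> a * b <= e / 8.
  move=> a0; rewrite ltr_pdivlMr; last by rewrite mulr_gt0// ltr_wpDl.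
  move=> hab; rewrite ler_pdivlMr//.
  have [b0|b0] := leP 0 b; first by nra.
  by apply: le_trans (ltW e0); nra.
have := key _ _ (sq M) ht; have := key _ _ (sq B) hs.
by move=> ? ? ?; lra.
Qed.

Lemma L2clZ a g : L2cl g -> L2cl (fun x => a * g x).
Proof. by apply: L2clM; exact: L2cl_cst. Qed.

Lemma L2clB g h : L2cl g -> L2cl h -> L2cl (fun x => g x - h x).
Proof.
move=> hg hh; rewrite (_ : (fun _ => _) = (fun x => g x + (-1) * h x)).
  by apply: L2clD => //; exact: L2clZ.
by apply/funext => x; rewrite mulN1r.
Qed.

Lemma L2cl_sum (I : Type) (r : seq I) (G : I -> T -> R[i]) :
  (forall i, L2cl (G i)) -> L2cl (fun x => \sum_(i <- r) G i x).
Proof.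
move=> hG; elim: r => [|i r ih].
  by under eq_fun do rewrite big_nil; exact: L2cl_cst.
by under eq_fun do rewrite big_cons; exact: L2clD.
Qed.

Lemma L2clJ g : L2cl g -> L2cl (fun x => (g x)^*%C).
Proof.
move=> [mg [M gM] ag]; split; first exact: cmeasurableJ.
  by exists M => x; rewrite /cabs cabs2J; exact: gM.
move=> e /ag [s ls hs]; exists (tp_conj s).
  by move=> _ /mapP[p /ls lp ->]; exact: latN.
apply: le_lt_trans hs; rewrite le_eqVlt; apply/orP; left; apply/eqP/eq_rI => x.
by rewrite tp_conjE !cabs2M -rmorphB /= cabs2J.
Qed.

Lemma L2cl_Re g : L2cl g -> L2cl (fun x => ((Re (g x))%:C)%C).
Proof.
move=> hg; have := L2clZ (2^-1) (L2clD hg (L2clJ hg)); congr L2cl; apply/funext => x.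
by rewrite addcJ mulrA mulVf ?mul1r// pnatr_eq0.
Qed.

Lemma L2cl_eqQ g h M : L2cl g -> cmeasurable h -> (forall x, cabs (h x) <= M) ->
  (forall x, QL x -> h x = g x) -> L2cl h.
Proof.
move=> [mg _ ag] mh hM hg; split => //; first by exists M.
move=> e /ag [s ls hs]; exists s => //.
apply: le_lt_trans hs; rewrite le_eqVlt; apply/orP; left; apply/eqP/eq_rI => x.
rewrite /cind indicE; case: (boolP (x \in QL)) => [|_]; last by rewrite !mul0r.
by rewrite inE => /hg ->.
Qed.

(** Dominated convergence on the cube brings some [u N] close to h in norm, and a polynomial close
    to [u N] then serves h. *)
Lemma L2cl_lim (u : nat -> T -> R[i]) h M : (forall k, L2cl (u k)) ->
  (forall k x, cabs (u k x) <= M) -> cmeasurable h ->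
  (forall x, ccvg (u^~ x) (h x)) -> L2cl h.
Proof.
move=> hu uM mh uh.
have hM x : cabs (h x) <= M by exact: ccvg_bound (uh x).
split => //; first by exists M.
have M0 : 0 <= M := le_trans (cabs_ge0 _) (hM (0 : V)).
have mu_ k : cmeasurable (u k) by case: (hu k).
have mB k : cmeasurable (fun x => h x - u k x) by exact: cmeasurableB.
have bB k x : cabs (h x - u k x) <= M + M.
  by apply: le_trans (cabsD _ _) _; rewrite cabsN lerD.
have LW k : L2 (fun x => cind QL x * (h x - u k x)) by exact: (@L2_bounded _ _ _ _ (M + M)).
have d0 x : cabs2 (cind QL x * (h x - u k x)) @[k --> \oo] --> (0 : R).
  have : cabs (u k x - h x) ^+ 2 @[k --> \oo] --> (0 : R) ^+ 2.
    by rewrite !expr2; under eq_fun do rewrite expr2; apply: cvgM; exact: uh.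
  rewrite expr0n => w0; apply: (squeeze_cvgr _ (cvg_cst 0) w0).
  apply: nearW => k; rewrite cabs2_ge0 /= cabs2M cabs2E cabs_cind cabs2E cabsBC.
  by rewrite indicE ler_piMl ?sqr_ge0//; case: (_ \in _); rewrite ?expr1n ?expr0n.
have db k x : `|cabs2 (cind QL x * (h x - u k x))| <= (M + M) ^+ 2 * \1_QL x.
  rewrite ger0_norm ?cabs2_ge0// cabs2M cabs2E cabs_cind mulrC indicE.
  have : cabs2 (h x - u k x) <= (M + M) ^+ 2 by rewrite cabs2_le ?addr_ge0.
  by case: (_ \in _); rewrite ?expr1n ?expr0n ?mulr1 ?mulr0.
have := rdominated (fun k => measurable_cabs2 (LW k).1) d0 db (rintbleZl _ (rintble_Q L)).
move=> /cvg0_small w0 e e0.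
have [|N /(_ N (leqnn _)) hN] := w0 (e / 4); first by rewrite divr_gt0.
have [_ _ /(_ (e / 4))] := hu N; case; first by rewrite divr_gt0.
move=> s ls hs; exists s => //.
have := nrm2D (LW N) (L2_cindB s (mu_ N) (uM N)).
rewrite (@eq_nrm2 _ (fun x => cind QL x * (h x - tp s (vec_of x)))); last by move=> x; ring.
have : nrm2 (fun x => cind QL x * (h x - u N x)) < e / 4 by apply: le_lt_trans (ler_norm _) hN.
by move=> ? ?; lra.
Qed.

Definition L2clr f := L2cl (fun x => ((f x)%:C)%C).

Lemma L2clr_measurable f : L2clr f -> measurable_fun setT f.
Proof. by case=> -[]. Qed.

Lemma L2clrD f1 f2 : L2clr f1 -> L2clr f2 -> L2clr (fun x => f1 x + f2 x).
Proof.
by move=> h1 h2; have := L2clD h1 h2; congr L2cl; apply/funext => x; rewrite rmorphD.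
Qed.

Lemma L2clrM f1 f2 : L2clr f1 -> L2clr f2 -> L2clr (fun x => f1 x * f2 x).
Proof.
by move=> h1 h2; have := L2clM h1 h2; congr L2cl; apply/funext => x; rewrite rmorphM.
Qed.

Lemma L2clr_cst (a : R) : L2clr (fun=> a). Proof. exact: L2cl_cst. Qed.

Lemma L2clrZ a f : L2clr f -> L2clr (fun x => a * f x).
Proof. by apply: L2clrM; exact: L2clr_cst. Qed.

Lemma L2clrB f1 f2 : L2clr f1 -> L2clr f2 -> L2clr (fun x => f1 x - f2 x).
Proof.
by move=> h1 h2; have := L2clB h1 h2; congr L2cl; apply/funext => x; rewrite rmorphB.
Qed.

Lemma L2clr_lim (u : nat -> T -> R) f M : (forall k, L2clr (u k)) ->
  (forall k x, `|u k x| <= M) -> measurable_fun setT f ->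
  (forall x, u k x @[k --> \oo] --> f x) -> L2clr f.
Proof.
move=> hu uM mf uf; apply: (@L2cl_lim (fun k x => ((u k x)%:C)%C) _ M) => //.
  by move=> k x; rewrite cabs_real.
move=> x; rewrite /ccvg; under eq_fun do rewrite -rmorphB cabs_real.
have h : u k x - f x @[k --> \oo] --> (0 : R).
  by rewrite -(subrr (f x)); apply: cvgB => //; exact: cvg_cst.
by rewrite -(@normr0 _ R); exact: cvg_norm.
Qed.

(* The monotone iteration s := s + (f ^+ 2 - s ^+ 2) / 2 for the square root of f ^+ 2. *)
Lemma L2clr_abs1 f : L2clr f -> (forall x, `|f x| <= 1) -> L2clr (fun x => `|f x|).
Proof.
move=> hf f1.
pose u := fix u (k : nat) (x : T) : R :=
  if k is j.+1 then u j x + 2^-1 * (f x * f x - u j x * u j x) else 0.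
have hu k : L2clr (u k).
  elim: k => [|k ih]; first exact: L2clr_cst.
  by apply: L2clrD => //; apply: L2clrZ; apply: L2clrB; exact: L2clrM.
have ub k x : 0 <= u k x <= `|f x| /\ `|f x| - u k x <= (1 - `|f x| / 2) ^+ k.
  have fx := f1 x; have f0 := normr_ge0 (f x).
  elim: k => [|k [/andP[u0 uf] ih]]; first by rewrite /= lexx f0 expr0 subr0.
  (* The error obeys |f| - u' = (|f| - u) (1 - (|f| + u) / 2), which yields both monotonicity and
     the geometric rate 1 - |f| / 2. *)
  have -> : u k.+1 x = u k x + 2^-1 * (`|f x| ^+ 2 - u k x * u k x).
    by rewrite real_normK ?num_real// expr2.
  split; first by apply/andP; split; nra.
  rewrite [leRHS]exprS; apply: le_trans (_ : (1 - `|f x| / 2) * (`|f x| - u k x) <= _).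
    by nra.
  by rewrite ler_wpM2l//; lra.
apply: (@L2clr_lim u _ 1) => // [k x||x].
- by have [/andP[u0 uf] _] := ub k x; rewrite ger0_norm// (le_trans uf).
- by apply: measurableT_comp => //; exact: L2clr_measurable.
have [fx0|fx0] := eqVneq (f x) 0.
  rewrite fx0 normr0; apply: cvg_near_cst; apply: nearW => k.
  have [/andP[u0 +] _] := ub k x; rewrite fx0 normr0 => u1.
  by apply/eqP; rewrite eq_le u0 u1.
apply/cvgrPdist_le => e e0.
have z1 : `|1 - `|f x| / 2| < 1.
  have := f1 x; have : 0 < `|f x| by rewrite normr_gt0.
  by move=> *; rewrite ltr_norml; lra.
have /cvg0_small/(_ e0)[N hN] := cvg_expr z1.
exists N => // k /= Nk; have h' := hN k Nk; have [/andP[u0 uf] h] := ub k x.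
rewrite ger0_norm ?subr_ge0//; apply: le_trans h _.
by apply: le_trans (ltW h'); exact: ler_norm.
Qed.

Lemma L2clr_abs f : L2clr f -> L2clr (fun x => `|f x|).
Proof.
move=> hf; have [_ [M fM] _] := hf.
have M1 : 0 < M + 1.
  by rewrite ltr_wpDl// (le_trans (cabs_ge0 _) (fM (0 : V))).
have Mi : `|(M + 1)^-1| = (M + 1)^-1 by rewrite ger0_norm// invr_ge0 ltW.
have := L2clrZ (M + 1) (@L2clr_abs1 (fun x => (M + 1)^-1 * f x) (L2clrZ _ hf) _).
rewrite (_ : (fun x => _ * _) = (fun x => `|f x|)); last first.
  apply/funext => x; rewrite normrM Mi.
  by rewrite mulrA divff ?mul1r// gt_eqF.
apply=> x; rewrite normrM Mi ler_pdivrMl// mulr1.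
by have := fM x; rewrite cabs_real; lra.
Qed.

(** The functions min (1, k f^+) tend to the indicator of {f > 0}; positive part and minimum are
    both written with absolute values, which stay in the class by [L2clr_abs]. *)
Lemma L2clr_pos f : L2clr f -> L2clr (fun x => if 0 < f x then 1 else 0).
Proof.
move=> hf; have mf := L2clr_measurable hf.
pose w k x : R := 2^-1 * ((1 + k%:R * (2^-1 * (f x + `|f x|))) -
   `|1 - k%:R * (2^-1 * (f x + `|f x|))|).
have hp k : L2clr (fun x => k%:R * (2^-1 * (f x + `|f x|))).
  by do 2 apply: L2clrZ; apply: L2clrD => //; exact: L2clr_abs.
have wpos k x : 0 < f x -> w k x = Order.min 1 (k%:R * f x).
  move=> fx; rewrite /w (ger0_norm (ltW fx)).
  rewrite (_ : 2^-1 * (f x + f x) = f x); last by field.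
  by case: (leP 1 (k%:R * f x)) => h; [rewrite ler0_norm|rewrite ger0_norm]; lra.
have wneg k x : f x <= 0 -> w k x = 0.
  by move=> fx; rewrite /w (ler0_norm fx) subrr !mulr0 addr0 subr0 normr1 subrr mulr0.
apply: (@L2clr_lim w _ 1) => [k|k x||x].
- apply: L2clrZ; apply: L2clrB; first by apply: L2clrD => //; exact: L2clr_cst.
  by apply: L2clr_abs; apply: L2clrB => //; exact: L2clr_cst.
- have [fx|fx] := ltP 0 (f x); last by rewrite wneg// normr0.
  have kf : 0 <= k%:R * f x by rewrite mulr_ge0// ltW.
  rewrite wpos// ger0_norm; first by rewrite ge_min lexx.
  by rewrite le_min ler01.
- apply: measurable_fun_ifT; [|exact: measurable_cst|exact: measurable_cst].
  by apply: measurable_fun_ltr => //; exact: measurable_cst.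
have [fx|fx] := ltP 0 (f x); last first.
  by apply: cvg_near_cst; apply: nearW => k; exact: wneg.
apply: cvg_near_cst.
exists (Num.bound (f x)^-1) => // k /= hk.
rewrite wpos//; apply/min_idPl.
rewrite -ler_pdivrMr// mul1r; apply: le_trans (ltW (archi_boundP _)) _.
  by rewrite invr_ge0 ltW.
by rewrite ler_nat.
Qed.

End density.

Section parseval.
Import HBNNSimple.
Context {R : realType} {n : nat}.
Local Notation V := 'rV[R]_n.+1.
Local Notation T := (@Rd R n.+1).
Local Notation leb := (@lebesgue_d R n.+1).
Local Notation Re := complex.Re.
Local Notation Im := complex.Im.
Variable L : R.
Hypothesis L0 : 0 < L.
Local Notation QL := (@Q R n L).
Implicit Types (F g h : T -> R[i]) (f : T -> R) (s : seq (V * R[i])).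

Lemma indic_le1 (A : set T) x : `|\1_A x : R| <= 1.
Proof. by rewrite indicE; case: (_ \in _); rewrite ?normr1 ?normr0. Qed.

Lemma cabs_cind_le1 (A : set T) x : cabs (cind A x : R[i]) <= 1.
Proof. by rewrite cabs_cind; have := indic_le1 A x; rewrite ger0_norm. Qed.

Lemma measurable_ltcoord (i : 'I_n.+1) (c : R) : measurable [set x : T | vec_of x ord0 i < c].
Proof. by apply: measurable_open; exact: halfspace_open. Qed.

(* With th = pi x_i / L and t = pi c / L, the function
   2 sin ((th + pi) / 2) sin ((th - t) / 2) = cos ((pi + t) / 2) - cos (th + (pi - t) / 2)
   is a trigonometric polynomial, positive on [Q L] exactly when th > t. *)
Lemma L2cl_gt_coord (i : 'I_n.+1) (c : R) : L2cl L (cind [set x : T | c < vec_of x ord0 i]).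
Proof.
pose A : set T := [set x | c < vec_of x ord0 i].
have mA : measurable A.
  rewrite (_ : A = ~` \bigcap_k [set x : T | vec_of x ord0 i < c + k.+1%:R^-1]).
    by apply: measurableC; apply: bigcapT_measurable => k; exact: measurable_ltcoord.
  apply/seteqP; split => x; rewrite /A /=.
    move=> cx /= h; have [k hk] : exists k : nat, k.+1%:R^-1 < vec_of x ord0 i - c.
      have d0 : 0 < vec_of x ord0 i - c by rewrite subr_gt0.
      exists (Num.bound (vec_of x ord0 i - c)^-1).
      rewrite -[ltRHS]invrK ltf_pV2 ?posrE ?invr_gt0//.
      apply: lt_le_trans (archi_boundP _) _; first by rewrite invr_ge0 ltW.
      by rewrite ler_nat.
    have h1 : vec_of x ord0 i < c + k.+1%:R^-1 := h k I.
    by move: hk; rewrite ltrBrDl => /(lt_trans h1); rewrite ltxx.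
  rewrite ltNge; apply: contra_notN => xc k _ /=.
  by apply: le_lt_trans xc _; rewrite ltrDl invr_gt0.
have mi : cmeasurable (cind A : T -> R[i]) by exact: cmeasurable_cind.
have [cL|cL] := ltP c (- L).
  apply: (@L2cl_eqQ _ _ _ (fun=> 1) _ 1) => // [|x|x /QE /(_ i) hx]; first exact: L2cl_cst.
    exact: cabs_cind_le1.
  by rewrite /cind indicE mem_set// /A /=; lra.
have [Lc|Lc] := leP L c.
  apply: (@L2cl_eqQ _ _ _ (fun=> 0) _ 1) => // [|x|x /QE /(_ i) hx]; first exact: L2cl_cst.
    exact: cabs_cind_le1.
  by rewrite /cind indicE memNset// /A /= => ?; lra.
pose t := pi * c / L.
pose k : V := (2 * L)^-1 *: delta_mx ord0 i.
have lk : lat L k.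
  move=> j; exists (if j == i then 1 else 0); rewrite /k !mxE eqxx /=.
  by case: eqP => _; rewrite ?mulr1 ?mulr0 ?mul1r ?mul0r.
have ezk (x : T) : ez (vec_of x) k = expi (pi * vec_of x ord0 i / L).
  rewrite /ez dotvZr /dotv (bigD1 i) //= big1 => [|j ji]; rewrite /k !mxE ?eqxx ?mulr1 ?addr0.
    by congr expi; field; rewrite gt_eqF.
  by rewrite (negPf ji) mulr0.
pose w (x : T) : R := cos ((pi + t) / 2) -
   Re (expi ((pi - t) / 2) * tp [:: (k, 1)] (vec_of x)).
have hw : L2clr L w.
  apply: L2clrB; first exact: L2clr_cst.
  apply: L2cl_Re; apply: L2clZ; apply: L2cl_tp => p; rewrite inE => /eqP -> //.
apply: (@L2cl_eqQ _ _ _ _ _ 1 (L2clr_pos hw)) => // [x|x]; first exact: cabs_cind_le1.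
move=> /QE /(_ i) hx; rewrite /cind indicE.
set y := vec_of x ord0 i in hx *.
have wE : w x = 2 * (sin ((pi * y / L + pi) / 2) * sin ((pi * y / L - t) / 2)).
  have tpE : tp [:: (k, 1)] (vec_of x) = expi (pi * y / L).
    by rewrite /tp big_seq1 -ezk mul1r.
  rewrite /w tpE -expiD /=.
  set a := (pi * y / L + pi) / 2; set b := (pi * y / L - t) / 2.
  rewrite (_ : (pi + t) / 2 = a - b); last by rewrite /a /b; field; rewrite gt_eqF.
  rewrite (_ : (pi - t) / 2 + pi * y / L = a + b); last by rewrite /a /b; field; rewrite gt_eqF.
  by rewrite cosB cosD; ring.
have p0 := @pi_gt0 R.
have yL : - pi <= pi * y / L < pi.
  by rewrite ler_pdivlMr// ltr_pdivrMr//; nra.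
have tL : - pi <= t < pi by rewrite /t ler_pdivlMr// ltr_pdivrMr//; nra.
have tyE : (t < pi * y / L) = (c < y) by rewrite /t ltr_pM2r ?invr_gt0// ltr_pM2l.
have -> : (x \in A) = (0 < w x).
  rewrite [LHS](_ : _ = (c < y)); last by apply/idP/idP; rewrite ?inE.
  rewrite -tyE wE pmulr_rgt0//; set th := pi * y / L in yL *.
  have [tth|tth] := ltP t th.
    by rewrite mulr_gt0// sin_gt0_pi//; lra.
  apply/esym/negbTE; rewrite -leNgt.
  have : 0 <= sin ((th + pi) / 2) by apply: sin_ge0_pi; lra.
  have : 0 <= sin (- ((th - t) / 2)) by apply: sin_ge0_pi; lra.
  by rewrite sinN => *; nra.
by case: ifP.
Qed.

Lemma L2cl_setC (A : set T) : L2cl L (cind A) -> L2cl L (cind (~` A)).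
Proof.
move=> hA; have := L2clB (L2cl_cst L 1) hA; congr L2cl; apply/funext => x.
by rewrite /cind !indicE in_setC; case: (_ \in _); rewrite /= ?subr0 ?subrr.
Qed.

Lemma cvg_indic_eventually (A : nat -> set T) (B : set T) x N :
  (forall k, (N <= k)%N -> A k x <-> B x) ->
  ccvg (fun k => cind (A k) x : R[i]) (cind B x).
Proof.
move=> h; rewrite /ccvg; apply: cvg_near_cst.
exists N => // k /= /h kx; rewrite /cind !indicE.
rewrite (_ : (x \in A k) = (x \in B)) ?subrr ?cabs0//.
by apply/idP/idP; rewrite !inE => /kx.
Qed.

(** The closed half-space {c <= x_i} is the limit of the open ones {c - 1/(k+1) < x_i}, and its
    complement has the form that [borel_ind] takes as generator. *)
Lemma L2cl_lt_coord (i : 'I_n.+1) (c : R) : L2cl L (cind [set x : T | vec_of x ord0 i < c]).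
Proof.
have h : L2cl L (cind [set x : T | c <= vec_of x ord0 i]).
  apply: (@L2cl_lim _ _ _ (fun k => cind [set x : T | c - k.+1%:R^-1 < vec_of x ord0 i]) _ 1).
  - by move=> k; exact: L2cl_gt_coord.
  - by move=> k x; exact: cabs_cind_le1.
  - apply: cmeasurable_cind; rewrite (_ : [set _ | _] = ~` [set x : T | vec_of x ord0 i < c]).
      by apply: measurableC; exact: measurable_ltcoord.
    by apply/seteqP; split => x /=; rewrite leNgt => /negP.
  move=> x; have [cx|cx] := leP c (vec_of x ord0 i).
    apply: (@cvg_indic_eventually _ _ x 0) => k _ /=; split => // _.
    by rewrite ltrBlDr (le_lt_trans cx)// ltrDl invr_gt0.
  have d0 : 0 < c - vec_of x ord0 i by rewrite subr_gt0.
  apply: (@cvg_indic_eventually _ _ x (Num.bound (c - vec_of x ord0 i)^-1)) => k hk /=.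
  split=> [h|]; last by move=> h; lra.
  have : k.+1%:R^-1 < c - vec_of x ord0 i.
    rewrite -[ltRHS]invrK ltf_pV2 ?posrE ?invr_gt0//.
    apply: lt_le_trans (archi_boundP _) _; first by rewrite invr_ge0 ltW.
    by rewrite ler_nat (leq_trans hk).
  by rewrite ltrBrDl; move: h; rewrite ltrBlDr => h /(lt_trans h); rewrite ltxx.
have := L2cl_setC h; rewrite (_ : ~` _ = [set x : T | vec_of x ord0 i < c])//.
by apply/seteqP; split => x /=; rewrite ltNge => /negP.
Qed.

Lemma L2cl_measurable (A : set T) : measurable A -> L2cl L (cind A).
Proof.
move=> mA; suff [] : measurable A /\ L2cl L (cind A) by [].
move: A mA; apply: borel_ind; last first.
  by move=> i c; split; [exact: measurable_ltcoord|exact: L2cl_lt_coord].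
split.
- split=> //; rewrite (_ : cind set0 = fun=> 0); first exact: L2cl_cst.
  by apply/funext => x; rewrite /cind indic0.
- by move=> A [mA hA]; rewrite setTD; split; [exact: measurableC|exact: L2cl_setC].
move=> A hA; have mA k : measurable (A k) by case: (hA k).
split; first exact: bigcupT_measurable.
(* Finite unions stay in the algebra, the indicator of a union being 1_A + 1_B - 1_A 1_B; the
   countable union is their bounded limit. *)
apply: (@L2cl_lim _ _ _ (fun k => cind (\bigcup_(j < k) A j)) _ 1).
- elim=> [|k ih].
    rewrite (_ : cind _ = fun=> 0); first exact: L2cl_cst.
    by apply/funext => x; rewrite /cind bigcup_mkord big_ord0 indic0.
  have := L2clB (L2clD ih (hA k).2) (L2clM ih (hA k).2); congr L2cl; apply/funext => x.
  have -> : \bigcup_(j < k.+1) A j = \bigcup_(j < k) A j `|` A k.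
    by rewrite !bigcup_mkord big_ord_recr.
  rewrite /cind !indicE in_setU.
  by case: (_ \in _); case: (_ \in _); apply: complex_ext; rewrite /= ?(mulr0, mul0r, mulr1, subr0, addr0, add0r, subrr, oppr0, addrK).
- by move=> k x; exact: cabs_cind_le1.
- by apply: cmeasurable_cind; exact: bigcupT_measurable.
move=> x; have [[j _ Ajx]|nx] := pselect ((\bigcup_k A k) x).
  apply: (@cvg_indic_eventually _ _ x j.+1) => k jk.
  by split=> [[l _ Al]|_]; [exists l|exists j].
apply: (@cvg_indic_eventually _ _ x 0) => k _.
by split=> [[l _ Al]|//]; exists l.
Qed.

Lemma L2clr_bounded_ge0 f M : measurable_fun setT f -> (forall x, 0 <= f x <= M) -> L2clr L f.
Proof.
move=> mf fM.
have mF : measurable_fun [set: T] (EFin \o f) by exact/measurable_EFinP.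
pose u k := nnsfun_approx measurableT mF k.
have uf x : u k x @[k --> \oo] --> f x.
  have f0 y : setT y -> (0 <= (EFin \o f) y)%E by rewrite lee_fin; case/andP: (fM y).
  exact: (fine_cvg (cvg_nnsfun_approx measurableT mF f0 I)).
have ule k x : u k x <= f x.
  have nd : nondecreasing_seq (fun k => u k x).
    by move=> a b ab; exact/lefP/nd_nnsfun_approx.
  have := nondecreasing_cvgn_le nd (cvgP _ (uf x)) k.
  by rewrite (cvg_lim _ (uf x)).
apply: (@L2clr_lim _ _ _ u _ M) => // k.
  rewrite /L2clr; rewrite (_ : (fun _ => _) =
    (fun x => \sum_(i < #|` fset_set (u k @` setT)|)
       (((fset_set (u k @` setT))`_i)%:C)%C * cind (u k @^-1` [set (fset_set (u k @` setT))`_i]) x)).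
    apply: L2cl_sum => // i; apply: L2clZ => //; apply: L2cl_measurable.
    exact: measurable_sfunP.
  apply/funext => x; rewrite [in LHS]fimfunEord rmorph_sum; apply: eq_bigr => i _.
  by rewrite rmorphM.
move=> x; rewrite ger0_norm//; apply: le_trans (ule k x) _.
by case/andP: (fM x).
Qed.

Lemma L2cl_bounded g M : cmeasurable g -> (forall x, cabs (g x) <= M) -> L2cl L g.
Proof.
move=> [m1 m2] gM.
have key f : measurable_fun setT f -> (forall x, `|f x| <= M) -> L2clr L f.
  move=> mf fM; rewrite (_ : f = fun x => (f x + M) - M); last by apply/funext => x; rewrite addrK.
  apply: L2clrB => //; last exact: L2clr_cst.
  apply: (@L2clr_bounded_ge0 _ (M + M)).
    by apply: measurable_funD => //; exact: measurable_cst.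
  by move=> x; have := fM x; rewrite ler_norml; lra.
have h1 := key _ m1 (fun x => le_trans (Re_le_cabs _) (gM x)).
have h2 := key _ m2 (fun x => le_trans (Im_le_cabs _) (gM x)).
have := L2clD h1 (L2clZ 'i%C h2); congr L2cl; apply/funext => x.
by rewrite [RHS]complexE.
Qed.

(** F is cut off where |F|^2 > k. The loss tends to 0 in norm by domination, and the conjugate of
    the bounded remainder lies in [L2cl]. *)
Lemma L2app_L2 F : L2 F -> offQ L F -> L2app L F.
Proof.
move=> hF oF e e0.
pose A (k : nat) : set T := [set x | cabs2 (F x) <= k%:R].
have mA k : measurable (A k).
  rewrite (_ : A k = (fun x => cabs2 (F x)) @^-1` `]-oo, k%:R]%classic).
    by rewrite -[_ @^-1` _]setTI; apply: (measurable_cabs2 hF.1).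
  by apply/seteqP; split => x; rewrite /A /= in_itv.
pose G k x := cind (A k) x * F x.
have mG k : cmeasurable (G k) by apply: cmeasurableM hF.1; exact: cmeasurable_cind.
have cG k x : G k x = F x \/ G k x = 0.
  by rewrite /G /cind indicE; case: (_ \in _); rewrite /= ?mul1r ?mul0r; [left|right].
have L2cl_ k : L2 (fun x => F x - G k x).
  apply: (@L2_le _ _ _ F 1) => // [|x]; first by apply: cmeasurableB => //; exact: hF.1.
  by rewrite mul1r; case: (cG k x) => ->; rewrite ?subrr ?cabs20 ?cabs2_ge0 ?subr0.
have d0 x : cabs2 (F x - G k x) @[k --> \oo] --> (0 : R).
  apply: cvg_near_cst; exists (Num.bound (cabs2 (F x))) => // k /= hk.
  rewrite /G /cind indicE mem_set ?mul1r ?subrr ?cabs20// /A /=.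
  apply: le_trans (ltW (archi_boundP (cabs2_ge0 _))) _.
  by rewrite ler_nat.
have db k x : `|cabs2 (F x - G k x)| <= cabs2 (F x).
  by rewrite ger0_norm ?cabs2_ge0//; case: (cG k x) => ->; rewrite ?subrr ?cabs20 ?cabs2_ge0 ?subr0.
have /cvg0_small w0 := rdominated (fun k => measurable_cabs2 (L2cl_ k).1) d0 db hF.2.
have [|N /(_ N (leqnn _)) hN] := w0 (e / 4); first by rewrite divr_gt0.
have GN x : cabs (G N x) <= Num.sqrt N%:R.
  rewrite /cabs ler_wsqrtr//; rewrite /G /cind indicE.
  have [xA|xA] := boolP (x \in A N); first by rewrite mul1r; move: xA; rewrite inE.
  by rewrite mul0r cabs20.
have bG : forall x, cabs ((G N x)^*%C) <= Num.sqrt N%:R by move=> x; rewrite /cabs cabs2J; exact: GN.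
have mGJ := cmeasurableJ (mG N).
have [_ _ /(_ (e / 4))] := L2cl_bounded mGJ bG.
case; first by rewrite divr_gt0.
move=> s ls hs; exists s => //.
have LJ : L2 (fun x => (F x - G N x)^*%C).
  apply: (@L2_le _ _ _ _ 1 _ (L2cl_ N)); first by apply: cmeasurableJ; exact: (L2cl_ N).1.
  by move=> x; rewrite mul1r cabs2J.
have := nrm2D LJ (L2_cindB L s mGJ bG).
rewrite (@eq_nrm2 _ _ _ (fun x => (F x)^*%C - cind QL x * tp s (vec_of x))); last first.
  move=> x; have [c1|[-> F0]] := offQ_cases x oF.
    by rewrite c1 !mul1r rmorphB /=; ring.
  by rewrite /G F0 mulr0 subrr !mul0r conjc0 subr0 addr0.
have -> : nrm2 (fun x => (F x - G N x)^*%C) = nrm2 (fun x => F x - G N x).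
  by apply: eq_rI => x; rewrite cabs2J.
have : nrm2 (fun x => F x - G N x) < e / 4 by apply: le_lt_trans (ler_norm _) hN.
by move=> ? ?; lra.
Qed.

Lemma parseval F S : 0 < fine (leb QL) -> L2 F -> offQ L F ->
  (forall ks, uniq ks -> (forall k, k \in ks -> lat L k) ->
     \sum_(k <- ks) cabs2 (ft F k) <= S) -> fine (leb QL) * nrm2 F <= S.
Proof. by move=> v0 hF oF; apply: parseval_app => //; exact: L2app_L2. Qed.

End parseval.

(** * Bounded functions with prescribed spectrum *)

Section spectral_class.
Context {R : realType} {n : nat}.
Local Notation V := 'rV[R]_n.+1.
Implicit Types (A B C : set V) (f g : V -> R[i]) (s : seq (V * R[i])) (x y t : V).

Definition freqs A s := forall p, p \in s -> A p.1.

(* Stands in for the bounded functions with Fourier transform supported in [A]: balayage passes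
   to such limits by dominated convergence, and products add the frequency sets. *)
Definition spec A f := exists (s : nat -> seq (V * R[i])) (M : R),
  [/\ forall k, freqs A (s k), forall k x, cabs (tp (s k) x) <= M &
      forall x, ccvg (fun k => tp (s k) x) (f x)].

Lemma spec_sub A B f : A `<=` B -> spec A f -> spec B f.
Proof. by move=> AB [s [M [h1 h2 h3]]]; exists s, M; split => // k p /h1 /AB. Qed.

Lemma spec_bounded A f : spec A f -> exists M, forall x, cabs (f x) <= M.
Proof.
by move=> [s [M [_ h2 h3]]]; exists M => x; apply: ccvg_bound (h3 x) => k; exact: h2.
Qed.

Lemma spec_tp A s : freqs A s -> spec A (tp s).
Proof.
move=> As; exists (fun=> s), (\sum_(p <- s) cabs p.2); split => // [k x|x].
  exact: tp_bound.
exact: ccvg_cst.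
Qed.

Lemma spec0 A : spec A (fun=> 0).
Proof.
rewrite (_ : (fun=> 0) = tp [::]); first exact: spec_tp.
by apply/funext => x; rewrite /tp big_nil.
Qed.

Lemma specD A f g : spec A f -> spec A g -> spec A (fun x => f x + g x).
Proof.
move=> [s [M [s1 s2 s3]]] [t [N [t1 t2 t3]]].
exists (fun k => s k ++ t k), (M + N); split.
- by move=> k p; rewrite mem_cat => /orP[/s1|/t1].
- by move=> k x; rewrite tp_cat; apply: le_trans (cabsD _ _) (lerD _ _).
- by move=> x; under eq_fun do rewrite tp_cat; exact: ccvgD.
Qed.

Lemma specM A B C f g : (forall a b, A a -> B b -> C (a + b)) ->
  spec A f -> spec B g -> spec C (fun x => f x * g x).
Proof.
move=> ABC [s [M [s1 s2 s3]]] [t [N [t1 t2 t3]]].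
exists (fun k => tp_mul (s k) (t k)), (M * N); split.
- by move=> k _ /allpairsP[[p q] [/= /s1 ps /t1 qt ->]]; exact: ABC.
- by move=> k x; rewrite tp_mulE cabsM ler_pM ?cabs_ge0.
- by move=> x; under eq_fun do rewrite tp_mulE; exact: ccvgM.
Qed.

Lemma specZ A f (a : R[i]) : spec A f -> spec A (fun x => a * f x).
Proof.
apply: (@specM [set 0] A A (fun=> a)) => [_ b -> |]; first by rewrite add0r.
rewrite (_ : (fun=> a) = tp [:: (0, a)]); last first.
  by apply/funext => x; rewrite /tp big_seq1 ez0r mulr1.
by apply: spec_tp => p; rewrite inE => /eqP ->.
Qed.

Lemma spec_sum A (I : Type) (r : seq I) (F : I -> V -> R[i]) :
  (forall i, spec A (F i)) -> spec A (fun x => \sum_(i <- r) F i x).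
Proof.
move=> hF; elim: r => [|i r ih].
  by under eq_fun do rewrite big_nil; exact: spec0.
by under eq_fun do rewrite big_cons; exact: specD.
Qed.

(** A translation only multiplies the coefficients by unimodular numbers; the dilation moves a
    frequency a to c a. *)
Lemma spec_affine A B f (c : R) t : (forall a, A a -> B (c *: a)) ->
  spec A f -> spec B (fun x => f (t + c *: x)).
Proof.
move=> AB [s [M [s1 s2 s3]]].
pose s' k := [seq (c *: p.1, p.2 * ez t p.1) | p <- s k].
have s'E k x : tp (s' k) x = tp (s k) (t + c *: x).
  rewrite /tp big_map; apply: eq_bigr => p _ /=.
  by rewrite -ezZ -mulrA -ezDl.
exists s', M; split.
- by move=> k _ /mapP[p /s1 ps ->]; exact: AB.
- by move=> k x; rewrite s'E.
- by move=> x; under eq_fun do rewrite s'E; exact: s3.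
Qed.

Definition nball (r : R) : set V := [set g | `|g| <= r].

Lemma nball_coord r (g : V) i : nball r g -> `|g ord0 i| <= r.
Proof. exact: le_trans (le_coord_norm _ _). Qed.

End spectral_class.

Lemma ler_sum_subseq (R : realType) (I : eqType) (F : I -> R) (s t : seq I) :
  (forall i, 0 <= F i) -> uniq s -> uniq t -> {subset s <= t} ->
  \sum_(i <- s) F i <= \sum_(i <- t) F i.
Proof.
move=> F0 us ut st.
have p : perm_eq s [seq i <- t | i \in s].
  apply: uniq_perm => //; first exact: filter_uniq.
  by move=> i; rewrite mem_filter; case: (boolP (i \in s)) => // /st ->.
rewrite (perm_big _ p) big_filter big_mkcond; apply: ler_sum => i _.
by case: ifP.
Qed.

(** * Bernstein's inequality *)

Section bernstein.
Context {R : realType} {n : nat}.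
Local Notation V := 'rV[R]_n.+1.
Local Notation T := (@Rd R n.+1).
Local Notation leb := (@lebesgue_d R n.+1).
Implicit Types (F : T -> R[i]) (f : V -> R[i]) (x y t a : V).

Lemma ccvg_cabs2 (u : nat -> R[i]) l : ccvg u l -> cabs2 (u k) @[k --> \oo] --> cabs2 l.
Proof.
move=> ul; rewrite cabs2E; under eq_fun do rewrite cabs2E.
have h : cabs (u k) @[k --> \oo] --> cabs l.
  apply/cvgrPdist_le => e e0; have [N hN] := cvg0_small ul e0.
  exists N => // k /= /hN; rewrite ger0_norm ?cabs_ge0// => /ltW; apply: le_trans.
  rewrite ler_norml; have := cabs_sub l (u k); have := cabs_sub (u k) l.
  by rewrite (cabsBC l); lra.
by rewrite expr2; under eq_fun do rewrite expr2; exact: cvgM.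
Qed.

Lemma cvg_sum_seq (I : Type) (r : seq I) (u : I -> nat -> R) (l : I -> R) :
  (forall i, u i k @[k --> \oo] --> l i) ->
  \sum_(i <- r) u i k @[k --> \oo] --> \sum_(i <- r) l i.
Proof.
move=> ul; elim: r => [|i r ih].
  by rewrite big_nil; under eq_fun do rewrite big_nil; exact: cvg_cst.
by rewrite big_cons; under eq_fun do rewrite big_cons; exact: cvgD.
Qed.

Lemma cintble_ez F x : cintble leb F -> cintble leb (fun g => F g * ez x (vec_of g)).
Proof.
move=> iF; apply: (@cintbleM _ _ _ _ _ 1) => //; first exact: cmeasurable_ez.
by move=> g; rewrite cabs_ez.
Qed.

Lemma ft_lip F L x y : 0 <= L -> cintble leb F -> offQ L F ->
  cabs (ft F x - ft F y) <= 2 * pi * n.+1%:R * L * `|x - y| * rI leb (fun g => cabs (F g)).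
Proof.
move=> L0 iF oF.
have ix := cintble_ez x iF; have iy := cintble_ez y iF.
rewrite /ft -cintegralB//.
have iB : cintble leb (fun g => F g * ez x (vec_of g) - F g * ez y (vec_of g)).
  rewrite (_ : (fun _ => _) = fun g => F g * ez x (vec_of g) + (-1) * (F g * ez y (vec_of g))).
    by apply: cintbleD => //; exact: cintbleZ.
  by apply/funext => g; rewrite mulN1r.
apply: le_trans (cabs_cintegral iB) _; rewrite -rIZ; last exact: cintble_cabs.
apply: rI_le; [exact: cintble_cabs|exact: rintbleZl (cintble_cabs iF)|move=> g].
rewrite -mulrBr cabsM mulrC.
have [gQ|gQ] := pselect (Q L g); last by rewrite oF// cabs0 !mulr0.
rewrite ler_wpM2r ?cabs_ge0//; apply: le_trans (ez_lip _ _ _) _.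
rewrite -(mulrA _ L) (mulrC L) ler_wpM2l ?mulr_ge0 ?pi_ge0// ler_wpM2l//.
by apply: norm_le_coord => i; move/QE : gQ => /(_ i) h; rewrite ler_norml; lra.
Qed.

Lemma ft_shift F a x : cintble leb F ->
  ft (fun g => F (shiftv (- a) g)) x = ez x a * ft F x.
Proof.
move=> iF; have ie := cintble_ez x iF.
pose h g := ez x a * (F g * ez x (vec_of g)).
have ih : cintble leb h by exact: cintbleZ.
rewrite /ft -cintegralZ// -[RHS](cintegral_shift (- a) ih).
apply: eq_cintegral => g; rewrite /h mulrCA -ezDr; congr (_ * ez x _).
by rewrite /shiftv /vec_of addrC subrK.
Qed.

Lemma cintble_shift F a : cintble leb F -> cintble leb (fun g => F (shiftv a g)).
Proof. by move=> [h1 h2]; split; [exact: (integrable_shift a h1)|exact: (integrable_shift a h2)]. Qed.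

Lemma L2_shift F a : L2 F -> L2 (fun g => F (shiftv a g)).
Proof.
move=> [[m1 m2] h]; split; last exact: (integrable_shift a h).
by split; [exact: (measurableT_comp m1 (measurable_shift a))|
           exact: (measurableT_comp m2 (measurable_shift a))].
Qed.

Lemma L2_sum (I : Type) (r : seq I) (G : I -> T -> R[i]) :
  (forall i, L2 (G i)) -> L2 (fun x => \sum_(i <- r) G i x).
Proof.
move=> hG; elim: r => [|i r ih].
  under eq_fun do rewrite big_nil; split; first exact: cmeasurable_cst.
  by under eq_fun do rewrite cabs20; exact: rintble0.
by under eq_fun do rewrite big_cons; exact: L2D.
Qed.

Lemma L2Z (c : R[i]) F : L2 F -> L2 (fun x => c * F x).
Proof.
move=> hF; apply: (@L2_le _ _ _ F (cabs2 c)) => // [|x]; last by rewrite cabs2M.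
by apply: cmeasurableM hF.1; exact: cmeasurable_cst.
Qed.

Lemma ft_sum (I : Type) (r : seq I) (c : I -> R[i]) (G : I -> T -> R[i]) x :
  (forall i, cintble leb (G i)) ->
  ft (fun g => \sum_(i <- r) c i * G i g) x = \sum_(i <- r) c i * ft (G i) x.
Proof.
move=> iG; rewrite /ft; transitivity (cintegral leb setT
   (fun g => \sum_(i <- r) c i * (G i g * ez x (vec_of g)))).
  apply: eq_cintegral => g; rewrite mulr_suml.
  by apply: eq_bigr => i _; rewrite mulrA.
rewrite cintegral_sum => [|i]; last by apply: cintbleZ; exact: cintble_ez.
by apply: eq_bigr => i _; rewrite cintegralZ//; exact: cintble_ez.
Qed.

(** The approximants are bounded only by some M that depends on f, their limit by 1. A finite set
    carries almost all of the weight w, and there the limit decides; the rest is made negligible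
    against M^2. The final bound is thus free of M. *)
Lemma tannery (D : set V) (w : V -> R) (fk : nat -> V -> R[i]) (f : V -> R[i]) C M :
  (forall k, 0 <= w k) ->
  (forall ks, uniq ks -> (forall k, k \in ks -> D k) -> \sum_(k <- ks) w k <= C) ->
  (forall j k, cabs (fk j k) <= M) -> (forall k, cabs (f k) <= 1) ->
  (forall k, ccvg (fk^~ k) (f k)) ->
  exists N, forall j, (N <= j)%N -> forall ks, uniq ks -> (forall k, k \in ks -> D k) ->
    \sum_(k <- ks) cabs2 (fk j k) * w k <= C + 1.
Proof.
move=> w0 wC fM f1 ff.
have M0 : 0 <= M := le_trans (cabs_ge0 _) (fM 0%N 0).
pose X := [set S : R | exists ks : seq V,
  [/\ uniq ks, forall k, k \in ks -> D k & S = \sum_(k <- ks) w k]].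
have supX : has_sup X.
  split; first by exists 0, [::]; split => //; rewrite big_nil.
  by exists C => _ [ks [u d ->]]; exact: wC.
(* The weight left outside the finite set: it costs M^2 e <= 1/4, which together with the error 1/2
   on that set stays below the allowed 1. *)
pose e := (4 * (M ^+ 2 + 1))^-1.
have Mp : 0 < M ^+ 2 + 1 by rewrite ltr_wpDl// sqr_ge0.
have e0 : 0 < e by rewrite invr_gt0 mulr_gt0.
have eM : M ^+ 2 * e <= 4^-1.
  rewrite /e ler_pdivrMr ?mulr_gt0//.
  by rewrite mulrA mulVf ?mul1r// lerDl.
have [_ [ks0 [u0 d0 ->]] hks0] := sup_adherent e0 supX.
have lim0 : \sum_(k <- ks0) cabs2 (fk j k) * w k @[j --> \oo] -->
    \sum_(k <- ks0) cabs2 (f k) * w k.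
  apply: cvg_sum_seq => k; apply: cvgM; last exact: cvg_cst.
  by apply: ccvg_cabs2; exact: ff.
have : \sum_(k <- ks0) cabs2 (fk j k) * w k - \sum_(k <- ks0) cabs2 (f k) * w k @[j --> \oo] --> (0 : R).
  rewrite -[X in _ --> X](subrr (\sum_(k <- ks0) cabs2 (f k) * w k)).
  by apply: cvgB => //; exact: cvg_cst.
move=> /cvg0_small/(_ (_ : 0 < 2^-1)) [|N hN]; first by rewrite invr_gt0.
exists N => j /hN hj ks uks dks.
have Fw k : 0 <= cabs2 (fk j k) * w k by rewrite mulr_ge0 ?cabs2_ge0.
have s0 : \sum_(k <- ks0) cabs2 (f k) * w k <= C.
  apply: le_trans (wC _ u0 d0); apply: ler_sum => k _.
  by rewrite ler_piMl// -(expr1n _ 2) cabs2_le.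
rewrite (bigID (mem ks0)) /=.
have h1 : \sum_(k <- ks | k \in ks0) cabs2 (fk j k) * w k <= \sum_(k <- ks0) cabs2 (fk j k) * w k.
  rewrite -big_filter; apply: ler_sum_subseq => //; first exact: filter_uniq.
  by move=> k; rewrite mem_filter => /andP[].
have h2 : \sum_(k <- ks | k \notin ks0) cabs2 (fk j k) * w k <= M ^+ 2 * e.
  apply: le_trans (_ : M ^+ 2 * \sum_(k <- ks | k \notin ks0) w k <= _).
    rewrite mulr_sumr; apply: ler_sum => k _.
    by rewrite ler_wpM2r// cabs2_le.
  rewrite ler_wpM2l ?sqr_ge0//.
  have : \sum_(k <- ks0 ++ [seq k <- ks | k \notin ks0]) w k <= sup X.
    apply: sup_upper_bound => //; exists (ks0 ++ [seq k <- ks | k \notin ks0]); split => //.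
      rewrite cat_uniq u0 filter_uniq// andbT; apply/hasPn => k.
      by rewrite mem_filter => /andP[].
    by move=> k; rewrite mem_cat mem_filter => /orP[/d0|/andP[_ /dks]].
  by rewrite big_cat big_filter /=; lra.
by move: hj; rewrite ltr_norml; lra.
Qed.

Lemma rI_cabs_le F L : L2 F -> offQ L F ->
  rI leb (fun g => cabs (F g)) <= 2^-1 * (fine (leb (Q L)) + nrm2 F).
Proof.
move=> hF oF; rewrite -rI_Q -rID; [|exact: rintble_Q|exact: hF.2].
rewrite -rIZ; last by apply: rintbleD hF.2; exact: rintble_Q.
apply: rI_le; first by apply: cintble_cabs; exact: L2_cintble oF.
  by apply: rintbleZl; apply: rintbleD hF.2; exact: rintble_Q.
move=> g; rewrite cabs2E indicE.
have [gQ|gQ] := boolP (g \in Q L).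
  by rewrite ler_pdivlMl//=; have := sqr_ge0 (cabs (F g) - 1); rewrite sqrrB1; lra.
rewrite oF ?cabs0 ?expr0n ?addr0 ?mulr0//.
by move=> h; move/negP : gQ; apply; rewrite inE.
Qed.

(* If [u] is the normalised average of the characters in [Q L], then [f * u] is, up to
   a limit, the Fourier integral of an L2 density, whose norm is controlled through
   Parseval by the values of [f] on a lattice. *)
Lemma bernstein (L : R) : 0 < L -> 0 < fine (leb (Q L)) ->
  exists2 B : R, 0 < B & forall f, spec (nball L) f -> (forall x, cabs (f x) <= 1) ->
    forall x y, cabs (f x - f y) <= B * `|x - y|.
Proof.
move=> L0 v0.
have L1 : 0 < 2 * L by rewrite mulr_gt0.
set v := fine _ in v0.
(* Frequencies from [nball L] shift the cube [Q L] within [Q (2 * L)], so Parseval is applied on the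
   larger cube. *)
pose w := fine (leb (Q (2 * L))).
have QQ : Q L `<=` (Q (2 * L) : set T).
  by move=> g /QE hg; apply/QE => i; have := hg i; lra.
have w0 : 0 < w.
  apply: lt_le_trans v0 _; apply: fine_le; rewrite ?fin_numElt ?leb_Q_fin ?andbT.
  - by rewrite (lt_le_trans _ (leb_ge0 _)).
  - by rewrite (lt_le_trans _ (leb_ge0 _)).
  - exact: leb_mono.
pose U : T -> R[i] := fun g => ((v^-1)%:C)%C * cind (Q L) g.
have iQ : cintble leb (cind (Q L)) by apply: cintble_cind; [exact: measurable_Q|exact: leb_Q_fin].
have iU : cintble leb U by exact: cintbleZ.
have mQ : measurable (Q L : set T) := measurable_Q L.
have L2Q : L2 (cind (Q L : set T) : T -> R[i]).
  split; first exact: cmeasurable_cind.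
  rewrite (_ : (fun _ => _) = (\1_(Q L) : T -> R)); first exact: rintble_Q.
  apply/funext => g; rewrite cabs2E cabs_cind indicE.
  by case: (_ \in _); rewrite ?expr1n ?expr0n.
have L2U : L2 U by exact: L2Z.
have oU : offQ L U.
  by move=> g gQ; rewrite /U /cind indicE memNset// mulr0.
have absU : rI leb (fun g => cabs (U g)) = 1.
  rewrite (@eq_rI _ _ _ _ (fun g => v^-1 * \1_(Q L) g)).
    by rewrite rIZ ?rI_Q ?mulVf ?gt_eqF//; exact: rintble_Q.
  by move=> g; rewrite /U cabsM cabs_cind cabs_real ger0_norm// invr_ge0 ltW.
have u0 : ft U 0 = 1.
  rewrite /ft /U (_ : (fun _ => _) = fun g => ((v^-1)%:C)%C * cind (Q L) g); last first.
    by apply/funext => g; rewrite ez0l mulr1.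
  by rewrite cintegralZ// cintegral_cind// -rmorphM /= mulVf ?gt_eqF.
pose C0 := 2 * pi * n.+1%:R * L.
have u1 z : cabs (ft U z - 1) <= C0 * `|z|.
  rewrite -u0; apply: le_trans (ft_lip z 0 (ltW L0) iU oU) _.
  by rewrite absU mulr1 subr0.
pose C1 := 2 * pi * n.+1%:R * (2 * L) * (2^-1 * (w + (w / v + 1) / w)).
have C00 : 0 <= C0 by rewrite !mulr_ge0 ?pi_ge0 ?ltW.
have C10 : 0 <= C1.
  by rewrite !mulr_ge0 ?pi_ge0 ?addr_ge0 ?divr_ge0 ?addr_ge0 ?divr_ge0// ltW.
exists (C0 + C1 + 1); first by rewrite ltr_wpDl// addr_ge0.
move=> f [s [M [s1 s2 s3]]] f1 x t.
(* The modulation recentres the kernel at t: [ft F z] is u (z - t), which equals 1 at z = t. *)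
pose F := fun g => U g * ez (- t) (vec_of g).
have iF : cintble leb F by exact: cintble_ez.
have L2F : L2 F.
  apply: (@L2_le _ _ _ U 1) => // [|g]; last by rewrite cabs2M cabs2_ez mulr1 mul1r.
  by apply: cmeasurableM (cmeasurable_ez _); exact: L2U.1.
have ftF z : ft F z = ft U (z - t).
  by apply: eq_cintegral => g; rewrite /F -mulrA -ezDl (addrC (- t)).
have oF : offQ (2 * L) F.
  by move=> g gQ; rewrite /F oU ?mul0r// => /QQ.
have nF : nrm2 F <= v^-1.
  rewrite /nrm2 (@eq_rI _ _ _ _ (fun g => v^-1 ^+ 2 * \1_(Q L) g)).
    by rewrite rIZ ?rI_Q; [rewrite expr2 -mulrA mulVf ?gt_eqF// mulr1|exact: rintble_Q].
  move=> g; rewrite /F /U !cabs2M cabs2_ez mulr1 !cabs2E cabs_cind cabs_real real_normK ?num_real//.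
  by rewrite indicE; case: (_ \in _); rewrite ?expr1n ?expr0n.
have wsum ks : uniq ks -> (forall k, k \in ks -> lat (2 * L) k) ->
    \sum_(k <- ks) cabs2 (ft U (k - t)) <= w / v.
  move=> uks lks; under eq_bigr do rewrite -ftF.
  by apply: le_trans (bessel L1 w0 L2F oF uks lks) _; rewrite ler_pM2l.
have [N hN] := tannery (fun k => cabs2_ge0 (ft U (k - t))) wsum s2 f1 s3.
pose G j := fun g => \sum_(p <- s j) p.2 * F (shiftv (- p.1) g).
have ftG j z : ft (G j) z = tp (s j) z * ft U (z - t).
  rewrite /G ft_sum => [|p]; last exact: cintble_shift.
  rewrite /tp mulr_suml; apply: eq_bigr => p _.
  by rewrite ft_shift// ftF mulrA.
have L2G j : L2 (G j) by apply: L2_sum => p; apply: L2Z; exact: L2_shift.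
have oG j : offQ (2 * L) (G j).
  move=> g gQ; rewrite /G big_seq big1// => p ps; rewrite /F oU ?mul0r ?mulr0// => /QE hq.
  apply: gQ; apply/QE => i; have := hq i; have := nball_coord i (s1 j p ps).
  rewrite ler_norml /shiftv /vec_of !mxE => h1 h2; lra.
have step j : (N <= j)%N ->
    cabs (tp (s j) x * ft U (x - t) - tp (s j) t) <= C1 * `|x - t|.
  move=> Nj.
  have := @parseval _ _ _ L1 (G j) (w / v + 1) w0 (L2G j) (oG j).
  move=> /(_ _) hp; have {hp} nG : w * nrm2 (G j) <= w / v + 1.
    apply: hp => ks uks lks.
    under eq_bigr do rewrite ftG cabs2M.
    exact: hN.
  have := ft_lip x t (ltW L1) (L2_cintble (L2G j) (oG j)) (oG j).
  rewrite !ftG subrr u0 mulr1 => /le_trans; apply.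
  rewrite /C1 [leRHS]mulrAC ler_wpM2l ?mulr_ge0 ?pi_ge0 ?(ltW L0)//.
  apply: le_trans (rI_cabs_le (L2G j) (oG j)) _.
  by rewrite ler_wpM2l ?invr_ge0// lerD2l ler_pdivlMr// mulrC.
have lim : cabs (f x * ft U (x - t) - f t) <= C1 * `|x - t|.
  apply: (@ccvg_bound_near _ (fun j => tp (s j) x * ft U (x - t) - tp (s j) t) _ _ N step).
  have h := ccvgD (ccvgM (s3 x) (ccvg_cst (ft U (x - t)))) (ccvgM (ccvg_cst (-1)) (s3 t)).
  by move: h; rewrite mulN1r; under eq_fun do rewrite mulN1r.
(* Since u (0) = 1, the first difference is the increment of f u between t and x, controlled by
   [lim]; the second is the increment of u, weighted by a value of f. *)
rewrite (_ : f x - f t = (f x * ft U (x - t) - f t) - f x * (ft U (x - t) - 1)); last by ring.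
apply: le_trans (cabsD _ _) _; rewrite cabsN cabsM !mulrDl.
have h2 : cabs (f x) * cabs (ft U (x - t) - 1) <= C0 * `|x - t|.
  by rewrite -[leRHS]mul1r ler_pM ?cabs_ge0.
by have := normr_ge0 (x - t); rewrite mul1r; lra.
Qed.

End bernstein.

(** * A decaying kernel with compact spectrum *)

Section viete.
Context {R : realType}.
Implicit Types t : R.

(** Viete's product. Its limit is [sinc], and each factor is the mean of two characters, which
    exhibits [sinc] as a bounded limit of trigonometric polynomials. *)
Definition vprod k t : R := \prod_(j < k) cos (t / 2 ^+ j.+1).

Lemma vprodS k t : vprod k.+1 t = vprod k t * cos (t / 2 ^+ k.+1).
Proof. by rewrite /vprod big_ord_recr. Qed.

Lemma sin_vprod k t : sin t = 2 ^+ k * sin (t / 2 ^+ k) * vprod k t.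
Proof.
elim: k => [|k ih]; first by rewrite /vprod big_ord0 expr0 divr1 mul1r mulr1.
rewrite {1}ih vprodS; set u := t / 2 ^+ k.+1.
have -> : t / 2 ^+ k = u *+ 2.
  by rewrite /u exprS; field; rewrite expf_neq0.
by rewrite sin_mulr2n exprS; ring.
Qed.

Lemma vprod_le1 k t : `|vprod k t| <= 1.
Proof.
elim: k => [|k ih]; first by rewrite /vprod big_ord0 normr1.
by rewrite vprodS normrM mulr_ile1// cos_max.
Qed.

Lemma sin_sub_le t : `|sin t - t| <= `|t| ^+ 3.
Proof.
wlog t0 : t / 0 <= t.
  move=> h; have [/h//|t0] := leP 0 t.
  have := h (- t); rewrite sinN -opprD !normrN; apply.
  by rewrite oppr_ge0 ltW.
have [c cI] := @MVT_segment R sin cos 0 t t0 (fun x _ => is_derive_sin x)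
  (continuous_subspaceT (@continuous_sin R)).
rewrite sin0 !subr0 => ->.
rewrite -{2}(mul1r t) -mulrBl normrM exprSr ler_wpM2r//.
have h : c / 2 + c / 2 = c by field.
rewrite -h cosD -!expr2 cos2sin2.
rewrite (_ : _ - 1 = - (2 * sin (c / 2) ^+ 2)); last by ring.
rewrite normrN ger0_norm; last by rewrite mulr_ge0// sqr_ge0.
have /andP[c0 ct] : 0 <= c <= t by move: cI; rewrite in_itv.
have := sin_le_norm (c / 2); rewrite (ger0_norm t0) [leRHS]ger0_norm ?divr_ge0// => hs.
have : `|sin (c / 2)| ^+ 2 <= (c / 2) ^+ 2 by rewrite ler_pXn2r// nnegrE divr_ge0.
rewrite real_normK ?num_real// => h2.
have : c ^+ 2 <= t ^+ 2 by rewrite ler_pXn2r// nnegrE.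
by have := sqr_ge0 c; nra.
Qed.

Definition sinc t : R := if t == 0 then 1 else sin t / t.

Lemma sinc_sin t : sinc t * t = sin t.
Proof.
by rewrite /sinc; case: eqP => [->|/eqP t0]; rewrite ?mulr0 ?sin0// divfK.
Qed.

Lemma sinc_le1 t : `|sinc t| <= 1.
Proof.
rewrite /sinc; case: eqP => [_|/eqP t0]; first by rewrite normr1.
by rewrite normrM normfV ler_pdivrMr ?normr_gt0// mul1r sin_le_norm.
Qed.

Lemma sinc_decay t : `|sinc t| * `|t| <= 1.
Proof. by rewrite -normrM sinc_sin sin_max. Qed.

Lemma cvg_vprod t : vprod k t @[k --> \oo] --> sinc t.
Proof.
have [->|t0] := eqVneq t 0.
  apply: cvg_near_cst; apply: nearW => k; rewrite /sinc eqxx /vprod big1// => j _.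
  by rewrite mul0r cos0.
(* After multiplication by t, [sin_vprod] leaves the factor 2^k sin (t / 2^k) - t, which is at most
   |t|^3 / 4^k. *)
have hk k : `|sinc t - vprod k t| <= `|t| ^+ 2 * 2^-1 ^+ k.
  rewrite -(@ler_pM2r _ `|t|) ?normr_gt0// -normrM mulrBl sinc_sin (sin_vprod k).
  rewrite [X in `|X|](_ : _ = (2 ^+ k * sin (t / 2 ^+ k) - t) * vprod k t); last by ring.
  rewrite normrM.
  have e0 : 0 < 2 ^+ k :> R by rewrite exprn_gt0.
  rewrite (_ : _ - t = 2 ^+ k * (sin (t / 2 ^+ k) - t / 2 ^+ k)); last first.
    by field; rewrite gt_eqF.
  apply: le_trans (_ : 2 ^+ k * `|t / 2 ^+ k| ^+ 3 * 1 <= _).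
    by rewrite ler_pM ?vprod_le1// normrM (ger0_norm (ltW e0)) ler_pM2l// sin_sub_le.
  have hT : `|t / 2 ^+ k| = `|t| / 2 ^+ k by rewrite normrM normfV (gtr0_norm e0).
  rewrite mulr1 hT exprVn.
  have -> : 2 ^+ k * (`|t| / 2 ^+ k) ^+ 3 = `|t| ^+ 3 / 2 ^+ k / 2 ^+ k.
    by field; rewrite gt_eqF.
  have -> : `|t| ^+ 2 / 2 ^+ k * `|t| = `|t| ^+ 3 / 2 ^+ k by ring.
  rewrite ler_piMr ?divr_ge0 ?exprn_ge0 ?(ltW e0)//.
  by rewrite invf_le1// exprn_ege1// ler1n.
apply/cvgrPdist_le => e e1.
have z1 : `|2^-1 : R| < 1 by rewrite ger0_norm ?invr_ge0//; lra.
have t2 : 0 < `|t| ^+ 2 by rewrite exprn_gt0// normr_gt0.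
have /cvg0_small/(_ (_ : 0 < e / `|t| ^+ 2)) [|N hN] := cvg_expr z1.
  by rewrite divr_gt0.
exists N => // k /= /hN hk'; apply: le_trans (hk k) _.
rewrite mulrC -ler_pdivlMr//; apply: le_trans (ltW hk'); exact: ler_norm.
Qed.

End viete.

Section decay.
Context {R : realType} {n : nat}.
Local Notation V := 'rV[R]_n.+1.
Implicit Types (x y : V) (rho : R).

(** The cosine with index j adds the frequencies rho 2^-j and - rho 2^-j along the axis i; the
    radius is the sum of rho 2^-j for j from 1 to k. *)
Lemma vprod_tp (i : 'I_n.+1) rho k : 0 < rho ->
  exists2 s, freqs (nball (rho * (1 - 2^-1 ^+ k))) s &
    forall x : V, tp s x = ((vprod k (2 * pi * rho * x ord0 i))%:C)%C.
Proof.
move=> r0; elim: k => [|k [s hs sE]].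
  exists [:: (0, 1)] => [p|x]; last by rewrite /tp big_seq1 ez0r mulr1 /vprod big_ord0.
  by rewrite inE => /eqP ->; rewrite /nball /= normr0 expr0 subrr mulr0.
pose e : V := (rho * 2^-1 ^+ k.+1) *: delta_mx ord0 i.
have e0 : 0 < 2^-1 ^+ k.+1 :> R by rewrite exprn_gt0.
have en : `|e| <= rho * 2^-1 ^+ k.+1.
  apply: norm_le_coord => j; rewrite !mxE eqxx /=.
  have h : 0 <= rho * 2^-1 ^+ k.+1 by rewrite mulr_ge0 ?ltW.
  by case: (j == i); rewrite ?mulr1 ?mulr0 ?normr0// ger0_norm.
pose c : R[i] := ((2^-1)%:C)%C.
exists (tp_mul s [:: (e, c); (- e, c)]).
  have hp (p : V * R[i]) (e' : V) : p \in s -> `|e'| <= rho * 2^-1 ^+ k.+1 ->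
      nball (rho * (1 - 2^-1 ^+ k.+1)) (p.1 + e').
    move=> /hs; rewrite /nball /= => h1 h2; apply: le_trans (ler_normD _ _) _.
    apply: le_trans (lerD h1 h2) _; rewrite -mulrDr ler_pM2l// exprS.
    by set z := 2^-1 ^+ k; lra.
  move=> _ /allpairsP[[p q] [/= ps + ->]]; rewrite !inE => /orP[] /eqP -> /=; apply: hp => //.
  by rewrite normrN.
move=> x; rewrite tp_mulE sE vprodS rmorphM /=; congr (_ * _).
rewrite /tp big_cons big_seq1 /= ezNr -mulrDr.
have -> : ez x e = expi (2 * pi * rho * x ord0 i / 2 ^+ k.+1).
  rewrite /ez dotvZr /dotv (bigD1 i) //= big1 => [|j ji]; rewrite !mxE ?eqxx ?mulr1 ?addr0.
    by congr expi; rewrite exprVn; ring.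
  by rewrite (negPf ji) mulr0.
by apply: complex_ext; rewrite ?ReM ?ImM ?ReD ?ImD ?ReJ ?ImJ /=; field.
Qed.

(** The Fourier transform of the normalised indicator of the cube of half-side rho. *)
Definition hV rho x : R[i] := ((\prod_(i < n.+1) sinc (2 * pi * rho * x ord0 i))%:C)%C.

Lemma spec_sinc (i : 'I_n.+1) rho : 0 < rho ->
  spec (nball rho) (fun x : V => ((sinc (2 * pi * rho * x ord0 i))%:C)%C).
Proof.
move=> r0; have [s hs] := choice (fun k => let: ex_intro2 s h1 h2 := vprod_tp i k r0 in
  ex_intro (fun s => freqs (nball (rho * (1 - 2^-1 ^+ k))) s /\
    forall x : V, tp s x = ((vprod k (2 * pi * rho * x ord0 i))%:C)%C) s (conj h1 h2)).
exists s, 1; split.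
- move=> k p /((hs k).1) /le_trans; apply.
  have : 0 <= 2^-1 ^+ k :> R by rewrite exprn_ge0// invr_ge0.
  by set z := 2^-1 ^+ k => z0; nra.
- by move=> k x; rewrite (hs k).2 cabs_real vprod_le1.
move=> x; rewrite /ccvg; under eq_fun do rewrite (hs _).2 -rmorphB cabs_real.
have h : vprod k (2 * pi * rho * x ord0 i) - sinc (2 * pi * rho * x ord0 i) @[k --> \oo] --> (0 : R).
  rewrite -[X in _ --> X](subrr (sinc (2 * pi * rho * x ord0 i))).
  by apply: cvgB; [exact: cvg_vprod|exact: cvg_cst].
by rewrite -(@normr0 _ R); exact: cvg_norm.
Qed.

(** The factor n.+1 is the triangle inequality over the coordinates; applications divide rho by n.+1
    beforehand. *)
Lemma spec_hV rho : 0 < rho -> spec (nball (n.+1%:R * rho)) (hV rho).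
Proof.
move=> r0.
suff h (r : seq 'I_n.+1) : spec (nball ((size r)%:R * rho))
    (fun x : V => ((\prod_(i <- r) sinc (2 * pi * rho * x ord0 i))%:C)%C).
  have := h (enum 'I_n.+1); rewrite size_enum_ord; congr spec.
  by apply/funext => x; rewrite /hV big_enum.
elim: r => [|i r ih].
  rewrite (_ : (fun _ => _) = tp [:: (0, 1)]).
    by apply: spec_tp => p; rewrite inE => /eqP ->; rewrite /nball /= mul0r normr0.
  by apply/funext => x; rewrite /tp big_nil big_seq1 ez0r mulr1.
have := @specM _ _ (nball rho) (nball ((size r)%:R * rho)) (nball ((size (i :: r))%:R * rho)) _ _ _ (spec_sinc i r0) ih.
rewrite (_ : (fun x : V => _ * _) = (fun x : V => ((\prod_(j <- i :: r) sinc (2 * pi * rho * x ord0 j))%:C)%C)).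
  apply=> a b; rewrite /nball /= => ha hb; apply: le_trans (ler_normD _ _) _.
  by apply: le_trans (lerD ha hb) _; rewrite -[X in X + _]mul1r -mulrDl nat1r.
by apply/funext => x; rewrite big_cons rmorphM.
Qed.

Lemma hV0 rho : hV rho 0 = 1.
Proof. by rewrite /hV big1// => i _; rewrite mxE mulr0 /sinc eqxx. Qed.

Lemma cabs2_hV rho x : cabs2 (hV rho x) = \prod_(i < n.+1) sinc (2 * pi * rho * x ord0 i) ^+ 2.
Proof. by rewrite cabs2E cabs_real real_normK ?num_real// prodrXl. Qed.

Lemma cabs_hV_le1 rho x : cabs (hV rho x) <= 1.
Proof.
rewrite cabs_real normr_prod; apply: prodr_ile1 => i.
by rewrite normr_ge0 sinc_le1.
Qed.

Lemma cabs_hV_coord rho x i : cabs (hV rho x) <= `|sinc (2 * pi * rho * x ord0 i)|.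
Proof.
rewrite cabs_real normr_prod (bigD1 i)//= ler_piMr//.
by apply: prodr_ile1 => j; rewrite normr_ge0 sinc_le1.
Qed.

(** The factor at the largest coordinate of x provides the decay, the others being at most 1 in
    modulus. *)
Lemma hV_decay rho x : 0 < rho -> cabs (hV rho x) * (2 * pi * rho * `|x|) <= 1.
Proof.
move=> r0; have p0 : 0 < 2 * pi * rho by rewrite !mulr_gt0 ?pi_gt0.
set p := 2 * pi * rho in p0 *; set c := cabs _.
have hi i : c * (p * `|x ord0 i|) <= 1.
  apply: le_trans (sinc_decay (2 * pi * rho * x ord0 i)).
  rewrite -/p (normrM p) (ger0_norm (ltW p0)) ler_wpM2r ?(mulr_ge0 (ltW p0))//.
  exact: cabs_hV_coord.
have [->|c0] := eqVneq c 0; first by rewrite mul0r.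
have cp : 0 < c * p by rewrite mulr_gt0// lt_neqAle eq_sym c0 cabs_ge0.
rewrite mulrA -ler_pdivlMl// mulr1; apply: norm_le_coord => i.
by rewrite -[leRHS]mulr1 ler_pdivlMl// -mulrA.
Qed.

(* Telescoping with the bounded increasing function 4 m / (1 + |m|). *)
Lemma sum_inv_sqr (N : nat) :
  \sum_(j < N.*2.+1) (1 + (j%:R - N%:R : R) ^+ 2)^-1 <= 8.
Proof.
pose g (j : nat) : R := 4 * ((j%:R - N%:R) / (1 + `|j%:R - N%:R|)).
have gb j : `|g j| <= 4.
  rewrite normrM ger0_norm// ler_piMr// normrM normfV.
  have h : 0 < 1 + `|j%:R - N%:R| :> R by rewrite ltr_wpDr.
  by rewrite (ger0_norm (ltW h)) ler_pdivrMr// mul1r lerDr.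
have step (j : nat) : (1 + (j%:R - N%:R : R) ^+ 2)^-1 <= g j.+1 - g j.
  have e1 : j.+1%:R - N%:R = j%:R - N%:R + 1 :> R by rewrite -(natr1 j); ring.
  rewrite /g -mulrBr e1.
  have [Nj|jN] := leqP N j.
    rewrite -natrB//; set m : R := (j - N)%:R.
    have m0 : 0 <= m by [].
    rewrite !ger0_norm ?addr_ge0//.
    rewrite (_ : 4 * _ = 4 / ((1 + (m + 1)) * (1 + m))); last by field; apply/andP; split; lra.
    rewrite ler_pdivlMr; last by rewrite mulr_gt0; lra.
    by rewrite mulrC ler_pdivrMr; have := sqr_ge0 m; nra.
  have -> : j%:R - N%:R = - ((N - j.+1)%:R + 1) :> R.
    by rewrite natrB// -(natr1 j); ring.
  set p : R := (N - j.+1)%:R.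
  have p0 : 0 <= p by [].
  have -> : - (p + 1) + 1 = - p by ring.
  rewrite !normrN !ger0_norm ?addr_ge0// sqrrN.
  rewrite (_ : 4 * _ = 4 / ((1 + p) * (1 + (p + 1)))); last by field; apply/andP; split; lra.
  rewrite ler_pdivlMr; last by rewrite mulr_gt0; lra.
  by rewrite mulrC ler_pdivrMr; have := sqr_ge0 (p + 1); nra.
rewrite -(big_mkord xpredT (fun j => (1 + (j%:R - N%:R : R) ^+ 2)^-1)).
apply: le_trans (ler_sum _ (fun j _ => step j)) _.
rewrite telescope_sumr//.
have := gb N.*2.+1; have := gb 0%N; rewrite !ler_norml; lra.
Qed.

(** With S = sinc (a t)^2 and k the integer part of t: S <= 1, S t^2 <= 1 / a^2 and k^2 <= 2 t^2 +
    2, so S (1 + k^2) <= 3 + 2 / a^2. *)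
Lemma sinc_sqr_le (a t : R) : 0 < a ->
  sinc (a * t) ^+ 2 <= (3 + 2 / a ^+ 2) * (1 + ((Num.floor t)%:~R : R) ^+ 2)^-1.
Proof.
move=> a0; set k : R := (Num.floor t)%:~R.
have /andP[k1 k2] : k <= t < k + 1 by have := floor_itv t; rewrite intrD.
have kp : 0 < 1 + k ^+ 2 by rewrite ltr_wpDr// sqr_ge0.
rewrite ler_pdivlMr//.
have s1 : sinc (a * t) ^+ 2 <= 1.
  by rewrite -[leRHS](expr1n _ 2) -(real_normK (num_real (sinc _))) ler_pXn2r ?nnegrE// sinc_le1.
have s2 : sinc (a * t) ^+ 2 * t ^+ 2 <= (a ^+ 2)^-1.
  have a2 : 0 < a ^+ 2 by rewrite exprn_gt0.
  rewrite -(ler_pM2r a2) mulVf ?gt_eqF// -!exprMn -mulrA (mulrC t) sinc_sin.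
  by rewrite -[leRHS](expr1n _ 2) -(real_normK (num_real (sin _))) ler_pXn2r ?nnegrE// sin_max.
have k3 : k ^+ 2 <= 2 * t ^+ 2 + 2.
  have : (t - k) ^+ 2 <= 1 by nra.
  by have := sqr_ge0 (2 * t - k); nra.
have := sqr_ge0 (sinc (a * t)); set S := sinc _ ^+ 2 in s1 s2 * => S0.
apply: le_trans (_ : S * (3 + 2 * t ^+ 2) <= _); first by rewrite ler_wpM2l//; lra.
by rewrite mulrDr; lra.
Qed.

(* Points of a [delta]-separated set lie in distinct cells of a grid of mesh [delta / 2]. *)
Lemma separated_sum rho delta : 0 < rho -> 0 < delta ->
  exists2 C : R, 0 < C & forall (y : V) (xs : seq V), uniq xs ->
    (forall x x', x \in xs -> x' \in xs -> x != x' -> delta <= `|x - x'|) ->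
    \sum_(x <- xs) cabs2 (hV rho (x - y)) <= C.
Proof.
move=> r0 d0; pose h := delta / 2; pose a := 2 * pi * rho * h.
have h0 : 0 < h by rewrite divr_gt0.
have a0 : 0 < a by rewrite !mulr_gt0 ?pi_gt0.
pose C0 := 3 + 2 / a ^+ 2.
have C00 : 0 < C0 by rewrite addr_gt0// divr_gt0// exprn_gt0.
exists ((C0 * 8) ^+ n.+1); first by rewrite exprn_gt0// mulr_gt0.
move=> y xs uxs sep.
pose k (x : V) (i : 'I_n.+1) : int := Num.floor ((x - y) ord0 i / h).
pose N := \max_(x <- xs) \max_(i < n.+1) `|k x i|%N.
have kN x i : x \in xs -> (`|k x i| <= N)%N.
  move=> xxs; apply: leq_trans (leq_bigmax_seq _ xxs isT).
  exact: (@leq_bigmax_cond _ _ (fun i => `|k x i|%N)).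
(* Cell indices are shifted by N to fit into a finite type: the sum over all cells of a product over
   coordinates then factorises into one-dimensional sums. *)
pose phi x : {ffun 'I_n.+1 -> 'I_N.*2.+1} := [ffun i => inord `|(k x i + N%:Z)%R|%N].
have phiE x i : x \in xs -> (phi x i)%:R - N%:R = (k x i)%:~R :> R.
  move=> /(kN _ i) hk; rewrite ffunE inordK; last by lia.
  by rewrite natr_absz ger0_norm ?intrD ?addrK//; lia.
pose G (f : {ffun 'I_n.+1 -> 'I_N.*2.+1}) : R :=
  \prod_i (C0 * (1 + ((f i)%:R - N%:R : R) ^+ 2)^-1).
have G0 f : 0 <= G f.
  by apply: prodr_ge0 => i _; rewrite mulr_ge0 ?(ltW C00)// invr_ge0 addr_ge0// sqr_ge0.
have phi_inj : {in xs &, injective phi}.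
  move=> x x' xxs xxs' e; apply/eqP; case: (boolP (x == x')) => // xx'.
  suff : `|x - x'| <= h.
    by have := sep _ _ xxs xxs' xx'; rewrite /h; lra.
  apply: norm_le_coord => j.
  have : (k x j)%:~R = (k x' j)%:~R :> R by rewrite -!phiE// e.
  have := floor_itv ((x - y) ord0 j / h); have := floor_itv ((x' - y) ord0 j / h).
  rewrite -/(k x j) -/(k x' j) !intrD !mxE => /andP[b1 b2] /andP[c1 c2] ek.
  rewrite ek in c1 c2; have hi : 0 < h^-1 by rewrite invr_gt0.
  rewrite -(@ler_pM2r _ h^-1)// divff ?gt_eqF// -[X in _ * X](gtr0_norm hi) -normrM ler_norml.
  have -> : (x ord0 j - x' ord0 j) / h = (x ord0 j - y ord0 j) / h - (x' ord0 j - y ord0 j) / h.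
    by rewrite -mulrBl; congr (_ / _); ring.
  by apply/andP; split; lra.
apply: (@le_trans _ _ (\sum_(x <- xs) G (phi x))).
  rewrite [leLHS]big_seq [leRHS]big_seq; apply: ler_sum => x xxs.
  rewrite cabs2_hV; apply: ler_prod => i _; rewrite sqr_ge0 /=.
  rewrite phiE// /k (_ : 2 * pi * rho * (x - y) ord0 i = a * ((x - y) ord0 i / h)).
    exact: sinc_sqr_le.
  by rewrite /a; field; rewrite gt_eqF.
rewrite -(big_map phi xpredT G).
apply: (@le_trans _ _ (\sum_f G f)).
  by apply: ler_sum_subseq => //; [rewrite map_inj_in_uniq|exact: index_enum_uniq|move=> f _; exact: mem_index_enum].
rewrite /G -(bigA_distr_bigA (fun (i : 'I_n.+1) (j : 'I_N.*2.+1) => C0 * (1 + (j%:R - N%:R : R) ^+ 2)^-1)).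
rewrite prodr_const card_ord -mulr_sumr.
have S0 : 0 <= \sum_(j < N.*2.+1) (1 + (j%:R - N%:R : R) ^+ 2)^-1.
  by apply: sumr_ge0 => j _; rewrite invr_ge0 addr_ge0// sqr_ge0.
have C0S : C0 * \sum_(j < N.*2.+1) (1 + (j%:R - N%:R : R) ^+ 2)^-1 <= C0 * 8.
  by rewrite ler_pM2l// sum_inv_sqr.
by apply: lerXn2r => //; rewrite nnegrE mulr_ge0// ltW.
Qed.

End decay.

(** * From balayage to sampling *)

Section finite_meas.
Context {R : realType} {n : nat}.
Local Notation T := (@Rd R n.+1).
Variable (m : {measure set T -> \bar R}).
Hypothesis mfin : fin_num_fun m.

(** The vacuous [let] makes [finm] depend on [mfin], so that the finiteness instance can be attached
    to it. *)
Definition finm : set T -> \bar R := let _ := mfin in m.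
HB.instance Definition _ := Measure.on finm.
HB.instance Definition _ := @Measure_isFinite.Build _ T R finm mfin.
Definition finmeas : {finite_measure set T -> \bar R} := finm.

End finite_meas.

Section balayage_norming.
Context {R : realType} {n : nat}.
Local Notation T := (@Rd R n.+1).
Local Notation V := 'rV[R]_n.+1.
Local Notation Re := complex.Re.
Local Notation Im := complex.Im.
Implicit Types (m : {finite_measure set T -> \bar R}) (mu nu : @cmeasure R n.+1).

Lemma mzero_fin : fin_num_fun (@mzero _ T R).
Proof. by move=> U mU; rewrite /mzero. Qed.

Definition posm (m : {measure set T -> \bar R}) (h : fin_num_fun m) : cmeasure :=
  CMeasure (finmeas h) (finmeas mzero_fin) (finmeas mzero_fin) (finmeas mzero_fin).

Lemma cmint_posm (m : {measure set T -> \bar R}) (h : fin_num_fun m) f :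
  cmint (posm h) f = cintegral m setT f.
Proof.
rewrite /cmint /= (_ : cintegral mzero setT f = 0) ?subr0 ?mulr0 ?addr0//.
by rewrite /cintegral !integral_measure_zero.
Qed.

Lemma fin_rintble_cst m (c : R) : rintble m (fun=> c).
Proof. exact: finite_measure_integrable_cst. Qed.

Lemma fin_cintble m f (M : R) : cmeasurable f -> (forall x, cabs (f x) <= M) -> cintble m f.
Proof. by move=> mf fM; apply: cintble_le (fin_rintble_cst m M). Qed.

(** The four parts may overlap, so this is an upper bound for the total variation rather than its
    value. *)
Definition cmnorm mu : R := fine (cm1 mu setT) + fine (cm2 mu setT)
  + (fine (cm3 mu setT) + fine (cm4 mu setT)).

Lemma cmnorm_ge0 mu : 0 <= cmnorm mu.
Proof. by rewrite !addr_ge0// fine_ge0. Qed.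

Lemma cabs_cintegral_le m f (c : R) : cmeasurable f -> (forall x, cabs (f x) <= c) ->
  cabs (cintegral m setT f) <= c * fine (m setT).
Proof.
move=> mf fc; have fi := fin_cintble m mf fc.
apply: le_trans (cabs_cintegral fi) _.
have e : (\int[m]_x (cst c%:E x) = (c * fine (m setT))%:E)%E.
  by rewrite integral_cst// EFinM fineK// fin_num_measure.
rewrite -[leRHS](congr1 fine e); apply: fine_le.
- by apply: integrable_fin_num => //; exact: cintble_cabs fi.
- by rewrite e.
apply: ge0_le_integral => //.
- by move=> x _; rewrite lee_fin cabs_ge0.
- by apply/measurable_EFinP; exact: measurable_cabs.
- by move=> x _; rewrite lee_fin fc.
Qed.

Lemma cmintD mu f g (M N : R) : cmeasurable f -> (forall x, cabs (f x) <= M) ->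
  cmeasurable g -> (forall x, cabs (g x) <= N) ->
  cmint mu (fun x => f x + g x) = cmint mu f + cmint mu g.
Proof.
move=> mf fM mg gN; rewrite /cmint !cintegralD; try by apply: fin_cintble; eauto.
by ring.
Qed.

Lemma cmint_tp mu (s : seq (V * R[i])) :
  cmint mu (fun x : T => tp s (vec_of x)) = \sum_(p <- s) p.2 * cm_hat mu (- p.1).
Proof.
have h m : cintegral m setT (fun x : T => tp s (vec_of x)) =
    \sum_(p <- s) p.2 * cintegral m setT (fun x => ez (vec_of x) p.1).
  have ci (p : V * R[i]) : cintble m (fun x : T => ez (vec_of x) p.1).
    apply: (@fin_cintble _ _ 1); last by move=> x; rewrite cabs_ez.
    by under eq_fun do rewrite ezC; exact: cmeasurable_ez.
  rewrite /tp cintegral_sum; last by move=> p; exact: cintbleZ.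
  by apply: eq_bigr => p _; rewrite cintegralZ.
rewrite /cmint !h -!sumrB mulr_sumr -big_split; apply: eq_bigr => p _ /=.
have e m : cintegral m setT (fun x : T => expi (- (2 * pi) * dotv (vec_of x) (- p.1)))
    = cintegral m setT (fun x : T => ez (vec_of x) p.1).
  by apply: eq_cintegral => x; rewrite dotvNr mulrNN.
by rewrite /cm_hat /cmint !e; ring.
Qed.

Lemma spec_measurable (A : set V) f : spec A f -> cmeasurable (fun x : T => f (vec_of x)).
Proof.
move=> [s [M [_ _ sf]]].
have hcv (x : V) (P : R[i] -> R) : (forall z w, `|P z - P w| <= cabs (z - w)) ->
    P (tp (s k) x) @[k --> \oo] --> P (f x).
  move=> Pl; apply/cvgrPdist_lt => e e0; near=> k.
  rewrite distrC (le_lt_trans (Pl _ _))//; near: k.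
  have /cvgrPdist_lt /(_ e e0) := sf x.
  by apply: filterS => k; rewrite sub0r normrN; apply: le_lt_trans; exact: ler_norm.
split; [pose P := @complex.Re R|pose P := @complex.Im R];
  apply: (@measurable_fun_cvg _ _ _ _ (fun k (x : T) => P (tp (s k) (vec_of x)))).
- by move=> k; have [] := cmeasurable_tp (s k).
- by move=> x _; apply: hcv => z w; rewrite -ReB Re_le_cabs.
- by move=> k; have [] := cmeasurable_tp (s k).
- by move=> x _; apply: hcv => z w; rewrite -ImB Im_le_cabs.
Unshelve. all: by end_near. Qed.

(** By [cmint_tp], integrating a trigonometric polynomial evaluates [cm_hat] at the negated
    frequencies, whence the symmetry of A; bounded limits follow by dominated convergence. *)
Lemma spec_cmint (A : set V) f mu nu : spec A f -> (forall g, A g -> A (- g)) ->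
  (forall g, A g -> cm_hat mu g = cm_hat nu g) ->
  cmint mu (fun x : T => f (vec_of x)) = cmint nu (fun x : T => f (vec_of x)).
Proof.
move=> sf symA mn; have mf := spec_measurable sf.
case: sf => s [M [sA sM sf]].
have fM x : cabs (f x) <= M by apply: ccvg_bound (sf x) => k; exact: sM.
have h m : ccvg (fun k => cintegral m setT (fun x : T => tp (s k) (vec_of x)))
    (cintegral m setT (fun x : T => f (vec_of x))).
  apply: (@ccvg_dominated _ _ _ _ _ (fun=> M)) => //.
  - by move=> k; exact: cmeasurable_tp.
  - exact: fin_rintble_cst.
have hc la : ccvg (fun k => cmint la (fun x : T => tp (s k) (vec_of x)))
    (cmint la (fun x : T => f (vec_of x))).
  rewrite /cmint; apply: ccvgD; first by apply: ccvgB.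
  by apply: ccvgM; [exact: ccvg_cst|apply: ccvgB].
apply: ccvg_unique (hc mu) _.
rewrite (_ : (fun k => _) = (fun k => cmint nu (fun x : T => tp (s k) (vec_of x)))); first exact: hc.
apply/funext => k; rewrite !cmint_tp; apply: eq_big_seq => p ps.
by rewrite mn//; apply: symA; exact: sA ps.
Qed.

Lemma cmint_supported (E : set V) nu f (M c : R) : measurable (E : set T) -> Mb E nu ->
  cmeasurable f -> (forall x, cabs (f x) <= M) -> 0 <= c ->
  (forall x, E (vec_of x) -> cabs (f x) <= c) -> cabs (cmint nu f) <= c * cmnorm nu.
Proof.
move=> mE nuE mf fM c0 fc; pose E' : set T := E.
have mE' : measurable (~` E') by exact: measurableC.
have bi (A : set T) (x : T) : cabs (f x * cind A x) <= M.
  rewrite cabsM cabs_cind indicE; case: (x \in A); rewrite ?mulr1 ?mulr0//.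
  by apply: le_trans (fM x); exact: cabs_ge0.
have mi (A : set T) : measurable A -> cmeasurable (fun x => f x * cind A x).
  by move=> mA; apply: cmeasurableM => //; exact: cmeasurable_cind.
(* The four parts of nu need not be carried by E: only their differences vanish off E. There [cm1]
   agrees with [cm2] and [cm3] with [cm4], so their integrals cancel. *)
have off m m' : (forall A, measurable A -> A `<=` ~` E' -> m A = m' A) ->
    cintegral m setT (fun x => f x * cind (~` E') x) =
    cintegral m' setT (fun x => f x * cind (~` E') x).
  move=> mm'; have aux m0 (P : R[i] -> R) : P 0 = 0 ->
      (\int[m0]_x (P (f x * cind (~` E') x)%R)%:E = \int[m0]_(x in ~` E') (P (f x))%:E)%E.
    move=> P0; rewrite [RHS]integral_mkcond; apply: eq_integral => x _.
    by rewrite /patch /cind indicE; case: ifP => _; rewrite ?mulr1 ?mulr0 ?P0.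
  by rewrite /cintegral !aux// !(eq_measure_integral m' mm').
have z0 : cmint nu (fun x => f x * cind (~` E') x) = 0.
  have fn (m : {finite_measure set T -> \bar R}) A : measurable A -> m A \is a fin_num by exact: fin_num_measure.
  rewrite /cmint (off (cm1 nu) (cm2 nu)) ?(off (cm3 nu) (cm4 nu)) ?subrr ?mulr0 ?addr0//.
    move=> A mA AE; have := nuE A mA AE => /(congr1 (@complex.Im R)) /= /eqP.
    by rewrite subr_eq0 => /eqP e; rewrite -[LHS]fineK ?fn// e fineK// fn.
  move=> A mA AE; have := nuE A mA AE => /(congr1 (@complex.Re R)) /= /eqP.
  by rewrite subr_eq0 => /eqP e; rewrite -[LHS]fineK ?fn// e fineK// fn.
have -> : cmint nu f = cmint nu (fun x => f x * cind E' x).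
  have e : f = (fun x => f x * cind E' x + f x * cind (~` E') x).
    apply/funext => x; rewrite -mulrDr /cind !indicE in_setC.
    by case: (x \in E'); rewrite /= ?addr0 ?add0r mulr1.
  rewrite {1}e (cmintD _ (mi _ _) (bi _) (mi _ _) (bi _))// z0 addr0.
  by [].
have hE (x : T) : cabs (f x * cind E' x) <= c.
  rewrite cabsM cabs_cind indicE; case: (boolP (x \in E')) => [|_]; rewrite ?mulr1 ?mulr0//.
  by rewrite inE => /fc.
have hm m := cabs_cintegral_le m (mi _ mE) hE.
apply: le_trans (cabsD _ _) _; rewrite cabsM (_ : cabs 'i%C = 1); last first.
  by rewrite /cabs /cabs2 /= expr0n expr1n add0r sqrtr1.
rewrite mul1r /cmnorm 3!mulrDr.
by apply: lerD; (apply: le_trans (cabsB _ _) _); exact: lerD.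
Qed.

(** Balayage of the unit mass at t. The constant N depends on t; [balayage_samp] removes this
    dependence. *)
Lemma balayage_pointwise (E A : set V) (t : V) : measurable (E : set T) ->
  (forall g, A g -> A (- g)) -> balayage E A ->
  exists2 N : R, 0 <= N & forall f (c : R), spec A f -> 0 <= c ->
    (forall x, E x -> cabs (f x) <= c) -> cabs (f t) <= c * N.
Proof.
move=> mE symA bal.
have dfin : fin_num_fun (@dirac _ T (t : T) R).
  by move=> U mU; rewrite /dirac.
have [nu [nuE h]] := bal (posm dfin).
exists (cmnorm nu) => [|f c sf c0 fc]; first exact: cmnorm_ge0.
have [M fM] := spec_bounded sf.
have mf := spec_measurable sf.
have := cmint_supported mE nuE mf (fun x => fM _) c0 (fun x Ex => fc _ Ex).
rewrite -(spec_cmint sf symA h) cmint_posm.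
suff -> : cintegral (@dirac _ T (t : T) R) setT (fun x : T => f (vec_of x)) = f t by [].
case: mf => m1 m2; rewrite /cintegral !integral_dirac ?diracT ?mul1e //=; last 2 first.
- exact/measurable_EFinP.
- exact/measurable_EFinP.
by case: (f t).
Qed.

Lemma separated_closed (E : set V) : is_separated E -> closed E.
Proof.
move=> [e [e0 sep]] x clx; apply: contrapT => nEx.
have ball_in (r : R) : 0 < r -> exists2 y, E y & `|x - y| < r.
  move=> r0; have [y [Ey]] := clx _ (nbhsx_ballx x r r0).
  by rewrite -ball_normE => yr; exists y.
have e20 : 0 < e / 2 by rewrite divr_gt0.
have [y Ey xy] := ball_in _ e20.
have xy0 : 0 < `|x - y|.
  by rewrite normr_gt0 subr_eq0; apply/eqP => xy'; apply: nEx; rewrite xy'.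
have [z Ez xz] := ball_in _ xy0.
have [yz|yz] := eqVneq y z; first by move: xz; rewrite yz ltxx.
have := sep y z Ey Ez yz; apply/negP; rewrite -ltNge.
rewrite (_ : y - z = (x - z) - (x - y)); last by rewrite opprB [RHS]addrC addrA subrK.
by apply: le_lt_trans (ler_normB _ _) _; lra.
Qed.

Lemma measurable_point (x : V) : measurable [set (x : T)].
Proof.
apply: (@measurable_closed _ _ [set x]); apply: separated_closed.
by exists 1; split => // _ _ -> -> /eqP.
Qed.

(** A threshold form of the inequality bounding sup |g| by a constant times the supremum of |g| over
    S; rescaling g, as in [samp_bound], recovers the latter. *)
Definition samp (A S : set V) (eta : R) := forall g, spec A g ->
  (forall x, cabs (g x) <= 1) -> (forall x, S x -> cabs (g x) <= eta) ->
  forall x, cabs (g x) <= 2^-1.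

(** The points may repeat, so a point carries at least its own weight and possibly more. *)
Lemma point_masses (t : nat -> V) : exists m : {measure set T -> \bar R},
  [/\ fin_num_fun m, forall k, 8^-1 ^+ k <= fine (m [set (t k : T)]) &
    forall (g : T -> R) c, measurable_fun setT g -> (forall x, 0 <= g x) ->
      (forall K, \sum_(k < K) 8^-1 ^+ k * g (t k) <= c) -> (\int[m]_x (g x)%:E <= c%:E)%E].
Proof.
have p0 k : 0 <= 8^-1 ^+ k :> R by rewrite exprn_ge0// invr_ge0.
pose mk k := mscale (NngNum (p0 k)) (@dirac _ T (t k : T) R).
have mkE k B : mk k B = ((8^-1 ^+ k)%:E * \d_(t k : T) B)%E by [].
have mt := @measurable_point.
pose m := mseries mk 0; exists m.
have fin : fin_num_fun m.
  apply: lty_fin_num_fun; apply: (@le_lt_trans _ _ 2%:E); last exact: ltry.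
  rewrite /m /mseries; apply: lime_le; first by apply: is_cvg_nneseries => k _ _.
  apply: nearW => K; rewrite (eq_bigr (fun k => (8^-1 ^+ k)%:E)); last first.
    by move=> k _; apply: etrans (mkE k _) _; rewrite diracT mule1.
  rewrite sumEFin lee_fin big_mkord.
  suff -> : \sum_(k < K) (8^-1 ^+ k : R) = 8 / 7 * (1 - 8^-1 ^+ K).
    by have := p0 K; lra.
  elim: K => [|K ih]; first by rewrite big_ord0 expr0 subrr mulr0.
  by rewrite big_ord_recr /= ih exprS; field.
split => // [k|g c mg g0 gc].
  rewrite -lee_fin fineK ?fin//.
  apply: le_trans; last by apply: (@nneseries_lim_ge R (fun j => mk j [set (t k : T)]) xpredT 0 k.+1).
  rewrite big_nat_recr//= mkE diracE mem_set// mule1 leeDr//.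
  by apply: sume_ge0 => j _; rewrite mule_ge0// lee_fin.
rewrite ge0_integral_measure_series//; [|by move=> x _; rewrite lee_fin|exact/measurable_EFinP].
apply: lime_le.
  by apply: is_cvg_nneseries => k _ _; apply: integral_ge0 => x _; rewrite lee_fin.
apply: nearW => K; rewrite (eq_bigr (fun k => (8^-1 ^+ k * g (t k))%:E)).
  by rewrite sumEFin lee_fin big_mkord.
have mg' : measurable_fun setT (EFin \o g) by exact/measurable_EFinP.
move=> k _; rewrite (ge0_integral_mscale _ measurableT)//.
  by rewrite integral_dirac ?diracT ?mul1e.
by move=> x _; rewrite lee_fin.
Qed.

(** Two rates compete. In the integral of f_m against the test measure, the mass at t_m contributes
    at least 8^-m / 2; earlier points contribute little by the choice of the thresholds eta_k, later
    ones little by their weights. The integral is thus at least 8^-m / 4, while moving the measure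
    to E bounds it by a constant times 100^-m. *)
Lemma balayage_samp (E A : set V) : is_separated E -> (forall g, A g -> A (- g)) ->
  balayage E A -> exists2 eta : R, 0 < eta & samp A E eta.
Proof.
move=> sepE symA bal; apply: contrapT => no.
have mE : measurable (E : set T) by apply: measurable_closed; exact: separated_closed.
have bad (eta : R) : 0 < eta -> exists ft : (V -> R[i]) * V,
    [/\ spec A ft.1, forall x, cabs (ft.1 x) <= 1, forall x, E x -> cabs (ft.1 x) <= eta
      & 2^-1 < cabs (ft.1 ft.2)].
  move=> eta0; apply: contrapT => no'; apply: no; exists eta => // g sg g1 ge x.
  by rewrite leNgt; apply/negP => gx; apply: no'; exists (g, x).
pose P (eta : R) (ft : (V -> R[i]) * V) := 0 < eta -> [/\ spec A ft.1, forall x, cabs (ft.1 x) <= 1, forall x, E x -> cabs (ft.1 x) <= eta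
      & 2^-1 < cabs (ft.1 ft.2)].
have [ft_ hft] : {ft_ & forall eta, P eta (ft_ eta)}.
  apply: boolp.choice => eta; rewrite /P.
  have [/bad [ft h]|] := boolP (0 < eta); first by exists ft.
  by exists (fun=> 0, 0).
have [N hN] : {N : V -> R & forall t, 0 <= N t /\ forall f (c : R), spec A f -> 0 <= c ->
    (forall x, E x -> cabs (f x) <= c) -> cabs (f t) <= c * N t}.
  apply: (@boolp.choice _ _ (fun t N => 0 <= N /\ forall f (c : R), spec A f -> 0 <= c ->
    (forall x, E x -> cabs (f x) <= c) -> cabs (f t) <= c * N)) => t.
  by have [N N0 hN] := balayage_pointwise t mE symA bal; exists N.
(* The next threshold is divided by the pointwise constant N at the point just chosen: every later
   function, being tiny on E, is then tiny at that point too. *)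
pose fix eta (k : nat) : R :=
  if k is k'.+1 then eta k' / 100 / (1 + N (ft_ (eta k')).2) else 1.
pose f k := (ft_ (eta k)).1; pose t k := (ft_ (eta k)).2.
have N1 x : 0 < 1 + N x by rewrite ltr_wpDr//; case: (hN x).
have eta0 k : 0 < eta k.
  by elim: k => [|k ih] //=; rewrite !divr_gt0.
have etaS k : eta k.+1 <= eta k / 100.
  rewrite /= ler_pdivrMr// ler_peMr// ?divr_ge0 ?(ltW (eta0 k))// lerDl.
  by case: (hN (t k)).
have etaD k j : eta (k + j)%N <= eta k * 100^-1 ^+ j.
  elim: j => [|j ih]; first by rewrite addn0 expr0 mulr1.
  by rewrite addnS exprSr mulrA (le_trans (etaS _))// ler_pM2r.
have fspec k : spec A (f k) by have [] := hft _ (eta0 k).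
have f1 k x : cabs (f k x) <= 1 by have [_ + _ _] := hft _ (eta0 k); exact.
have fE k x : E x -> cabs (f k x) <= eta k by have [_ _ + _] := hft _ (eta0 k); exact.
have ftk k : 2^-1 < cabs (f k (t k)) by have [_ _ _] := hft _ (eta0 k).
have small k (m : nat) : (k < m)%N -> cabs (f m (t k)) <= 100^-1 ^+ m.
  move=> km; have [N0 hNk] := hN (t k).
  apply: le_trans (hNk _ _ (fspec m) (ltW (eta0 m)) (fE m)) _.
  have e1 : eta m <= eta k.+1 * 100^-1 ^+ (m - k.+1) by rewrite -{1}(subnKC km) etaD.
  have e2 : eta k <= 100^-1 ^+ k by have := etaD 0%N k; rewrite add0n /= mul1r.
  have e3 : eta k.+1 * (1 + N (t k)) = eta k / 100 by rewrite /= divfK// gt_eqF.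
  have i0 j : 0 < 100^-1 ^+ j :> R by rewrite exprn_gt0.
  apply: (@le_trans _ _ (eta k.+1 * (1 + N (t k)) * 100^-1 ^+ (m - k.+1))).
    rewrite mulrAC; apply: ler_pM => //; first exact: ltW.
    by rewrite lerDr.
  rewrite e3 -[X in _ <= _ ^+ X](subnKC km) exprD exprSr ler_pM2r//.
  by rewrite ler_pM2r.
have [mu [mufin mut muint]] := point_masses t.
have [nu [nuE h]] := bal (posm mufin).
have upper (m : nat) : cabs (cintegral mu setT (fun x : T => f m (vec_of x))) <= 100^-1 ^+ m * cmnorm nu.
  rewrite -(cmint_posm mufin) (spec_cmint (fspec m) symA h).
  apply: le_trans (cmint_supported mE nuE (spec_measurable (fspec m)) (fun x => f1 m _) (ltW (eta0 m)) _) _.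
    by move=> x; exact: fE.
  rewrite ler_wpM2r ?cmnorm_ge0//.
  by have := etaD 0%N m; rewrite add0n /= mul1r.
have lower (m : nat) : (0 < m)%N -> 8^-1 ^+ m / 4 <= cabs (cintegral mu setT (fun x : T => f m (vec_of x))).
  move=> m0; pose D : set T := [set t m : T].
  pose mu' : {finite_measure set T -> \bar R} := finmeas mufin.
  have mD : measurable D by exact: measurable_point.
  have mf := spec_measurable (fspec m).
  have mi (B : set T) : measurable B -> cmeasurable (fun x : T => f m (vec_of x) * cind B x).
    by move=> mB; apply: cmeasurableM => //; exact: cmeasurable_cind.
  have bi (B : set T) (x : T) : cabs (f m (vec_of x) * cind B x) <= 1.
    by rewrite cabsM cabs_cind indicE mulr_ile1 ?cabs_ge0//; case: (x \in B).
  have ib (B : set T) : measurable B -> cintble mu (fun x : T => f m (vec_of x) * cind B x).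
    by move=> mB; apply: (@fin_cintble mu' _ 1); [exact: mi|exact: bi].
  have e0 : cintegral mu setT (fun x : T => f m (vec_of x)) =
      cintegral mu setT (fun x : T => f m (vec_of x) * cind D x) +
      cintegral mu setT (fun x : T => f m (vec_of x) * cind (~` D) x).
    rewrite -cintegralD; [|exact: ib|by apply: ib; exact: measurableC].
    apply: eq_cintegral => x; rewrite -mulrDr /cind !indicE in_setC.
    by case: (x \in D); rewrite /= ?addr0 ?add0r mulr1.
  have e1 : cintegral mu setT (fun x : T => f m (vec_of x) * cind D x) =
      f m (t m) * ((fine (mu D))%:C)%C.
    rewrite (_ : (fun x : T => _) = fun x : T => f m (t m) * cind D x); last first.
      apply/funext => x; rewrite /cind indicE; case: (boolP (x \in D)); last by rewrite !mulr0.
      by rewrite inE => ->.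
    rewrite cintegralZ; last first.
      apply: (@fin_cintble mu' _ 1); first exact: cmeasurable_cind.
      by move=> x; rewrite cabs_cind indicE; case: (x \in D).
    congr (_ * _); apply: complex_ext; rewrite /= ?integral0//.
    by under eq_integral do rewrite /cind /=; rewrite integral_indic// setIT.
  have e2 : cabs (cintegral mu setT (fun x : T => f m (vec_of x) * cind (~` D) x)) <= 8^-1 ^+ m / 4.
    have iD := ib _ (measurableC mD).
    apply: le_trans (cabs_cintegral iD) _; rewrite -lee_fin fineK; last first.
      by apply: integrable_fin_num => //; exact: cintble_cabs iD.
    apply: muint => [||K].
    - by apply: measurable_cabs; apply: mi; exact: measurableC.
    - by move=> x; exact: cabs_ge0.
    have gk k : cabs (f m (t k) * cind (~` D) (t k)) <= 100^-1 ^+ m + (if (m < k)%N then 1 else 0).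
      have h0 : 0 <= 100^-1 ^+ m :> R by rewrite exprn_ge0.
      case: (ltngtP m k) => [mk|km|<-].
      - by rewrite (le_trans (bi _ _))// lerDr.
      - rewrite addr0 cabsM cabs_cind (le_trans _ (small _ _ km))//.
        by rewrite ler_piMr ?cabs_ge0// indicE; case: (_ \in _).
      - by rewrite addr0 cabsM cabs_cind indicE in_setC mem_set //= mulr0.
    have q0 j : 0 < 8^-1 ^+ j :> R by rewrite exprn_gt0.
    apply: (@le_trans _ _ (8 / 7 * (1 - 8^-1 ^+ K) * 100^-1 ^+ m
        + (if (m < K)%N then 8^-1 ^+ m / 7 - 8^-1 ^+ K * (8 / 7) else 0))).
      elim: K => [|K ih]; first by rewrite big_ord0 expr0 subrr mulr0 mul0r add0r.
      rewrite big_ord_recr /=; apply: le_trans (lerD ih (ler_wpM2l (ltW (q0 K)) (gk K))) _.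
      rewrite [X in _ + X <= _]mulrDr addrACA; apply: lerD.
        by rewrite -mulrDl le_eqVlt; apply/orP; left; apply/eqP; rewrite exprS; field.
      rewrite ltnS; case: (ltngtP m K) => [mK|Km|<-].
      - by rewrite exprS; have := q0 K; lra.
      - by rewrite mulr0 addr0.
      - by rewrite exprS; have := q0 m; lra.
    have h1 : 100^-1 ^+ m <= 8^-1 ^+ m * (8 / 100) :> R.
      have -> : 100^-1 ^+ m = 8^-1 ^+ m * (8 / 100) ^+ m :> R.
        by rewrite -exprMn; congr (_ ^+ _); field.
      have e80 : 0 <= 8 / 100 :> R by lra.
      have e81 : 8 / 100 <= 1 :> R by lra.
      by rewrite ler_pM2l//; exact: ler_wiXn2l m0.
    have h2 : 8 / 7 * (1 - 8^-1 ^+ K) * 100^-1 ^+ m <= 8 / 7 * 100^-1 ^+ m :> R.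
      rewrite ler_wpM2r// ?exprn_ge0//; have := q0 K; lra.
    case: ifP => _; have := q0 m; have := q0 K; lra.
  have e3 : 8^-1 ^+ m / 2 <= cabs (cintegral mu setT (fun x : T => f m (vec_of x) * cind D x)).
    rewrite e1 cabsM cabs_real ger0_norm; last exact: fine_ge0.
    have q0 : 0 <= 8^-1 ^+ m :> R by rewrite exprn_ge0.
    rewrite mulrC; apply: ler_pM (ltW (ftk m)) (mut m) => //.
  rewrite e0; have := cabs_sub (cintegral mu setT (fun x : T => f m (vec_of x) * cind D x))
    (- cintegral mu setT (fun x : T => f m (vec_of x) * cind (~` D) x)).
  by rewrite opprK cabsN; lra.
(* The rates have ratio 100 / 8 = 25 / 2, and (25 / 2)^m >= m already contradicts the two bounds
   once m exceeds 4 [cmnorm nu]. *)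
have [m m0 mb] : exists2 m : nat, (0 < m)%N & 4 * cmnorm nu < m%:R.
  exists (Num.bound (4 * cmnorm nu)).+1 => //.
  by rewrite (lt_le_trans (archi_boundP _))// ?mulr_ge0 ?cmnorm_ge0// ler_nat.
have := le_trans (lower m m0) (upper m).
have -> : 8^-1 ^+ m = 100^-1 ^+ m * (25 / 2) ^+ m :> R.
  by rewrite -exprMn; congr (_ ^+ _); field.
rewrite -mulrA ler_pM2l ?exprn_gt0// => hm.
have : m%:R <= (25 / 2) ^+ m :> R.
  elim: m {mb hm m0} => [|j ih]; first exact: ler01.
  rewrite -(natr1 j) exprS; have : 1 <= (25 / 2) ^+ j :> R by apply: exprn_ege1; lra.
  lra.
lra.
Qed.

End balayage_norming.

(** * Enlarging the spectrum *)

Section dilates.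
Context {R : realType} {n : nat}.
Local Notation V := 'rV[R]_n.+1.
Implicit Types (A : set V) (r s : R).

Definition dil r A : set V := [set x | exists2 y, A y & x = r *: y].

Lemma dil1 A : dil 1 A = A.
Proof.
apply/seteqP; split => [_ [y Ay ->]|x Ax]; first by rewrite scale1r.
by exists x => //; rewrite scale1r.
Qed.

Lemma dil_dil r s A : dil r (dil s A) `<=` dil (r * s) A.
Proof. by move=> _ [_ [y Ay ->] ->]; exists y => //; rewrite scalerA. Qed.

(** Convexity enters as a budget rule: when functions are multiplied, the dilation factors of their
    spectra add up. *)
Lemma dilD A r s x y : is_convex A -> 0 <= r -> 0 <= s ->
  dil r A x -> dil s A y -> dil (r + s) A (x + y).
Proof.
move=> cA r0 s0 [a Aa ->] [b Ab ->].
have [rs|rs] := eqVneq (r + s) 0.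
  have r00 : r = 0 by lra.
  have s00 : s = 0 by lra.
  by exists a => //; rewrite r00 s00 !scale0r !addr0 scale0r.
have rs0 : 0 < r + s by rewrite lt_neqAle eq_sym rs addr_ge0.
exists (r / (r + s) *: a + (1 - r / (r + s)) *: b).
  apply: cA => //; rewrite divr_ge0 ?addr_ge0//=.
  by rewrite ler_pdivrMr// mul1r lerDl.
rewrite scalerDr !scalerA mulrC divfK// (_ : (r + s) * (1 - r / (r + s)) = s)//.
by field.
Qed.

Lemma dil_mono A r s : is_convex A -> A 0 -> 0 <= r -> r <= s -> dil r A `<=` dil s A.
Proof.
move=> cA A0 r0 rs x Ax; rewrite -(subrKC r s) -[x]addr0; apply: dilD => //.
  by rewrite subr_ge0.
by exists 0 => //; rewrite scaler0.
Qed.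

Lemma nball_dil A r s : nball s `<=` A -> 0 < r -> nball (r * s) `<=` dil r A.
Proof.
move=> sA r0 x xrs; exists (r^-1 *: x); last by rewrite scalerA divff ?scale1r ?gt_eqF.
apply: sA; rewrite /nball /= normrZ gtr0_norm ?invr_gt0//.
by rewrite mulrC ler_pdivrMr// mulrC.
Qed.

Lemma dil_nball A r s : A `<=` nball s -> 0 <= r -> dil r A `<=` nball (r * s).
Proof.
by move=> As r0 _ [y /As ys ->]; rewrite /nball /= normrZ ger0_norm// ler_wpM2l.
Qed.

End dilates.

Section extension.
Context {R : realType} {n : nat}.
Local Notation T := (@Rd R n.+1).
Local Notation V := 'rV[R]_n.+1.
Implicit Types (A : set V).
Notation leb := (@lebesgue_d R n.+1).

(** If the supremum of |g| exceeded m / eta, g divided by it would be within the threshold of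
    [samp], hence at most 1/2 everywhere, against the choice of the supremum. *)
Lemma samp_bound A (S : set V) (eta m : R) g : 0 < eta -> 0 <= m -> samp A S eta ->
  spec A g -> (forall x, S x -> cabs (g x) <= m) -> forall x, cabs (g x) <= m / eta.
Proof.
move=> eta0 m0 smp sg gS x0; pose X : set R := range (fun x => cabs (g x)).
have [K gK] := spec_bounded sg.
have hs : has_sup X by split; [exists (cabs (g 0)), 0|exists K => _ [x _ <-]].
have ub x : cabs (g x) <= sup X by apply: sup_upper_bound => //; exists x.
apply: le_trans (ub x0) _; rewrite leNgt; apply/negP => lt.
have sX0 : 0 < sup X by apply: le_lt_trans lt; rewrite divr_ge0// ltW.
pose c : R[i] := (((sup X)^-1)%:C)%C.
have cE x : cabs (c * g x) = (sup X)^-1 * cabs (g x).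
  by rewrite cabsM cabs_real gtr0_norm ?invr_gt0.
have h x : cabs (c * g x) <= 2^-1.
  apply: (smp (fun x => c * g x)) => [|y|y Sy]; first exact: specZ.
    by rewrite cE mulrC ler_pdivrMr// mul1r.
  rewrite cE mulrC ler_pdivrMr// (le_trans (gS _ Sy))//.
  by move: lt; rewrite ltr_pdivrMr// mulrC => /ltW.
have : sup X <= sup X / 2.
  apply: sup_le_ub; first by exists (cabs (g 0)), 0.
  by move=> _ [x _ <-]; have := h x; rewrite cE mulrC ler_pdivrMr// mulrC.
by lra.
Qed.

Lemma sum_at_most_one (m : nat) (P : pred 'I_m) :
  (forall i j, P i -> P j -> i = j) -> \sum_(i < m) (P i)%:R <= 1 :> R.
Proof.
move=> h; case: (pickP P) => [i Pi|P0].
  rewrite (bigD1 i)//= Pi big1 ?addr0// => j ji.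
  by case: (boolP (P j)) => // /(h _ _ Pi) ij; rewrite ij eqxx in ji.
by rewrite big1 ?ler01// => i _; rewrite P0.
Qed.

(* [f (t + c_j (x - t)) hV (d_j (x - t))] with [c_j = 1 - 2 d_j]: near [t] it differs little from
   [f x], far from [t] the second factor is small, and with [d_j] lacunary at most one [j] is
   in neither regime, so the average over [j] is small wherever [f] is small. *)
Lemma samp_extension A (E : set V) (L rho eta : R) : 0 < rho -> 0 < L ->
  0 < fine (leb (Q (2 * L))) ->
  is_convex A -> nball rho `<=` A -> A `<=` nball L -> 0 < eta -> samp A E eta ->
  exists eps : R, [/\ 0 < eps, eps <= 1 & samp (dil (1 + eps) A) E (eta / 4)].
Proof.
move=> rho0 L0 vol cA rA AL eta0 smp.
(* As eps will be at most 1, spectra in (1 + eps) A stay in the ball of radius 2 L. *)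
have [||B B0 bern] := @bernstein R n (2 * L); rewrite ?mulr_gt0//.
have A0 : A 0 by apply: rA; rewrite /nball /= normr0 ltW.
pose rho' := rho / n.+1%:R; have rho'0 : 0 < rho' by rewrite divr_gt0.
have rhoE : n.+1%:R * rho' = rho by rewrite mulrC divfK.
(* Near regime: if d_j |x - t| <= s, the argument of f is displaced by at most 2 s, which changes f
   by at most 2 B s = eta / 4. *)
pose s := eta / (8 * B); have s0 : 0 < s by rewrite divr_gt0// mulr_gt0.
pose p := 2 * pi * rho'; have p0 : 0 < p by rewrite !mulr_gt0 ?pi_gt0.
(* Far regime: if d_j |x - t| >= r, the kernel is at most 1 / (p r) = eta / 2. *)
pose r := 2 / (p * eta); have r0 : 0 < r by rewrite divr_gt0// mulr_gt0.
(* From q r <= s, the window between s and r contains d_j |x - t| for at most one j; q <= 1/4 keeps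
   1 - 2 d_j positive. *)
pose q := Num.min 4^-1 (s / r).
have q0 : 0 < q by rewrite lt_min invr_gt0 divr_gt0//= andbT.
have q4 : q <= 4^-1 by rewrite ge_min lexx.
have qr : q * r <= s by rewrite -ler_pdivlMr// ge_min lexx orbT.
(* The one exceptional index contributes 1 / (m + 1) <= eta / 4 to the average, on top of eta / 2
   from the others. *)
have [m m4] : exists m : nat, 4 / eta <= m.+1%:R.
  exists (Num.bound (4 / eta)); have := archi_boundP (divr_ge0 (ler0n _ 4) (ltW eta0)).
  by move=> /ltW h; rewrite (le_trans h)// ler_nat.
pose d (j : 'I_m.+1) := q ^+ j.+1.
have d0 j : 0 < d j by rewrite exprn_gt0.
have dq j : d j <= q by rewrite /d exprS ler_piMr ?(ltW q0)// exprn_ile1 ?(ltW q0)//; lra.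
(* The smallest d_j: then (1 - 2 d_j) (1 + eps) + d_j <= 1 for all j, so the average has its
   spectrum in A. *)
pose eps := q ^+ m.+1.
have eps0 : 0 < eps by rewrite exprn_gt0.
have epsd j : eps <= d j.
  by apply: ler_wiXn2l; rewrite ?(ltW q0) ?ltn_ord//; lra.
have eps4 : eps <= 4^-1 by apply: le_trans (epsd ord0) (le_trans (dq _) q4).
exists eps; split => //; first by lra.
move=> f sf f1 fE t.
pose term j (x : V) := f (t + (1 - 2 * d j) *: (x - t)) * hV rho' (d j *: (x - t)).
pose c : R[i] := ((m.+1%:R^-1)%:C)%C.
pose g x := c * \sum_(j < m.+1) term j x.
have cm : c * m.+1%:R = 1.
  rewrite /c (_ : (m.+1%:R : R[i]) = ((m.+1%:R : R)%:C)%C); last by rewrite rmorph_nat.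
  by rewrite -rmorphM /= mulVf ?pnatr_eq0.
have gt : g t = f t.
  rewrite /g (eq_bigr (fun=> f t)) => [|j _].
    by rewrite sumr_const card_ord -mulr_natr mulrCA cm mulr1.
  by rewrite /term subrr !scaler0 addr0 hV0 mulr1.
have sg : spec A g.
  apply: specZ; apply: spec_sum => j.
  apply: (@specM _ _ (dil ((1 - 2 * d j) * (1 + eps)) A) (dil (d j) A)).
  - move=> a b ha hb; rewrite -(dil1 A); have := dq j; have := epsd j; have := d0 j.
    move=> h1 h2 h3; have h4 : 0 <= (1 - 2 * d j) * (1 + eps) by rewrite mulr_ge0; lra.
    have := dilD cA h4 (ltW (d0 j)) ha hb; apply: dil_mono => //; first by rewrite addr_ge0// ltW.
    have : eps <= d j * (1 + 2 * eps) by rewrite mulrDr mulr1 ler_wpDr// mulr_ge0//; lra.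
    by lra.
  - rewrite (_ : (fun x => _) = fun x => f ((t - (1 - 2 * d j) *: t) + (1 - 2 * d j) *: x)).
      apply: spec_affine sf => a ha; apply: dil_dil; by exists a.
    by apply/funext => x; rewrite scalerBr; congr f; rewrite -!addrA; congr (_ + _); rewrite addrC.
  - rewrite (_ : (fun x => _) = fun x => hV rho' (- d j *: t + d j *: x)).
      apply: spec_affine (spec_hV rho'0) => a ha.
      by exists a => //; apply: rA; rewrite -rhoE.
    by apply/funext => x; rewrite scalerBr addrC scaleNr.
have sf2 : spec (nball (2 * L)) f.
  apply: spec_sub sf => x hx.
  have : 0 <= 1 + eps by lra.
  move=> /(dil_nball AL) /(_ _ hx); rewrite /nball /= => h; apply: le_trans h _.
  by rewrite ler_pM2r//; lra.
have fB := bern f sf2 f1.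
rewrite -gt; apply: smp => //.
  move=> x; rewrite /g cabsM; apply: le_trans (ler_wpM2l (cabs_ge0 _) (cabs_sum _ _)) _.
  rewrite cabs_real gtr0_norm ?invr_gt0// mulrC ler_pdivrMr// mul1r.
  apply: (@le_trans _ _ (\sum_(j < m.+1) 1)); last by rewrite sumr_const card_ord.
  by apply: ler_sum => j _; rewrite cabsM mulr_ile1 ?cabs_ge0 ?cabs_hV_le1.
move=> x Ex; pose D := `|x - t|.
pose bad (j : 'I_m.+1) := (s < d j * D) && (d j * D < r).
have bad1 : \sum_(j < m.+1) (bad j)%:R <= 1 :> R.
  have aux (i j : 'I_m.+1) : (i < j)%N -> bad i -> bad j -> False.
    move=> ij /andP[_ b2] /andP[b3 _].
    have : d j * D <= q * r; last by lra.
    apply: (@le_trans _ _ (q * (d i * D))); last by rewrite ler_pM2l// ltW.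
    rewrite mulrA; apply: ler_wpM2r; first exact: normr_ge0.
    rewrite [X in _ <= X](_ : _ = q ^+ i.+2) /d; last by rewrite -exprS.
    by apply: ler_wiXn2l; rewrite ?(ltW q0)//; lra.
  apply: sum_at_most_one => i j bi bj; apply: val_inj => /=.
  by case: (ltngtP i j) => // [/aux /(_ bi bj)|/aux /(_ bj bi)].
have tj j : cabs (term j x) <= eta / 2 + (bad j)%:R.
  rewrite /term cabsM; have := f1 (t + (1 - 2 * d j) *: (x - t)).
  have := cabs_hV_le1 rho' (d j *: (x - t)).
  set ff := f _; set hh := hV _ _ => hh1 ff1.
  rewrite /bad; case: ltP => [near|far] /=; last first.
    rewrite addr0; apply: (@le_trans _ _ (cabs ff)); first by rewrite ler_piMr ?cabs_ge0.
    apply: le_trans (cabs_sub _ (f x)) _.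
    have := fE _ Ex; have := fB (t + (1 - 2 * d j) *: (x - t)) x; rewrite -/ff.
    have -> : t + (1 - 2 * d j) *: (x - t) - x = (- (2 * d j)) *: (x - t).
      by rewrite scalerBl scale1r scaleNr addrA subrKC addrAC subrr add0r.
    rewrite normrZ normrN gtr0_norm ?mulr_gt0// -/D => h1 h2.
    have : B * (2 * d j * D) <= eta / 4.
      rewrite (_ : B * (2 * d j * D) = 2 * B * (d j * D)); last by ring.
      apply: le_trans (ler_wpM2l _ far) _; first by rewrite mulr_ge0 ?(ltW B0).
      rewrite /s le_eqVlt; apply/orP; left; apply/eqP; by field; rewrite gt_eqF.
    by lra.
  case: (ltP (d j * D) r) => [_|far'] /=.
    apply: (@le_trans _ _ 1); [by rewrite mulr_ile1 ?cabs_ge0|].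
    lra.
  rewrite addr0; apply: (@le_trans _ _ (cabs hh)); first by rewrite ler_piMl ?cabs_ge0.
  have := hV_decay (d j *: (x - t)) rho'0; rewrite -/hh -/p normrZ gtr0_norm// -/D => h.
  have : cabs hh * (p * r) <= 1.
    by apply: le_trans h; rewrite ler_wpM2l ?cabs_ge0// ler_pM2l.
  rewrite (_ : p * r = 2 / eta); last by rewrite /r; field; rewrite !gt_eqF.
  by rewrite mulrA ler_pdivrMr// mul1r; lra.
rewrite /g cabsM; apply: le_trans (ler_wpM2l (cabs_ge0 _) (cabs_sum _ _)) _.
rewrite cabs_real gtr0_norm ?invr_gt0// mulrC ler_pdivrMr//.
apply: le_trans (ler_sum _ (fun j _ => tj j)) _.
rewrite big_split /= sumr_const card_ord -[_ *+ m.+1]mulr_natr.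
have h2 : 1 <= eta / 4 * m.+1%:R.
  have := ler_wpM2l (ltW eta0) m4.
  by rewrite (_ : eta * (4 / eta) = 4); [lra|field; rewrite gt_eqF].
move: bad1 h2 => {m4 cm gt sg}; move: (m.+1%:R : R) => M; set Y := \sum_(j < _) _ => h1 h2.
by lra.
Qed.

End extension.

(** * Comparison of square sums *)

Section transfer.
Context {R : realType} {n : nat}.
Local Notation T := (@Rd R n.+1).
Local Notation V := 'rV[R]_n.+1.
Implicit Types (A S : set V).
Notation leb := (@lebesgue_d R n.+1).

(* For each [y] apply [samp] to [x |-> f x * hV (y - x)], whose value at [y] is [f y]: some [x] in [S]
   carries a fixed proportion of it, and these [x] absorb the sum over [y] by [separated_sum]. *)
Lemma sampled_energy A S (eta rho delta : R) : 0 < eta -> 0 < rho -> 0 < delta ->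
  samp A S eta -> exists2 C : R, 0 < C & forall f K ys,
    (forall y, spec A (fun x => f x * hV rho (y - x))) ->
    (forall xs, uniq xs -> (forall x, x \in xs -> S x) -> \sum_(x <- xs) cabs2 (f x) <= K) ->
    uniq ys -> (forall y y', y \in ys -> y' \in ys -> y != y' -> delta <= `|y - y'|) ->
    \sum_(y <- ys) cabs2 (f y) <= C * K.
Proof.
move=> eta0 rho0 delta0 smp.
have [C C0 hC] := @separated_sum R n rho delta rho0 delta0.
(* Some x in S satisfies |f x| |hV (y - x)| > (eta / 2) |f y|, for otherwise [samp_bound] would give
   |f y| <= |f y| / 2; c is the square of 2 / eta. *)
pose c : R := 4 / eta ^+ 2; have c0 : 0 < c by rewrite divr_gt0// exprn_gt0.
exists (c * C) => [|f K ys sf fK uys sep]; first by rewrite mulr_gt0.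
have [X hX] : {X : V -> V & forall y, cabs2 (f y) != 0 ->
    S (X y) /\ cabs2 (f y) <= c * (cabs2 (f (X y)) * cabs2 (hV rho (y - X y)))}.
  apply: (@boolp.choice _ _ (fun y x => cabs2 (f y) != 0 ->
    S x /\ cabs2 (f y) <= c * (cabs2 (f x) * cabs2 (hV rho (y - x))))) => y.
  have [_|fy] := eqVneq (cabs2 (f y)) 0; first by exists 0.
  have fy0 : 0 < cabs (f y).
    rewrite lt_neqAle cabs_ge0 eq_sym andbT; apply: contraNneq fy.
    by move=> /cabs_eq0 ->; rewrite cabs20.
  apply: contrapT => no; pose m := eta / 2 * cabs (f y).
  have m0 : 0 <= m by rewrite mulr_ge0 ?cabs_ge0 ?divr_ge0// ltW.
  have gS x : S x -> cabs (f x * hV rho (y - x)) <= m.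
    move=> Sx; rewrite leNgt; apply/negP => lt; apply: no; exists x => _; split => //.
    rewrite -cabs2M 2!cabs2E; have : m ^+ 2 <= cabs (f x * hV rho (y - x)) ^+ 2.
      by apply: lerXn2r; rewrite ?nnegrE ?cabs_ge0// ltW.
    move=> h; apply: le_trans (ler_wpM2l (ltW c0) h).
    rewrite /c /m le_eqVlt; apply/orP; left; apply/eqP.
    by field; rewrite gt_eqF.
  have := samp_bound eta0 m0 smp (sf y) gS y.
  rewrite subrr hV0 mulr1 (_ : m / eta = cabs (f y) / 2); first by lra.
  by rewrite /m; field; rewrite gt_eqF.
pose ys' := [seq y <- ys | cabs2 (f y) != 0].
have -> : \sum_(y <- ys) cabs2 (f y) = \sum_(y <- ys') cabs2 (f y).
  rewrite big_filter [RHS]big_mkcond; apply: eq_bigr => y _.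
  by case: eqP.
have ys'P y : y \in ys' -> y \in ys /\ cabs2 (f y) != 0.
  by rewrite mem_filter => /andP[? ?].
pose xs := undup [seq X y | y <- ys'].
apply: (@le_trans _ _ (\sum_(y <- ys') \sum_(x <- xs) c * (cabs2 (f x) * cabs2 (hV rho (y - x))))).
  rewrite [leLHS]big_seq [leRHS]big_seq; apply: ler_sum => y yys.
  have [_ fy] := ys'P _ yys; have [_ h] := hX _ fy; apply: le_trans h _.
  have Xy : X y \in xs by rewrite mem_undup map_f.
  rewrite (big_rem _ Xy) /= lerDl; apply: sumr_ge0 => x _.
  by rewrite mulr_ge0 ?(ltW c0)// mulr_ge0 ?cabs2_ge0.
rewrite exchange_big /= -mulrA.
apply: (@le_trans _ _ (\sum_(x <- xs) c * (C * cabs2 (f x)))).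
  apply: ler_sum => x _; rewrite -mulr_sumr ler_pM2l// -mulr_sumr mulrC.
  rewrite ler_wpM2r ?cabs2_ge0//; apply: hC; first exact: filter_uniq.
  by move=> y y' /ys'P[? _] /ys'P[? _]; exact: sep.
rewrite -mulr_sumr -mulr_sumr ler_pM2l// ler_pM2l//; apply: fK; first exact: undup_uniq.
move=> x; rewrite mem_undup => /mapP[y /ys'P[_ fy] ->].
by have [] := hX _ fy.
Qed.

(** Rounding x down to the lattice changes f by at most B / (2 r) <= 1/4, and on the lattice f is at
    most 1/4. *)
Lemma lattice_samp (L B r : R) : 0 < r -> 0 < B -> 2 * B <= r ->
  (forall f : V -> R[i], spec (nball L) f -> (forall x, cabs (f x) <= 1) ->
    forall x y, cabs (f x - f y) <= B * `|x - y|) ->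
  samp (nball L : set V) (lat r) 4^-1.
Proof.
move=> r0 B0 Br bern f sf f1 fl x.
pose y : V := \row_i ((Num.floor (2 * r * x ord0 i))%:~R / (2 * r)).
have r20 : 0 < 2 * r by rewrite mulr_gt0.
have ly : lat r y by move=> i; exists (Num.floor (2 * r * x ord0 i)); rewrite mxE.
have xy : `|x - y| <= (2 * r)^-1.
  apply: norm_le_coord => i; rewrite !mxE.
  have := floor_itv (2 * r * x ord0 i); set z := Num.floor _.
  rewrite intrD => /andP[h1 h2].
  rewrite (_ : x ord0 i - _ = (2 * r * x ord0 i - z%:~R) / (2 * r)).
    rewrite normrM (gtr0_norm (x := _^-1)) ?invr_gt0// ler_piMl ?invr_ge0 ?(ltW r20)//.
    by rewrite ler_norml; apply/andP; split; lra.
  by field; rewrite gt_eqF.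
apply: le_trans (cabs_sub _ (f y)) _.
have := fl _ ly; have := bern f sf f1 x y; have := ler_wpM2l (ltW B0) xy.
have : B * (2 * r)^-1 <= 4^-1 by rewrite ler_pdivrMr//; lra.
by lra.
Qed.

(* Rounding the frequencies to a grid of mesh [1 / N] turns [ft F] into trigonometric polynomials. *)
Lemma spec_ft A (B : set V) (L r : R) (F : T -> R[i]) : cintble leb F ->
  (forall g : T, ~ A (vec_of g) -> F g = 0) -> 0 < L -> A `<=` nball L -> B 0 -> 0 < r ->
  (forall a v, A a -> `|v| <= r -> B (a + v)) -> spec B (ft F).
Proof.
move=> iF F0 L0 AL B0 r0 hB.
have mF := cintble_measurable iF.
have [n0 n0r] : exists n0 : nat, r^-1 <= n0%:R.
  by exists (Num.bound r^-1); apply/ltW/archi_boundP; rewrite invr_ge0 ltW.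
pose N k : R := (n0 + k).+1%:R.
have N0 k : 0 < N k by rewrite ltr0n.
have Nr k : (N k)^-1 <= r.
  by rewrite -[r]invrK lef_pV2 ?posrE ?invr_gt0// (le_trans n0r)// ler_nat -addnS leq_addr.
pose M k := (Num.bound (2 * N k * L)).+1.
pose J k := {ffun 'I_n.+1 -> 'I_(M k)}.
pose idx k (g : V) i := Num.floor (N k * (g ord0 i + L)).
pose pt k (j : J k) : V := \row_i ((j i)%:R / N k - L).
pose cell k (j : J k) : set T := [set g | forall i, idx k (vec_of g) i = (j i)%:Z].
(* A cell whose corner is outside B does not meet A, so its coefficient is 0; the frequency 0 is a
   default that B contains. *)
pose qt k (j : J k) : V := if `[< B (pt k j) >] then pt k j else 0.
have mcell k j : measurable (cell k j).
  rewrite (_ : cell k j = boxv (pt k j) (pt k j + const_mx (N k)^-1)); first exact: measurable_box.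
  have e (g : T) i : (pt k j ord0 i <= vec_of g ord0 i < (pt k j + const_mx (N k)^-1) ord0 i) =
      ((j i)%:Z%:~R <= N k * (vec_of g ord0 i + L) < ((j i)%:Z + 1)%:~R).
    rewrite !mxE intrD; congr (_ && _).
      by rewrite lerBlDr ler_pdivrMr// mulrC.
    by rewrite addrAC -[X in _ + X - _]mul1r -mulrDl ltrBrDr ltr_pdivlMr// mulrC.
  apply/seteqP; split => g cg i.
    by rewrite e; have := floor_itv (N k * (vec_of g ord0 i + L)); rewrite -(cg i).
  by apply: floor_def; rewrite -e; exact: cg.
have near_pt k j (g : T) : cell k j g -> `|pt k j - vec_of g| <= (N k)^-1.
  move=> cg; apply: norm_le_coord => i; rewrite !mxE.
  have := floor_itv (N k * (vec_of g ord0 i + L)); have := cg i; rewrite /idx => ->.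
  rewrite intrD => /andP[h1 h2].
  rewrite (_ : _ - _ = ((j i)%:R - N k * (vec_of g ord0 i + L)) / N k); last first.
    by field; rewrite gt_eqF.
  rewrite normrM (gtr0_norm (x := _^-1)) ?invr_gt0// ler_piMl ?invr_ge0 ?(ltW (N0 k))//.
  by rewrite ler_norml; apply/andP; split; lra.
have qtE k j (g : T) : A (vec_of g) -> cell k j g -> qt k j = pt k j.
  move=> Ag cg; rewrite /qt asboolT// -(subrKC (vec_of g) (pt k j)).
  by apply: hB => //; apply: le_trans (near_pt _ _ _ cg) (Nr k).
have cover k (g : T) : A (vec_of g) -> exists j, cell k j g.
  move=> /AL Lg.
  have b i : (0 <= idx k (vec_of g) i) /\ (`|idx k (vec_of g) i| < M k)%N.
    have := nball_coord i Lg; rewrite ler_norml => /andP[h1 h2].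
    have p0 : 0 <= idx k (vec_of g) i.
      by rewrite floor_ge0 mulr_ge0 ?(ltW (N0 k))//; lra.
    split => //; rewrite -ltz_nat gez0_abs//.
    rewrite -(ltr_int R); apply: le_lt_trans (floor_le _) _.
    apply: (@le_lt_trans _ _ (2 * N k * L)).
      rewrite [leRHS](_ : _ = N k * (2 * L)); last by ring.
      by rewrite ler_pM2l//; lra.
    apply: lt_le_trans (archi_boundP _) _; first by rewrite !mulr_ge0 ?(ltW (N0 k))// ltW.
    by rewrite -[leRHS]/((M k)%:R) ler_nat leqnSn.
  exists [ffun i => inord `|idx k (vec_of g) i|%N] => i; have [b1 b2] := b i.
  by rewrite ffunE inordK// gez0_abs.
have disj k j j' (g : T) : cell k j g -> cell k j' g -> j = j'.
  move=> h h'; apply/ffunP => i; apply: val_inj; have := h i; rewrite h' => /eqP.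
  by rewrite eqz_nat => /eqP.
pose s k : seq (V * R[i]) := [seq (qt k j, cintegral leb setT (fun g => F g * cind (cell k j) g)) | j <- index_enum (J k)].
pose phi k x (g : T) : R[i] := \sum_(j : J k) cind (cell k j) g * ez x (qt k j).
have phiE k x j (g : T) : A (vec_of g) -> cell k j g -> phi k x g = ez x (pt k j).
  move=> Ag cg; rewrite /phi (bigD1 j)//= big1 => [|j' jj'].
    by rewrite addr0 /cind indicE mem_set// mul1r (qtE _ _ _ Ag cg).
  rewrite /cind indicE memNset ?mul0r// => cg'.
  by rewrite (disj _ _ _ _ cg cg') eqxx in jj'.
have icell k j : cintble leb (fun g => F g * cind (cell k j) g).
  apply: (@cintbleM _ _ _ _ _ 1) => //; first exact: cmeasurable_cind.
  by move=> g; rewrite cabs_cind indicE; case: (_ \in _).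
have tpE k x : tp (s k) x = cintegral leb setT (fun g => F g * phi k x g).
  rewrite /tp big_map.
  rewrite [RHS](_ : _ = cintegral leb setT
      (fun g => \sum_(j : J k) ez x (qt k j) * (F g * cind (cell k j) g))).
    rewrite cintegral_sum; last by move=> j; exact: cintbleZ.
    by apply: eq_bigr => j _ /=; rewrite cintegralZ// mulrC.
  by apply: eq_cintegral => g; rewrite /phi mulr_sumr; apply: eq_bigr => j _; ring.
have phi1 k x (g : T) : cabs (F g * phi k x g) <= cabs (F g).
  have [Ag|nAg] := pselect (A (vec_of g)); last by rewrite F0// mul0r.
  by have [j cj] := cover k g Ag; rewrite (phiE _ _ _ _ Ag cj) cabsM cabs_ez mulr1.
have mphi k x : cmeasurable (fun g => F g * phi k x g).
  apply: cmeasurableM => //; apply: cmeasurable_sum => j; apply: cmeasurableM.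
    exact: cmeasurable_cind.
  exact: cmeasurable_cst.
exists s, (rI leb (fun g => cabs (F g))); split.
- move=> k _ /mapP[j _ ->] /=; rewrite /qt; case: ifP => // /asboolP //.
- move=> k x; rewrite tpE; apply: le_trans (cabs_cintegral _) _.
    by apply: cintble_le (mphi k x) (phi1 k x) (cintble_cabs iF).
  apply: rI_le => //; last exact: cintble_cabs.
  by apply: cintble_cabs; apply: cintble_le (mphi k x) (phi1 k x) (cintble_cabs iF).
move=> x; under eq_fun do rewrite tpE.
apply: (@ccvg_dominated _ _ _ _ _ (fun g => cabs (F g))) => //.
- by apply: cintble_measurable; exact: cintble_ez.
- move=> g; have [Ag|nAg] := pselect (A (vec_of g)); last first.
    by rewrite F0//; under eq_fun do rewrite mul0r; rewrite mul0r; exact: ccvg_cst.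
  apply: ccvgM; first exact: ccvg_cst.
  pose C := 2 * pi * n.+1%:R * `|x| : R.
  apply: (@ccvg_squeeze _ _ _ (fun k => C * k.+1%:R^-1)).
    move=> k; have [j cj] := cover k g Ag; rewrite (phiE _ _ _ _ Ag cj) !(ezC x).
    apply: le_trans (ez_lip _ _ _) _.
    rewrite /C -!mulrA ler_pM2l// ler_wpM2l ?pi_ge0// ler_wpM2l// mulrC ler_wpM2l//.
    apply: le_trans (near_pt _ _ _ cj) _; rewrite lef_pV2 ?posrE// ler_nat ltnS.
    exact: leq_addl.
  rewrite -[X in _ --> X](mulr0 C); apply: cvgM; first exact: cvg_cst.
  exact: cvg_harmonic.
- by move=> g; rewrite cabsM cabs_ez mulr1.
- exact: cintble_cabs.
Qed.

End transfer.

(** * Symmetric convex sets: null or with interior *)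

Section convex_body.
Context {R : realType} {n : nat}.
Local Notation T := (@Rd R n.+1).
Local Notation V := 'rV[R]_n.+1.
Implicit Types (A : set V).
Notation leb := (@lebesgue_d R n.+1).

Lemma compact_nball A : compact A -> exists2 L : R, 0 < L & A `<=` nball L.
Proof.
move=> /compact_bounded [M [_ hM]]; exists (`|M| + 1); first by rewrite ltr_wpDl.
by move=> x Ax; apply: (hM (`|M| + 1)) => //; rewrite ltr_pwDr// ler_norm.
Qed.

(** The inequality between the radii is strict because the cube is half-open. *)
Lemma nball_Q (L L' : R) : L < L' -> nball L `<=` (Q L' : set V).
Proof.
move=> LL x Lx; apply/QE => i; have := nball_coord i Lx.
by rewrite ler_norml => /andP[h1 h2]; apply/andP; split; rewrite /vec_of; lra.
Qed.

(** A large cube contains A and so has positive measure; a dilation carries it to [Q L]. *)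
Lemma leb_Q_gt0 A (L : R) : compact A -> (0 < leb (A : set T))%E -> 0 < L ->
  0 < fine (leb (Q L)).
Proof.
move=> cA vA L0; rewrite -lte_fin fineK; last first.
  by rewrite ge0_fin_numE ?leb_Q_fin ?leb_ge0.
have [M M0 AM] := compact_nball cA.
have AQ : (0 < leb (Q (M + 1)))%E.
  by apply: lt_le_trans vA (leb_mono _) => x /AM; apply: nball_Q; rewrite ltrDl.
have c0 : 0 < (M + 1) / L by rewrite divr_gt0// addr_gt0.
move: AQ; rewrite -(leb_dilate _ c0).
rewrite (_ : dilatev _ @^-1` _ = Q L); first by rewrite pmule_rgt0// lte_fin exprn_gt0.
have e (x : T) i : (- (M + 1) <= vec_of (dilatev ((M + 1) / L) x) ord0 i < M + 1) =
    (- L <= vec_of x ord0 i < L).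
  rewrite /dilatev /vec_of mxE -[X in - X <= _](divfK (lt0r_neq0 L0)) -[X in _ < X](divfK (lt0r_neq0 L0)).
  by rewrite -mulrN ler_pM2l// ltr_pM2l.
by apply/seteqP; split => x hx; apply/QE => i; move/QE : hx => /(_ i); rewrite e.
Qed.

(** Two points of A differing by a positive multiple of e_i would, by symmetry and convexity, put
    half that multiple into A. So the translates of A by the vectors e_i / (k + 1), taken with
    either sign, are disjoint; infinitely many sets of equal measure in one bounded cube are
    null. *)
Lemma thin_null A : measurable (A : set T) -> compact A -> is_convex A -> is_symmetric A ->
  (exists i : 'I_n.+1, forall s : R, 0 < s -> ~ A (s *: delta_mx 0 i)) -> leb (A : set T) = 0.
Proof.
move=> mA cA vA sA [i hi]; pose e : V := delta_mx 0 i.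
have [L L0 AL] := compact_nball cA.
have disj (s s' : R) (x : V) : s < s' -> A (x + s *: e) -> A (x + s' *: e) -> False.
  move=> ss A1 A2; apply: (hi ((s' - s) / 2)); first by rewrite divr_gt0// subr_gt0.
  have h : (0 <= 2^-1 :> R) && (2^-1 <= 1 :> R) by rewrite invr_ge0 ler0n invf_le1 ?ler1n.
  have := vA _ _ _ A2 (sA _ A1) h; congr A.
  rewrite (_ : 1 - 2^-1 = 2^-1 :> R); last by field.
  by rewrite -scalerDr opprD addrACA subrr add0r -scalerBl scalerA mulrC.
pose F k : set T := shiftv (k.+1%:R^-1 *: e) @^-1` (A : set T).
have mF k : measurable (F k).
  by rewrite -[F k]setTI; exact: (measurable_shift _ measurableT).
have FQ k : F k `<=` (Q (L + 2) : set T).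
  move=> x Fx; apply: (@nball_Q (L + 1)); first by rewrite ltrD2l; lra.
  rewrite /nball /= -[x](addrK (k.+1%:R^-1 *: e)); apply: le_trans (ler_normB _ _) _.
  apply: lerD; first exact: AL Fx.
  apply: norm_le_coord => j; rewrite !mxE eqxx /= normrM.
  rewrite mulr_ile1// ?ger0_norm ?invr_ge0 ?invf_le1 ?ler1n//.
  by case: (j == i).
have tF : trivIset setT F.
  apply/trivIsetP => k k' _ _ kk'; apply/seteqP; split => // x [h h'].
  case: (ltgtP (k.+1%:R^-1 : R) k'.+1%:R^-1) => [lt|lt|].
  - exact: disj lt h h'.
  - exact: disj lt h' h.
  - by move/invr_inj/eqP; rewrite eqr_nat eqSS (negPf kk').
have vf : leb (A : set T) \is a fin_num.
  rewrite ge0_fin_numE ?leb_ge0//; apply: le_lt_trans (leb_Q_fin (L + 2)); apply: leb_mono.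
  by move=> x /AL; apply: nball_Q; rewrite ltrDl.
have qf : leb (Q (L + 2)) \is a fin_num by rewrite ge0_fin_numE ?leb_ge0 ?leb_Q_fin.
have lK (K : nat) : K%:R * fine (leb (A : set T)) <= fine (leb (Q (L + 2))).
  rewrite -lee_fin (fineK qf); have := measure_bigsetU leb mF tF K.
  rewrite (eq_bigr (fun=> (fine (leb (A : set T)))%:E)) => [|k _]; last first.
    by rewrite fineK//; exact: leb_shift.
  rewrite sumEFin sumr_const card_ord mulr_natl => <-; apply: leb_mono.
  by rewrite -bigcup_mkord => x [k _]; exact: FQ.
have a0 : 0 <= fine (leb (A : set T)) by apply: fine_ge0; exact: leb_ge0.
rewrite -(fineK vf).
move: (fine (leb (A : set T))) a0 (fine (leb (Q (L + 2)))) lK => a a0 q lK.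
congr EFin; apply/eqP; rewrite eq_le a0 andbT leNgt; apply/negP => a1.
have q0 : 0 <= q / a by rewrite divr_ge0 ?(ltW a1)//; have := lK 0%N; rewrite mul0r.
have := archi_boundP q0; rewrite ltr_pdivrMr// ltNge; apply/negP; rewrite negbK.
exact: lK.
Qed.

(** x is the mean of the n.+1 vectors (n.+1) x_i e_i. When |x| <= min s_i / n.+1, each of them lies
    between 0 and s_i e_i or its opposite. *)
Lemma fat_ball A : is_convex A -> is_symmetric A -> A 0 ->
  (forall i : 'I_n.+1, exists2 s : R, 0 < s & A (s *: delta_mx 0 i)) ->
  exists2 rho : R, 0 < rho & nball rho `<=` A.
Proof.
move=> vA sA A0 h; have [s hs] : {s : 'I_n.+1 -> R & forall i, 0 < s i /\ A (s i *: delta_mx 0 i)}.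
  apply: (@boolp.choice _ _ (fun (i : 'I_n.+1) (s : R) => 0 < s /\ A (s *: delta_mx 0 i))) => i.
  by have [s s0 As] := h i; exists s.
pose m := \big[Num.min/1]_i s i.
have m0 : 0 < m by rewrite /m; apply: lt_bigmin => [|i _]; [exact: ltr01|case: (hs i)].
exists (m / n.+1%:R); first by rewrite divr_gt0.
move=> x xr.
have Ai i : A ((n.+1%:R * x ord0 i) *: delta_mx 0 i).
  have [si Asi] := hs i.
  have xi : `|n.+1%:R * x ord0 i / s i| <= 1.
    rewrite normrM (gtr0_norm (x := (s i)^-1)) ?invr_gt0// ler_pdivrMr// mul1r.
    apply: (@le_trans _ _ m); last exact: bigmin_le.
    have := nball_coord i xr; rewrite ler_pdivlMr// => xr'.
    by rewrite normrM normr_nat mulrC.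
  have seg (a : V) (c : R) : A a -> 0 <= c -> c <= 1 -> A (c *: a).
    move=> Aa c0 c1; have c01 : 0 <= c <= 1 by rewrite c0.
    by have := vA _ _ _ Aa A0 c01; rewrite scaler0 addr0.
  rewrite (_ : _ *: _ = (n.+1%:R * x ord0 i / s i) *: (s i *: delta_mx 0 i)); last first.
    by rewrite scalerA divfK// gt_eqF.
  move: xi; have [c0|c0] := leP 0 (n.+1%:R * x ord0 i / s i).
    by rewrite ger0_norm// => c1; exact: seg.
  rewrite ltr0_norm// => c1; rewrite -[_ *: (s i *: _)]opprK -scaleNr -scalerN; apply: seg => //.
  - exact: sA.
  - by rewrite oppr_ge0 ltW.
have aux (r : seq 'I_n.+1) : dil ((size r)%:R * n.+1%:R^-1) A (\sum_(i <- r) x ord0 i *: delta_mx 0 i).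
  elim: r => [|i r ih].
    by rewrite big_nil mul0r; exists 0 => //; rewrite scaler0.
  rewrite big_cons /= -(natr1 (size r)) mulrDl mul1r [X in dil X](addrC); apply: dilD => //; rewrite ?mulr_ge0//.
  by exists ((n.+1%:R * x ord0 i) *: delta_mx 0 i) => //; rewrite scalerA mulKf.
rewrite -(dil1 A) [x in dil _ _ x]row_sum_delta.
have := aux (index_enum _).
by rewrite /index_enum -enumT size_enum_ord divff ?pnatr_eq0.
Qed.

End convex_body.

(** * Square sums of Paley-Wiener functions *)

Section frame.
Context {R : realType} {n : nat}.
Local Notation T := (@Rd R n.+1).
Local Notation V := 'rV[R]_n.+1.
Implicit Types (A E S : set V).
Notation leb := (@lebesgue_d R n.+1).

Lemma spec_hV_flip (rho : R) (y : V) : 0 < rho ->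
  spec (nball (n.+1%:R * rho)) (fun x => hV rho (y - x)).
Proof.
move=> r0; under eq_fun do rewrite -scaleN1r.
apply: spec_affine (spec_hV r0) => a; rewrite /nball /=.
by rewrite scaleN1r normrN.
Qed.

Definition separated (delta : R) S := forall x y, S x -> S y -> x != y -> delta <= `|x - y|.

Definition PWF A (F : T -> R[i]) := L2 F /\ forall g, ~ A (vec_of g) -> F g = 0.

Lemma spec_PWF A (B : set V) (L r : R) F : 0 < L -> A `<=` nball L -> PWF A F ->
  B 0 -> 0 < r -> (forall a v, A a -> `|v| <= r -> B (a + v)) -> spec B (ft F).
Proof.
move=> L0 AL [L2F F0] B0 r0 hB.
have iF : cintble leb F.
  apply: (@L2_cintble _ _ (L + 1)) => // g gQ; apply: F0 => /AL h; apply: gQ.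
  by apply: nball_Q h; rewrite ltrDl.
by apply: spec_ft iF F0 L0 AL B0 r0 hB.
Qed.

Lemma upper_bound A S (L delta : R) : 0 < L -> A `<=` nball L -> 0 < delta -> separated delta S ->
  (forall L', 0 < L' -> 0 < fine (leb (Q L'))) ->
  exists2 C : R, 0 < C & forall F ys, PWF A F -> uniq ys -> (forall y, y \in ys -> S y) ->
    \sum_(y <- ys) cabs2 (ft F y) <= C * nrm2 F.
Proof.
move=> L0 AL d0 sep vol.
(* The radius budget: L for A, L for the room that [spec_PWF] requires around it, L for the
   kernel. *)
have L30 : 0 < 3 * L by rewrite mulr_gt0.
have [B B0 bern] := @bernstein R n (3 * L) L30 (vol _ L30).
(* The term 2 B makes the lattice fine enough for [lattice_samp]; the term 2 L puts A inside [Q r],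
   where Bessel's inequality applies. *)
pose r := 2 * B + 2 * L; have r0 : 0 < r by rewrite addr_gt0// mulr_gt0.
have smp : samp (nball (3 * L) : set V) (lat r) 4^-1.
  by apply: lattice_samp B0 _ bern => //; rewrite lerDl mulr_ge0// ltW.
have rho0 : 0 < L / n.+1%:R by rewrite divr_gt0.
have q0 : 0 < 4^-1 :> R by rewrite invr_gt0.
have [C C0 hC] := sampled_energy q0 rho0 d0 smp.
exists (C * fine (leb (Q r))) => [|F ys PF uys yS]; first by rewrite mulr_gt0 ?vol.
rewrite -mulrA; apply: hC => //.
- move=> y; apply: (@specM _ _ (nball (2 * L)) (nball (n.+1%:R * (L / n.+1%:R)))).
  + move=> a b; rewrite /nball /= (mulrC n.+1%:R) divfK// => h1 h2.
    by apply: le_trans (ler_normD _ _) _; lra.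
  + apply: (spec_PWF L0 AL PF _ L0); first by rewrite /nball /= normr0 mulr_ge0// ltW.
    by move=> a v /AL; rewrite /nball /= => h1 h2; apply: le_trans (ler_normD _ _) _; lra.
  + exact: spec_hV_flip.
- move=> xs uxs xl; case: PF => L2F F0; apply: bessel => //; first exact: vol.
  move=> g gQ; apply: F0 => /AL h; apply: gQ; apply: nball_Q h.
  by rewrite /r; lra.
- by move=> y y' /yS Sy /yS Sy'; exact: sep.
Qed.

Lemma lat_separated (L : R) : 0 < L -> separated (2 * L)^-1 (lat L).
Proof.
move=> L0 x y lx ly xy; have L20 : 0 < 2 * L by rewrite mulr_gt0.
have [i xyi] : exists i, x ord0 i != y ord0 i.
  apply/existsP; apply: contraNT xy; rewrite negb_exists => /forallP h.
  by apply/eqP/rowP => i; apply/eqP; have := h i; rewrite negbK.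
apply: le_trans (le_coord_norm _ i); rewrite !mxE.
have [m xm] := lx i; have [k yk] := ly i; move: xyi; rewrite xm yk => xyi.
rewrite -mulrBl normrM (gtr0_norm (x := _^-1)) ?invr_gt0// ler_peMl ?invr_ge0 ?(ltW L20)//.
rewrite -intrB -intr_norm ler1z -gtz0_ge1 normr_gt0 subr_eq0.
by apply: contraNneq xyi => ->.
Qed.

Definition comb (F : T -> R[i]) : T -> R[i] := fun g => F g + F (dilatev 2 g) + F (dilatev 3 g).

(** The Jacobian factor that [ft] picks up when its density is dilated by k. *)
Definition cfac (k : R) : R[i] := ((k ^- n.+1)%:C)%C.
Definition combt (f : V -> R[i]) : V -> R[i] := fun x =>
  f x + cfac 2 * f (2^-1 *: x) + cfac 3 * f (3^-1 *: x).

Lemma ft_dilate (F : T -> R[i]) (k : R) x : 0 < k -> cintble leb F ->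
  ft (fun g => F (dilatev k g)) x = cfac k * ft F (k^-1 *: x).
Proof.
move=> k0 iF; have ih := cintble_ez (k^-1 *: x) iF.
rewrite [ft F _]/ft -(cintegral_dilate k0 ih) mulrA /cfac -rmorphM /=.
rewrite mulVf ?mul1r; last by rewrite expf_neq0// gt_eqF.
apply: eq_cintegral => g; congr (_ * _).
by rewrite /dilatev /vec_of -ezZ scalerA divff ?scale1r// gt_eqF.
Qed.

Lemma cintble_dilate (F : T -> R[i]) (k : R) : 0 < k -> cintble leb F ->
  cintble leb (fun g => F (dilatev k g)).
Proof. by move=> k0 [i1 i2]; split; [exact: integrable_dilate k0 i1|exact: integrable_dilate k0 i2]. Qed.

Lemma L2_dilate (F : T -> R[i]) (k : R) : 0 < k -> L2 F -> L2 (fun g => F (dilatev k g)).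
Proof.
move=> k0 [[m1 m2] iF]; split; last exact: integrable_dilate k0 iF.
by split; [apply: measurableT_comp m1 _|apply: measurableT_comp m2 _]; exact: measurable_dilate.
Qed.

Lemma nrm2_dilate (F : T -> R[i]) (k : R) : 1 <= k -> L2 F -> nrm2 (fun g => F (dilatev k g)) <= nrm2 F.
Proof.
move=> k1 LF; have k0 : 0 < k by apply: lt_le_trans k1.
have := integral_dilate k0 LF.2 => /(congr1 fine).
rewrite fineM//; last by apply: integrable_fin_num => //; exact: (L2_dilate k0 LF).2.
move=> e; rewrite [leRHS]/nrm2 /rI -[leRHS]e ler_peMl//; first exact: nrm2_ge0.
by rewrite exprn_ege1.
Qed.

Lemma L2_comb F : L2 F -> L2 (comb F).
Proof. by move=> LF; do ![apply: L2D => //]; exact: L2_dilate. Qed.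

Lemma nrm2_comb F : L2 F -> nrm2 (comb F) <= 9 * nrm2 F.
Proof.
move=> LF; have L2F := L2_dilate (ltr0n R 2) LF; have L3F := L2_dilate (ltr0n R 3) LF.
have n2 := nrm2_dilate (ler1n R 2) LF; have n3 := nrm2_dilate (ler1n R 3) LF.
have i2 := rintbleD (rintbleD LF.2 L2F.2) L3F.2.
apply: (@le_trans _ _ (3 * (nrm2 F + nrm2 (fun g => F (dilatev 2 g)) + nrm2 (fun g => F (dilatev 3 g))))).
  rewrite -rID; [|exact: LF.2|exact: L2F.2].
  rewrite -rID; [|exact: rintbleD LF.2 L2F.2|exact: L3F.2].
  rewrite -rIZ//; apply: rI_le; [exact: (L2_comb LF).2|exact: rintbleZl|].
  by move=> x; exact: cabs2D3.
by lra.
Qed.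

Lemma ft_comb F x : cintble leb F -> ft (comb F) x = combt (ft F) x.
Proof.
move=> iF; have i2 := cintble_dilate (ltr0n R 2) iF; have i3 := cintble_dilate (ltr0n R 3) iF.
rewrite /combt -!ft_dilate// /ft -cintegralD; [|exact: cintble_ez|exact: cintble_ez].
rewrite -cintegralD; [|by apply: cintbleD; exact: cintble_ez|exact: cintble_ez].
by apply: eq_cintegral => g; rewrite /comb !mulrDl.
Qed.

Lemma lower_bound A E (L rho eps eta : R) : 0 < L -> A `<=` nball L -> is_convex A ->
  0 < rho -> nball rho `<=` A -> 0 < eps -> 0 < eta -> samp (dil (1 + eps) A) E eta ->
  (forall L', 0 < L' -> 0 < fine (leb (Q L'))) ->
  exists2 C : R, 0 < C & forall F K, PWF A F ->
    (forall xs, uniq xs -> (forall x, x \in xs -> E x) ->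
       \sum_(x <- xs) cabs2 (combt (ft F) x) <= K) ->
    nrm2 (comb F) <= C * K.
Proof.
move=> L0 AL vA rho0 rA eps0 eta0 smp vol.
have L20 : 0 < 2 * L by rewrite mulr_gt0.
have A0 : A 0 by apply: rA; rewrite /nball /= normr0 ltW.
(* The available eps is halved: one part is the room around A needed to approximate [ft F], the
   other holds the spectrum of the kernel. *)
pose e := eps / 2; have e0 : 0 < e by rewrite divr_gt0.
have rho'0 : 0 < e * rho / n.+1%:R by rewrite divr_gt0// mulr_gt0.
have d0 : 0 < (2 * (2 * L))^-1 by rewrite invr_gt0 mulr_gt0.
have [C C0 hC] := sampled_energy eta0 rho'0 d0 smp.
have v0 := vol _ L20.
exists (C / fine (leb (Q (2 * L)))) => [|F K PF hK]; first by rewrite divr_gt0.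
have [L2F F0] := PF.
have oF : offQ (2 * L) F.
  by move=> g gQ; apply: F0 => /AL h; apply: gQ; apply: nball_Q h; lra.
have oG : offQ (2 * L) (comb F).
  have big (k : R) (g : T) : 1 <= k -> ~ Q (2 * L) g -> F (dilatev k g) = 0.
    move=> k1 gQ; apply: F0 => /AL h; apply: gQ.
    have k0 : 0 < k by apply: lt_le_trans k1.
    apply: (@nball_Q _ _ L); first lra.
    move: h; rewrite /nball /= /dilatev /vec_of normrZ gtr0_norm// => h.
    by apply: le_trans h; rewrite ler_peMl.
  by move=> g gQ; rewrite /comb oF// !big ?addr0// ler1n.
have iF := L2_cintble L2F oF.
rewrite mulrAC ler_pdivlMr// mulrC; apply: parseval => //; first exact: L2_comb.
move=> ks uks kl.
rewrite (eq_bigr (fun k => cabs2 (combt (ft F) k))) => [|k _]; last by rewrite ft_comb.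
apply: hC => //; last by move=> y y' /kl ly /kl ly'; exact: lat_separated.
move=> y; apply: (@specM _ _ (dil (1 + e) A) (nball (n.+1%:R * (e * rho / n.+1%:R)))).
- move=> a b ha hb; have hb' : dil e A b.
    by apply: (nball_dil rA e0); move: hb; rewrite mulrC divfK.
  have := dilD vA _ (ltW e0) ha hb'; rewrite (_ : 1 + e + e = 1 + eps); last by rewrite /e; lra.
  by apply; lra.
- have sf : spec (dil (1 + e) A) (ft F).
    apply: (spec_PWF (r := e * rho) L0 AL PF) => //.
    + by exists 0 => //; rewrite scaler0.
    + by rewrite mulr_gt0.
    + move=> a v Aa hv; apply: dilD => //; [by rewrite ltW|by rewrite dil1|].
      by apply: nball_dil hv.
  have sc (k : R) : 1 <= k -> spec (dil (1 + e) A) (fun x => ft F (k^-1 *: x)).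
    move=> k1; have k0 : 0 < k by apply: lt_le_trans k1.
    under eq_fun do rewrite -[_ *: _]add0r.
    apply: spec_affine sf => a ha; have e1 : 0 <= 1 + e by lra.
    apply: (@dil_mono _ _ _ (k^-1 * (1 + e))) => //.
    + by rewrite mulr_ge0// invr_ge0 ltW.
    + by rewrite ler_piMl// invf_le1.
    + by apply: dil_dil; exists a.
  apply: (@specD _ _ _ (fun x => ft F x + cfac 2 * ft F (2^-1 *: x))).
    by apply: (specD sf); apply: specZ; apply: sc; rewrite ler1n.
  by apply: specZ; apply: sc; rewrite ler1n.
- exact: spec_hV_flip.
Qed.

End frame.

(** The passage from sums over finite duplicate-free lists, in which all the estimates are stated,
    to [\esum] and back. *)
Lemma esqrt_esum {R : realType} {V : choiceType} (E : set V) (a : V -> R) (C : R) :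
  (forall x, 0 <= a x) ->
  (forall xs, uniq xs -> (forall x, x \in xs -> E x) -> \sum_(x <- xs) a x <= C) ->
  exists s : R, [/\ 0 <= s, esqrt (\esum_(x in E) (a x)%:E)%E = s%:E, s ^+ 2 <= C &
    forall xs, uniq xs -> (forall x, x \in xs -> E x) -> \sum_(x <- xs) a x <= s ^+ 2].
Proof.
move=> a0 aC; set S := (\esum_(x in E) _)%E.
have S0 : (0 <= S)%E by apply: esum_ge0 => x _; rewrite lee_fin.
have SC : (S <= C%:E)%E.
  apply: ge_ereal_sup => _ [X [finX XE] <-].
  rewrite fsbig_finite// sumEFin lee_fin; apply: aC; first exact: fset_uniq.
  by move=> x; rewrite in_fset_set// inE => /XE.
have Sf : S \is a fin_num by rewrite ge0_fin_numE// (le_lt_trans SC)// ltry.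
have s2 : Num.sqrt (fine S) ^+ 2 = fine S by rewrite sqr_sqrtr// fine_ge0.
exists (Num.sqrt (fine S)); rewrite s2; split.
- exact: sqrtr_ge0.
- by rewrite -(fineK Sf).
- by rewrite -lee_fin fineK.
move=> xs uxs xE; rewrite -lee_fin fineK// -sumEFin fsbig_seq//.
apply: esum_ge; exists [set` xs]; last exact: lexx.
by split; [exact: finite_seq|move=> x /= /xE].
Qed.

(** * The two frame inequalities *)

Section main.
Context {R : realType} {n : nat}.
Local Notation T := (@Rd R n.+1).
Local Notation V := 'rV[R]_n.+1.
Implicit Types (A E S : set V).
Notation leb := (@lebesgue_d R n.+1).

Lemma cintegral_mkcond (D : set T) (h : T -> R[i]) : (forall g, ~ D g -> h g = 0) ->
  cintegral leb D h = cintegral leb setT h.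
Proof.
move=> h0; rewrite /cintegral; congr (fine _ +i* fine _)%C;
  rewrite integral_mkcond; apply: eq_integral => g _; rewrite patchE;
  by case: ifPn => // /negP; rewrite inE => /h0 ->.
Qed.

Lemma PW_fun_null A (F : V -> R[i]) x : measurable (A : set T) -> leb (A : set T) = 0 ->
  PW_F A F -> PW_fun A F x = 0.
Proof.
move=> mA A0 [mF _ _].
have [m1 m2] : cmeasurable (fun g : T => F (vec_of g) * ez x (vec_of g)).
  by apply: cmeasurableM => //; exact: cmeasurable_ez.
rewrite /PW_fun /cintegral !null_set_integral//.
- by apply/measurable_EFinP; exact: measurable_funS m2.
- by apply/measurable_EFinP; exact: measurable_funS m1.
Qed.

Lemma PW_F_PWF A (F : V -> R[i]) : measurable (A : set T) -> PW_F A F ->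
  [/\ PWF A (fun g : T => F (vec_of g)),
    (\int[leb]_(g in (A : set T)) (cabs2 (F (vec_of g)))%:E)%E = (nrm2 (fun g : T => F (vec_of g)))%:E
    & forall x, PW_fun A F x = ft (fun g : T => F (vec_of g)) x].
Proof.
move=> mA [mF F0 iF].
have e : (\int[leb]_(g in (A : set T)) (cabs2 (F (vec_of g)))%:E =
    \int[leb]_g (cabs2 (F (vec_of g)))%:E)%E.
  rewrite integral_mkcond; apply: eq_integral => g _; rewrite patchE.
  by case: ifPn => // /negP; rewrite inE => /F0 ->; rewrite cabs20.
have L2F : L2 (fun g : T => F (vec_of g)).
  split => //; apply/integrableP; split; first by apply/measurable_EFinP; exact: measurable_cabs2.
  rewrite e in iF; apply: le_lt_trans iF; rewrite le_eqVlt; apply/orP; left; apply/eqP.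
  by apply: eq_integral => g _ /=; rewrite ger0_norm// cabs2_ge0.
split; first by split.
- by rewrite e /nrm2 /rI fineK//; apply: integrable_fin_num => //; exact: L2F.2.
- by move=> x; apply: cintegral_mkcond => g /F0 ->; rewrite mul0r.
Qed.

Lemma frame_inequalities E A : is_separated E -> compact A -> is_convex A -> is_symmetric A ->
  balayage E A ->
  exists a b : R, [/\ 0 < a, 0 < b &
    forall F : V -> R[i], PW_F A F ->
    let f := PW_fun A F in
    f <> (fun=> 0) ->
    let normF2 := (\int[leb]_(g in (A : set T)) (cabs2 (F (vec_of g)))%:E)%E in
    let num := (\int[leb]_(g in (A : set T))
         (cabs2 (F (vec_of g) + F (2 *: vec_of g) + F (3 *: vec_of g)))%:E)%E in
    let S (k : R) := esqrt (\esum_(x in E) (cabs2 (f (k^-1 *: x)))%:E)%E in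
    let mid := (S 1%R + (2^-1)%:E * S 2%R + (3^-1)%:E * S 3%R)%E in
    ((Num.sqrt a)%:E * num * ((Num.sqrt (fine normF2))^-1)%:E <= mid)%E /\
    (mid <= (Num.sqrt b)%:E * esqrt normF2)%E].
Proof.
move=> sepE cA vA sA bal.
have clA : closed A by apply: compact_closed => //; exact: norm_hausdorff.
have mA : measurable (A : set T) by exact: measurable_closed.
have [A0|nA0] := eqVneq (leb (A : set T)) 0%E.
  exists 1, 1; split => // F PF f f0; exfalso; apply: f0; apply/funext => x.
  exact: PW_fun_null.
have vA0 : (0 < leb (A : set T))%E by rewrite lt_neqAle eq_sym nA0 leb_ge0.
have vol (L : R) : 0 < L -> 0 < fine (leb (Q L)) by exact: leb_Q_gt0 cA vA0.
have [rho rho0 rA] : exists2 rho : R, 0 < rho & nball rho `<=` A.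
  have fat (i : 'I_n.+1) : exists2 s : R, 0 < s & A (s *: delta_mx 0 i).
    apply: contrapT => h; move/eqP: nA0; apply; apply: thin_null => //.
    by exists i => s s0 As; apply: h; exists s.
  apply: fat_ball => //.
  have [s s0 As] := fat ord0.
  have h : (0 <= 2^-1 :> R) && (2^-1 <= 1 :> R) by rewrite invr_ge0 ler0n invf_le1 ?ler1n.
  have := vA _ _ _ As (sA _ As) h; congr A.
  rewrite (_ : 1 - 2^-1 = 2^-1 :> R); last by field.
  by rewrite scalerN subrr.
have [L L0 AL] := compact_nball cA.
have [eta eta0 smp] := balayage_samp sepE sA bal.
have L20 : 0 < 2 * L by rewrite mulr_gt0.
have [eps [eps0 _ smp']] := samp_extension rho0 L0 (vol _ L20) vA rA AL eta0 smp.
have eta40 : 0 < eta / 4 by rewrite divr_gt0.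
have [C C0 hlow] := lower_bound L0 AL vA rho0 rA eps0 eta40 smp' vol.
have [delta [d0 sep]] := sepE.
have up (k : R) : 0 < k -> exists2 D : R, 0 < D & forall F xs, PWF A F -> uniq xs ->
    (forall x, x \in xs -> E x) -> \sum_(x <- xs) cabs2 (ft F (k^-1 *: x)) <= D * nrm2 F.
  move=> k0; pose S : set V := [set y | E (k *: y)].
  have sepS : separated (delta / k) S.
    move=> x y Ex Ey xy; rewrite ler_pdivrMr// mulrC -[X in X * _](gtr0_norm k0) -normrZ scalerBr.
    apply: sep => //; apply: contra_neq xy => /(congr1 (fun z => k^-1 *: z)).
    by rewrite !scalerA mulVf ?scale1r// gt_eqF.
  have dk0 : 0 < delta / k by rewrite divr_gt0.
  have [D D0 hD] := upper_bound L0 AL dk0 sepS vol.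
  exists D => // F xs PF uxs xE; rewrite -(big_map (fun x => k^-1 *: x) xpredT (fun y => cabs2 (ft F y))).
  apply: hD => //.
    rewrite map_inj_uniq// => x y /(congr1 (fun z => k *: z)).
    by rewrite !scalerA divff ?scale1r// gt_eqF.
  by move=> _ /mapP[x /xE Ex ->]; rewrite /S /= scalerA divff ?scale1r// gt_eqF.
have [D1 D10 h1] := up 1 ltr01.
have [D2 D20 h2] := up 2 (ltr0n R 2).
have [D3 D30 h3] := up 3 (ltr0n R 3).
pose D := D1 + D2 + D3.
(* 27 = 9 * 3 combines the two bounds on [nrm2 (comb F')]; 4 is the square of 2, which dominates 1 +
   1/2 + 1/3. *)
exists (27 * C)^-1, (4 * D); split.
- by rewrite invr_gt0 mulr_gt0.
- by rewrite mulr_gt0// !addr_gt0.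
move=> F PF f _; have [PWf normE fE] := PW_F_PWF mA PF.
set F' := (fun g : T => F (vec_of g)) in PWf normE fE.
move=> normF2 num S mid; pose N := nrm2 F'.
have N0 : 0 <= N by exact: nrm2_ge0.
have -> : normF2 = N%:E by [].
have L2F : L2 F' by case: PWf.
have Sx (k D' : R) : D' <= D -> (forall F xs, PWF A F -> uniq xs ->
    (forall x, x \in xs -> E x) -> \sum_(x <- xs) cabs2 (ft F (k^-1 *: x)) <= D' * nrm2 F) ->
    exists s : R, [/\ 0 <= s, S k = s%:E, s ^+ 2 <= D * N & forall xs, uniq xs ->
      (forall x, x \in xs -> E x) -> \sum_(x <- xs) cabs2 (ft F' (k^-1 *: x)) <= s ^+ 2].
  move=> DD hk; have [|xs uxs xE|s [s0 sE sC sxs]] :=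
    @esqrt_esum R _ E (fun x => cabs2 (ft F' (k^-1 *: x))) (D * N).
  - by move=> x; exact: cabs2_ge0.
  - by apply: le_trans (hk _ _ PWf uxs xE) _; rewrite ler_wpM2r.
  - by exists s; split => //; rewrite -sE /S; congr esqrt; apply: eq_esum => x _; rewrite /f fE.
have [|s1 [s10 s1E s1D s1x]] := Sx _ _ _ h1; first by rewrite /D; lra.
have [|s2 [s20 s2E s2D s2x]] := Sx _ _ _ h2; first by rewrite /D; lra.
have [|s3 [s30 s3E s3D s3x]] := Sx _ _ _ h3; first by rewrite /D; lra.
pose m := s1 + 2^-1 * s2 + 3^-1 * s3.
have midE : mid = m%:E by rewrite /mid s1E s2E s3E.
have m0 : 0 <= m by rewrite /m; lra.
rewrite midE; split; last first.
  rewrite /= -EFinM lee_fin -sqrtrM; last by rewrite mulr_ge0// /D; lra.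
  rewrite -[leLHS]ger0_norm// -sqrtr_sqr; apply: ler_wsqrtr.
  have h (s : R) : 0 <= s -> s ^+ 2 <= D * N -> s <= Num.sqrt (D * N).
    by move=> s0 sD; rewrite -[s]ger0_norm// -sqrtr_sqr; exact: ler_wsqrtr.
  have q0 := sqrtr_ge0 (D * N).
  have q2 : Num.sqrt (D * N) ^+ 2 = D * N.
    by rewrite sqr_sqrtr// mulr_ge0// /D; lra.
  rewrite (_ : 4 * D * N = (2 * Num.sqrt (D * N)) ^+ 2); last by rewrite exprMn q2; ring.
  apply: lerXn2r; rewrite ?nnegrE//.
  have := h _ s10 s1D; have := h _ s20 s2D; have := h _ s30 s3D; rewrite /m; lra.
have numle : (0 <= num <= (nrm2 (comb F'))%:E)%E.
  rewrite /num integral_mkcond; apply/andP; split.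
    apply: integral_ge0 => g _; rewrite patchE; case: ifP => // _.
    by rewrite lee_fin cabs2_ge0.
  have [mG iG] := L2_comb L2F.
  rewrite /nrm2 /rI fineK; last exact: integrable_fin_num.
  apply: ge0_le_integral => //.
  - by move=> g _; rewrite patchE; case: ifP => // _; rewrite lee_fin cabs2_ge0.
  - apply/(measurable_restrictT _ mA); apply/measurable_EFinP.
    exact: measurable_funS (measurable_cabs2 mG).
  - by apply/measurable_EFinP; exact: measurable_cabs2.
  - move=> g _; rewrite patchE; case: ifP => _; first by [].
    by rewrite lee_fin cabs2_ge0.
have numf : num \is a fin_num.
  by case/andP: numle => a b; rewrite ge0_fin_numE// (le_lt_trans b)// ltry.
rewrite -(fineK numf) -!EFinM lee_fin.
pose G := nrm2 (comb F').
have [nu0 nuG] : 0 <= fine num /\ fine num <= G.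
  by case/andP: numle => a b; split; [exact: fine_ge0|rewrite -lee_fin fineK].
have G9 : G <= 9 * N by exact: nrm2_comb.
have GC : G <= C * (3 * m ^+ 2).
  apply: hlow => // xs uxs xE.
  (* The exponent n.+1 being at least 1, the Jacobian factor is at most 1 / k, the weight with which
     the sum over f (x / k) enters m. *)
  have c2 (k : R) (z : R[i]) : 1 <= k -> cabs2 (@cfac R n k * z) <= k^-1 ^+ 2 * cabs2 z.
    move=> k1; have k0 : 0 < k by apply: lt_le_trans k1.
    rewrite cabs2M ler_wpM2r ?cabs2_ge0// cabs2E /cfac cabs_real gtr0_norm ?invr_gt0 ?exprn_gt0//.
    apply: lerXn2r; rewrite ?nnegrE ?invr_ge0 ?exprn_ge0 ?(ltW k0)//.
    by rewrite lef_pV2 ?posrE ?exprn_gt0// exprS ler_peMr ?(ltW k0)// exprn_ege1.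
  apply: (@le_trans _ _ (\sum_(x <- xs) 3 * (cabs2 (ft F' (1^-1 *: x))
      + 2^-1 ^+ 2 * cabs2 (ft F' (2^-1 *: x)) + 3^-1 ^+ 2 * cabs2 (ft F' (3^-1 *: x))))).
    apply: ler_sum => x _; apply: le_trans (cabs2D3 _ _ _) _.
    rewrite invr1 scale1r ler_pM2l//; apply: lerD; last by apply: c2; rewrite ler1n.
    by apply: lerD => //; apply: c2; rewrite ler1n.
  rewrite -mulr_sumr ler_pM2l// 2!big_split /= -!mulr_sumr.
  have := s1x xs uxs xE; have := s2x xs uxs xE; have := s3x xs uxs xE.
  have : 0 <= s1 * s2 by rewrite mulr_ge0.
  have : 0 <= s1 * s3 by rewrite mulr_ge0.
  have : 0 <= s2 * s3 by rewrite mulr_ge0.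
  have -> : m ^+ 2 = s1 ^+ 2 + s2 ^+ 2 / 4 + s3 ^+ 2 / 9 + s1 * s2 + 2 / 3 * (s1 * s3) + 3^-1 * (s2 * s3).
    by rewrite /m; field.
  have e2 : 2^-1 ^+ 2 = 4^-1 :> R by field.
  have e3 : 3^-1 ^+ 2 = 9^-1 :> R by field.
  rewrite e2 e3.
  set X1 := \sum_(x <- xs) cabs2 (ft F' (1^-1 *: x)).
  set X2 := \sum_(x <- xs) cabs2 (ft F' (2^-1 *: x)).
  set X3 := \sum_(x <- xs) cabs2 (ft F' (3^-1 *: x)).
  move: (s1 * s2) (s1 * s3) (s2 * s3) (s1 ^+ 2) (s2 ^+ 2) (s3 ^+ 2) X1 X2 X3 => p12 p13 p23 q1 q2 q3 X1 X2 X3.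
  clear.
  lra.
(* For N = 0 the left side vanishes by the convention 0^-1 = 0. *)
rewrite /=; have [N00|Nn0] := eqVneq N 0.
  by rewrite N00 sqrtr0 invr0 mulr0.
have Np : 0 < N by rewrite lt_neqAle eq_sym Nn0.
rewrite ler_pdivrMr ?sqrtr_gt0//.
have a0 : 0 <= (27 * C)^-1 by rewrite invr_ge0 mulr_ge0// ltW.
have sq0 (x : R) : 0 <= Num.sqrt x by exact: sqrtr_ge0.
rewrite -(@ler_pXn2r _ 2)// ?nnegrE ?mulr_ge0// !exprMn !sqr_sqrtr//.
rewrite mulrC ler_pdivrMr ?mulr_gt0//.
apply: (@le_trans _ _ (G * G)); first by rewrite expr2 ler_pM.
have G0 : 0 <= G := le_trans nu0 nuG.
apply: (@le_trans _ _ (9 * N * (C * (3 * m ^+ 2)))); first exact: ler_pM.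
lra.
Qed.

End main.

Theorem theorem4p2 (R : realType) (d : nat) (E Lambda : set 'rV[R]_d) :
  (0 < d)%N ->
  is_separated E ->
  compact Lambda -> S_set Lambda -> strict_multiplicity Lambda ->
  is_convex Lambda -> is_symmetric Lambda ->
  balayage E Lambda ->
  exists A B : R, [/\ 0 < A, 0 < B &
    forall F : 'rV[R]_d -> R[i], PW_F Lambda F ->
    let f := PW_fun Lambda F in
    f <> (fun=> 0) ->
    let normF2 := (\int[@lebesgue_d R d]_(g in (Lambda : set (@Rd R d)))
                     (cabs2 (F (vec_of g)))%:E)%E in
    let num := (\int[@lebesgue_d R d]_(g in (Lambda : set (@Rd R d)))
         (cabs2 (F (vec_of g) + F (2 *: vec_of g) + F (3 *: vec_of g)))%:E)%E in
    let S (k : R) := esqrt (\esum_(x in E) (cabs2 (f (k^-1 *: x)))%:E)%E in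
    let mid := (S 1%R + (2^-1)%:E * S 2%R + (3^-1)%:E * S 3%R)%E in
    ((Num.sqrt A)%:E * num * ((Num.sqrt (fine normF2))^-1)%:E <= mid)%E /\
    (mid <= (Num.sqrt B)%:E * esqrt normF2)%E].
Proof.
case: d E Lambda => [//|n] E Lambda _ sepE cL _ _ vL sL bal.
exact: frame_inequalities.
Qed.
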